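(* Let $\mathbf{X}$ be a geometric stack, $p\colon X\to\mathbf{X}$ a presentation with $X$ affine, and $A_\bullet$ the corresponding Hopf algebroid. The categories $\mathsf{Desc}_{\mathsf{qc}}(X/\mathbf{X})$ and $A_\bullet\text{-}\mathsf{coMod}$ are equivalent.
   Context: Stacks are stacks in groupoids for the étale topology on affine schemes over a fixed base scheme; algebraic stacks are in the sense of Laumon–Moret-Bailly. A geometric stack is an algebraic stack $\mathbf{X}$ whose diagonal is representable by affine schemes and which admits a smooth surjective morphism from an affine scheme. A presentation is a surjective flat finitely presented 1-morphism $p\colon X\to\mathbf{X}$ with $X$ an affine scheme (for instance a smooth surjective one). Put $X_1=X\times_{\mathbf{X}}X$ (an affine scheme), with projections $p_1,p_2\colon X_1\to X$, and let $p_{ij}\colon X\times_{\mathbf{X}}X\times_{\mathbf{X}}X\to X_1$ be the projections on the indicated factors. Sheaves on an affine scheme $Z$ are taken on the site $\mathsf{Aff}_{\mathsf{fppf}}/Z$ of flat finitely presented affine $Z$-schemes, with coverings the finite jointly surjective families of flat finitely presented maps; $\mathcal{O}_Z(U)=\Gamma(U,\mathcal{O}_U)$. A sheaf of $\mathcal{O}_Z$-modules $\mathcal{M}$ is quasi-coherent if every object $V$ has a covering $\{V_i\to V\}$ such that on each slice site over $V_i$ there is an exact sequence $\mathcal{O}|_{V_i}^{(I)}\to\mathcal{O}|_{V_i}^{(J)}\to\mathcal{M}|_{V_i}\to0$ with $I,J$ sets. $\mathsf{Desc}_{\mathsf{qc}}(X/\mathbf{X})$ is the category of pairs $(\mathcal{G},t)$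 with $\mathcal{G}$ a quasi-coherent sheaf on $X$ and $t\colon p_2^*\mathcal{G}\to p_1^*\mathcal{G}$ an isomorphism of $\mathcal{O}_{X_1}$-modules with $p_{12}^*t\circ p_{23}^*t=p_{13}^*t$; morphisms $(\mathcal{G},t)\to(\mathcal{G}',t')$ are morphisms $h\colon\mathcal{G}\to\mathcal{G}'$ with $p_1^*h\circ t=t'\circ p_2^*h$. Here $(p_i^*\mathcal{G})(W,w)=\mathcal{G}(W,p_iw)$, and similarly for $p_{ij}^*$. The Hopf algebroid $A_\bullet=(A_0,A_1)$: $X=\operatorname{Spec}(A_0)$, $X_1=\operatorname{Spec}(A_1)$; $\eta_L,\eta_R\colon A_0\to A_1$ correspond to $p_1,p_2$; the counit $\epsilon\colon A_1\to A_0$ corresponds to the diagonal $X\to X_1$; the conjugation $\kappa\colon A_1\to A_1$ corresponds to interchanging factors; and, identifying $X\times_{\mathbf{X}}X\times_{\mathbf{X}}X$ with $\operatorname{Spec}(A_1\,{}_{\eta_R}\otimes_{\eta_L}A_1)$ so that $b\mapsto b\otimes1$ and $b\mapsto1\otimes b$ correspond to $p_{12}$ and $p_{23}$, the comultiplication $\nabla\colon A_1\to A_1\,{}_{\eta_R}\otimes_{\eta_L}A_1$ corresponds to $p_{13}$. A (left) $A_\bullet$-comodule is an $A_0$-module $M$ with an $A_0$-linear map $\psi_M\colon M\to A_1\,{}_{\eta_R}\otimes_{A_0}M$ (target an $A_0$-module via $\eta_L$) such that $(\nabla\otimes\mathrm{id})\psi_M=(\mathrm{id}\otimes\psi_M)\psi_M$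 and $(\epsilon\otimes\mathrm{id})\psi_M=\mathrm{id}_M$. Morphisms are $A_0$-linear maps $\lambda\colon M\to M'$ with $(\mathrm{id}\otimes\lambda)\psi_M=\psi_{M'}\lambda$. $A_\bullet\text{-}\mathsf{coMod}$ is the resulting category. *)

(* Defs.v *)
From HB Require Import structures.
From mathcomp Require Import all_boot all_order all_algebra.
From mathcomp Require Import generic_quotient.
From mathcomp Require Import boolp functions.
Set Implicit Arguments.
Unset Strict Implicit.
Unset Printing Implicit Defensive.
Import GRing.Theory.
Local Open Scope ring_scope.
Local Open Scope quotient_scope.

Lemma rmorph_eq (A B : pzRingType) (f g : {rmorphism A -> B}) : f =1 g -> f = g.
Proof.
case: f => f [[f1] [f2]]; case: g => g [[g1] [g2]] /= /funext e.
subst g.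
by rewrite (Prop_irrelevance f1 g1) (Prop_irrelevance f2 g2).
Qed.

Lemma lin_eq (A : pzRingType) (M N : lmodType A) (f g : {linear M -> N}) :
  f =1 g -> f = g.
Proof.
case: f => f [[f1] [f2]]; case: g => g [[g1] [g2]] /= /funext e.
subst g.
by rewrite (Prop_irrelevance f1 g1) (Prop_irrelevance f2 g2).
Qed.

Definition rid (A : pzRingType) : {rmorphism A -> A} :=
  GRing.RMorphism.clone A A idfun _.
Definition rcomp (A B C : pzRingType) (g : {rmorphism B -> C})
  (f : {rmorphism A -> B}) : {rmorphism A -> C} :=
  GRing.RMorphism.clone A C (g \o f) _.
Definition lid (A : pzRingType) (M : lmodType A) : {linear M -> M} :=
  GRing.Linear.clone A M M _ idfun _.
Definition lcomp (A : pzRingType) (M N P : lmodType A) (g : {linear N -> P})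
  (f : {linear M -> N}) : {linear M -> P} :=
  GRing.Linear.clone A M P _ (g \o f) _.

Definition mklin (A : pzRingType) (M N : lmodType A) (f : M -> N)
    (fl : linear f) : {linear M -> N} :=
  HB.pack f (GRing.isLinear.Build A M N *:%R f fl).

Definition restr (A B : comPzRingType) (f : {rmorphism A -> B})
  (M : lmodType B) : Type := M.

Section Restr.
Context (A B : comPzRingType) (f : {rmorphism A -> B}) (M : lmodType B).
Local Notation restr := (restr f M).
HB.instance Definition _ := GRing.Zmodule.copy restr M.
Definition restr_scale (a : A) (m : restr) : restr := f a *: (m : M).
Fact restr_scaleA a b m : restr_scale a (restr_scale b m) = restr_scale (a * b) m.
Proof. by rewrite /restr_scale scalerA rmorphM. Qed.
Fact restr_scale1 : left_id 1 restr_scale.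
Proof. by move=> m; rewrite /restr_scale rmorph1 scale1r. Qed.
Fact restr_scaleDr : right_distributive restr_scale +%R.
Proof. by move=> a m n; rewrite /restr_scale scalerDr. Qed.
Fact restr_scaleDl m : {morph restr_scale^~ m : a b / a + b}.
Proof. by move=> a b; rewrite /restr_scale rmorphD scalerDl. Qed.
HB.instance Definition _ := GRing.Zmodule_isLmodule.Build A restr
  restr_scaleA restr_scale1 restr_scaleDr restr_scaleDl.
End Restr.

Section Tensor.
Context (A B : comPzRingType) (f : {rmorphism A -> B}) (M : lmodType A).

Definition balanced (Z : zmodType) (g : B -> M -> Z) : Prop :=
  [/\ forall b b' m, g (b + b') m = g b m + g b' m,
      forall b m m', g b (m + m') = g b m + g b m'
    & forall b a m, g (b * f a) m = g b (a *: m)].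

Definition fsum (Z : zmodType) (g : B -> M -> Z) (s : seq (B * M)) : Z :=
  \sum_(p <- s) g p.1 p.2.

(* The quotient by this relation is B (x)_A M: two formal sums are identified
   exactly when no balanced map into an abelian group separates them. *)
Definition tens_rel (s t : seq (B * M)) : bool :=
  `[< forall (Z : zmodType) (g : B -> M -> Z), balanced g -> fsum g s = fsum g t >].

Fact tens_rel_equiv : equiv_class_of tens_rel.
Proof.
split.
- by move=> s; apply/asboolP.
- by move=> s t; apply/asboolP/asboolP => h Z g bg; rewrite h.
- by move=> t s u /asboolP h /asboolP k; apply/asboolP => Z g bg; rewrite h // k.
Qed.
Canonical tens_equivrel := EquivRelPack tens_rel_equiv.

Definition tens : Type := {eq_quot tens_equivrel}.
HB.instance Definition _ := Choice.on tens.

Definition tcls (s : seq (B * M)) : tens := \pi_({eq_quot tens_equivrel}) s.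
Definition trep (x : tens) : seq (B * M) := repr (x : {eq_quot tens_equivrel}).
Definition pure (b : B) (m : M) : tens := tcls [:: (b, m)].
Definition tlift (Z : zmodType) (g : B -> M -> Z) (x : tens) : Z := fsum g (trep x).

Lemma tlift_cls (Z : zmodType) (g : B -> M -> Z) s :
  balanced g -> tlift g (tcls s) = fsum g s.
Proof.
move=> bg; rewrite /tlift /trep /tcls.
have /eqmodP /asboolP h : repr (\pi_({eq_quot tens_equivrel}) s) =
  s %[mod {eq_quot tens_equivrel}] by rewrite reprK.
exact: h.
Qed.

Lemma tens_ext (x y : tens) :
  (forall (Z : zmodType) (g : B -> M -> Z), balanced g -> tlift g x = tlift g y) ->
  x = y.
Proof.
move=> h; rewrite -[x](@reprK _ {eq_quot tens_equivrel}).
rewrite -[y](@reprK _ {eq_quot tens_equivrel}).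
by apply/eqmodP/asboolP => Z g bg; apply: h.
Qed.

Lemma tlift_pure (Z : zmodType) (g : B -> M -> Z) b m :
  balanced g -> tlift g (pure b m) = g b m.
Proof. by move=> bg; rewrite tlift_cls // /fsum big_seq1. Qed.

Lemma balanced0l (Z : zmodType) (g : B -> M -> Z) m : balanced g -> g 0 m = 0.
Proof. by case=> h _ _; apply: (addrI (g 0 m)); rewrite -h !addr0. Qed.
Lemma balancedNl (Z : zmodType) (g : B -> M -> Z) b m :
  balanced g -> g (- b) m = - g b m.
Proof.
move=> bg; apply: (addrI (g b m)); rewrite subrr -(balanced0l m bg).
by case: bg => <- _ _; rewrite subrr.
Qed.

Definition tens0 : tens := tcls [::].
Definition tens_add (x y : tens) : tens := tcls (trep x ++ trep y).
Definition tens_opp (x : tens) : tens := tcls [seq (- p.1, p.2) | p <- trep x].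

Section TliftRules.
Context (Z : zmodType) (g : B -> M -> Z) (bg : balanced g).
Fact tlift0' : tlift g tens0 = 0.
Proof. by rewrite tlift_cls // /fsum big_nil. Qed.
Fact tliftD' x y : tlift g (tens_add x y) = tlift g x + tlift g y.
Proof. by rewrite tlift_cls // /fsum big_cat. Qed.
Fact tliftN' x : tlift g (tens_opp x) = - tlift g x.
Proof.
rewrite tlift_cls // /tlift /fsum big_map -sumrN.
by apply: eq_bigr => p _; rewrite balancedNl.
Qed.
End TliftRules.

Fact tens_addA : associative tens_add.
Proof. by move=> x y z; apply: tens_ext => Z g bg; rewrite !tliftD' // addrA. Qed.
Fact tens_addC : commutative tens_add.
Proof. by move=> x y; apply: tens_ext => Z g bg; rewrite !tliftD' // addrC. Qed.
Fact tens_add0 : left_id tens0 tens_add.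
Proof. by move=> x; apply: tens_ext => Z g bg; rewrite !tliftD' // tlift0' // add0r. Qed.
Fact tens_addN : left_inverse tens0 tens_opp tens_add.
Proof.
by move=> x; apply: tens_ext => Z g bg; rewrite !tliftD' // tlift0' // tliftN' // addNr.
Qed.
HB.instance Definition _ := GRing.isZmodule.Build tens
  tens_addA tens_addC tens_add0 tens_addN.

Lemma tlift0 (Z : zmodType) (g : B -> M -> Z) : balanced g -> tlift g 0 = 0.
Proof. exact: tlift0'. Qed.
Lemma tliftD (Z : zmodType) (g : B -> M -> Z) :
  balanced g -> {morph tlift g : x y / x + y}.
Proof. by move=> bg x y; apply: tliftD'. Qed.
Lemma tlift_sum (Z : zmodType) (g : B -> M -> Z) (I : Type) (r : seq I) (F : I -> tens) :
  balanced g -> tlift g (\sum_(i <- r) F i) = \sum_(i <- r) tlift g (F i).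
Proof. by move=> bg; apply: big_morph; [apply: tliftD | apply: tlift0]. Qed.

Lemma pure_balanced : balanced pure.
Proof.
split=> [b b' m|b m m'|b a m]; apply: tens_ext => Z g bg;
  rewrite ?tliftD // !tlift_pure //; by case: bg.
Qed.

Lemma tens_sumE (x : tens) : x = \sum_(p <- trep x) pure p.1 p.2.
Proof.
apply: tens_ext => Z g bg; rewrite tlift_sum //.
by apply: eq_bigr => p _; rewrite tlift_pure.
Qed.

Lemma tens_ind (P : tens -> Prop) :
  P 0 -> (forall b m, P (pure b m)) -> (forall x y, P x -> P y -> P (x + y)) ->
  forall x, P x.
Proof. by move=> P0 P1 PD x; rewrite (tens_sumE x); apply: big_ind. Qed.

Definition tens_scale (c : B) (x : tens) : tens :=
  tlift (fun b m => pure (c * b) m) x.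
Fact tens_scale_balanced c : balanced (fun b m => pure (c * b) m).
Proof.
case: pure_balanced => h1 h2 h3.
by split=> [b b' m|b m m'|b a m]; rewrite ?mulrDr ?h1 ?h2 // mulrA h3.
Qed.
Fact tens_scale_pure c b m : tens_scale c (pure b m) = pure (c * b) m.
Proof. by rewrite /tens_scale tlift_pure //; exact: tens_scale_balanced. Qed.
Fact tens_scaleDr : right_distributive tens_scale +%R.
Proof. by move=> c; apply: tliftD; exact: tens_scale_balanced. Qed.
Fact tens_scale0 c : tens_scale c 0 = 0.
Proof. by apply: tlift0; exact: tens_scale_balanced. Qed.
Fact tens_scaleA a b x : tens_scale a (tens_scale b x) = tens_scale (a * b) x.
Proof.
elim/tens_ind: x => [|c m|x y hx hy]; rewrite ?tens_scale0 //.
  by rewrite !tens_scale_pure mulrA.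
by rewrite !tens_scaleDr hx hy.
Qed.
Fact tens_scale1 : left_id 1 tens_scale.
Proof.
move=> x; elim/tens_ind: x => [|c m|x y hx hy]; rewrite ?tens_scale0 //.
  by rewrite !tens_scale_pure mul1r.
by rewrite !tens_scaleDr hx hy.
Qed.
Fact tens_scaleDl x : {morph tens_scale^~ x : a b / a + b}.
Proof.
move=> a b; elim/tens_ind: x => [|c m|x y hx hy]; rewrite ?tens_scale0 ?addr0 //.
  by rewrite !tens_scale_pure mulrDl; case: pure_balanced => ->.
by rewrite !tens_scaleDr hx hy addrACA.
Qed.
HB.instance Definition _ := GRing.Zmodule_isLmodule.Build B tens
  tens_scaleA tens_scale1 tens_scaleDr tens_scaleDl.
Lemma scale_pure c b m : c *: pure b m = pure (c * b) m.
Proof. exact: tens_scale_pure. Qed.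

End Tensor.

Section TensorFunctoriality.
Context (A B : comPzRingType) (f : {rmorphism A -> B}).

Section Map.
Context (M N : lmodType A) (l : {linear M -> N}).
Definition tmap_fun (x : tens f M) : tens f N := tlift (fun b m => pure f b (l m)) x.
Fact tmap_balanced : balanced f (fun b m => pure f b (l m)).
Proof.
case: (pure_balanced f N) => h1 h2 h3.
by split=> [b b' m|b m m'|b a m]; rewrite ?linearD ?linearZ ?h1 ?h2 // h3.
Qed.
Lemma tmap_pure b m : tmap_fun (pure f b m) = pure f b (l m).
Proof. by rewrite /tmap_fun tlift_pure //; exact: tmap_balanced. Qed.
Fact tmap_linear : linear tmap_fun.
Proof.
have hD x y : tmap_fun (x + y) = tmap_fun x + tmap_fun y.
  exact: (tliftD tmap_balanced).
have h0 : tmap_fun 0 = 0 by exact: (tlift0 tmap_balanced).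
move=> c x y; rewrite hD; congr (_ + _).
elim/tens_ind: x => [|b m|x z hx hz]; rewrite ?scaler0 ?h0 ?scaler0 //.
  by rewrite scale_pure !tmap_pure scale_pure.
by rewrite scalerDr !hD hx hz scalerDr.
Qed.
Definition tmap : {linear tens f M -> tens f N} := mklin tmap_linear.
End Map.

Lemma tmap_id (M : lmodType A) (x : tens f M) : tmap (lid M) x = x.
Proof.
elim/tens_ind: x => [|b m|x y hx hy]; first exact: linear0.
  exact: (tmap_pure (lid M) b m).
by rewrite linearD hx hy.
Qed.
Lemma tmap_comp (M N P : lmodType A) (l' : {linear N -> P}) (l : {linear M -> N})
  (x : tens f M) : tmap (lcomp l' l) x = tmap l' (tmap l x).
Proof.
elim/tens_ind: x => [|b m|x y hx hy]; first by rewrite !linear0.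
  by rewrite [LHS]tmap_pure [tmap l _]tmap_pure [RHS]tmap_pure.
by rewrite !linearD hx hy.
Qed.

Section Base.
Context (C : comPzRingType) (g : {rmorphism B -> C}) (f' : {rmorphism A -> C}).
Context (e : forall a, g (f a) = f' a) (M : lmodType A).
(* b (x) m |-> g b (x) m *)
Definition tbase (_ : forall a, g (f a) = f' a) (x : tens f M) : tens f' M :=
  tlift (fun b m => pure f' (g b) m) x.
Fact tbase_balanced : balanced f (fun b (m : M) => pure f' (g b) m).
Proof.
case: (pure_balanced f' M) => h1 h2 h3.
by split=> [b b' m|b m m'|b a m]; rewrite ?rmorphD ?rmorphM ?h1 ?h2 // e h3.
Qed.
Lemma tbase_pure b m : tbase e (pure f b m) = pure f' (g b) m.
Proof. by rewrite /tbase tlift_pure //; exact: tbase_balanced. Qed.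
Lemma tbaseD : {morph tbase e : x y / x + y}.
Proof. exact: (tliftD tbase_balanced). Qed.
Lemma tbase0 : tbase e 0 = 0.
Proof. exact: (tlift0 tbase_balanced). Qed.
Lemma tbaseZ b x : tbase e (b *: x) = g b *: tbase e x.
Proof.
elim/tens_ind: x => [|c m|x z hx hz]; rewrite ?scaler0 ?tbase0 ?scaler0 //.
  by rewrite scale_pure !tbase_pure scale_pure rmorphM.
by rewrite scalerDr !tbaseD hx hz scalerDr.
Qed.
End Base.

End TensorFunctoriality.

Section TensorRing.
Context (A B C : comPzRingType) (f : {rmorphism A -> B}) (g : {rmorphism A -> C}).

Definition tensR : Type := tens f (restr g C^o).
HB.instance Definition _ := GRing.Zmodule.on tensR.
Definition pureR (b : B) (c : C) : tensR := pure f b (c : restr g C^o).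
Definition mulR_aux (b : B) (c : C) (y : tensR) : tensR :=
  tlift (fun b' (c' : restr g C^o) => pureR (b * b') (c * (c' : C))) y.
Definition mulR (x y : tensR) : tensR :=
  tlift (fun b (c : restr g C^o) => mulR_aux b c y) x.
Definition oneR : tensR := pureR 1 1.

Lemma pureRDl b b' c : pureR (b + b') c = pureR b c + pureR b' c.
Proof. by case: (pure_balanced f (restr g C^o)). Qed.
Lemma pureRDr b c c' : pureR b (c + c') = pureR b c + pureR b c'.
Proof. by case: (pure_balanced f (restr g C^o)). Qed.
Lemma pureR_bal b a c : pureR (b * f a) c = pureR b (g a * c).
Proof. by case: (pure_balanced f (restr g C^o)). Qed.
Lemma tensR_ind (P : tensR -> Prop) :
  P 0 -> (forall b c, P (pureR b c)) -> (forall x y, P x -> P y -> P (x + y)) ->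
  forall x, P x.
Proof. exact: (@tens_ind _ _ f (restr g C^o) P). Qed.

Fact mulR_aux_bal b c :
  balanced f (fun b' (c' : restr g C^o) => pureR (b * b') (c * (c' : C))).
Proof.
split=> [b' b'' m|b' m m'|b' a m].
- by rewrite mulrDr pureRDl.
- by rewrite mulrDr pureRDr.
- by rewrite mulrA pureR_bal; congr (pureR _ _); rewrite mulrCA.
Qed.
Fact mulR_auxD b c x y : mulR_aux b c (x + y) = mulR_aux b c x + mulR_aux b c y.
Proof. exact: (tliftD (mulR_aux_bal b c)). Qed.
Fact mulR_aux0 b c : mulR_aux b c 0 = 0.
Proof. exact: (tlift0 (mulR_aux_bal b c)). Qed.
Fact mulR_aux_pure b c b' c' : mulR_aux b c (pureR b' c') = pureR (b * b') (c * c').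
Proof. by rewrite /mulR_aux (tlift_pure _ _ (mulR_aux_bal b c)). Qed.
Fact mulR_bal y : balanced f (fun b (c : restr g C^o) => mulR_aux b c y).
Proof.
split=> [b b' c|b c c'|b a c]; elim/tensR_ind: y => [|u v|x y hx hy];
  rewrite ?mulR_aux0 ?addr0 // ?mulR_aux_pure ?mulR_auxD.
- by rewrite mulrDl pureRDl.
- by rewrite hx hy addrACA.
- by rewrite mulrDl pureRDr.
- by rewrite hx hy addrACA.
- by rewrite mulrAC pureR_bal mulrA.
- by rewrite hx hy.
Qed.
Fact mulR_pure b c b' c' : mulR (pureR b c) (pureR b' c') = pureR (b * b') (c * c').
Proof. by rewrite /mulR (tlift_pure _ _ (mulR_bal _)) mulR_aux_pure. Qed.
Fact mulRDl : left_distributive mulR +%R.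
Proof. by move=> x y z; apply: (tliftD (mulR_bal z)). Qed.
Fact mul0R x : mulR 0 x = 0.
Proof. exact: (tlift0 (mulR_bal x)). Qed.
Fact mulRDr' x y z : mulR x (y + z) = mulR x y + mulR x z.
Proof.
elim/tensR_ind: x => [|b c|x x' hx hx']; rewrite ?mul0R ?addr0 //.
  by rewrite /mulR !(tlift_pure _ _ (mulR_bal _)) mulR_auxD.
by rewrite !mulRDl hx hx' addrACA.
Qed.
Fact mulR0 x : mulR x 0 = 0.
Proof. by apply: (addrI (mulR x 0)); rewrite -mulRDr' !addr0. Qed.
Fact mulRC : commutative mulR.
Proof.
move=> x y; elim/tensR_ind: x => [|b c|x x' hx hx']; rewrite ?mul0R ?mulR0 //.
  elim/tensR_ind: y => [|b' c'|y y' hy hy']; rewrite ?mul0R ?mulR0 //.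
    by rewrite !mulR_pure mulrC [c * _]mulrC.
  by rewrite mulRDr' mulRDl hy hy'.
by rewrite mulRDr' mulRDl hx hx'.
Qed.
Fact mulRA : associative mulR.
Proof.
move=> x y z; elim/tensR_ind: x => [|b c|x x' hx hx']; rewrite ?mul0R //.
  elim/tensR_ind: y => [|b' c'|y y' hy hy']; rewrite ?mulR0 ?mul0R ?mulR0 //.
    elim/tensR_ind: z => [|b2 c2|z z' hz hz']; rewrite ?mulR0 //.
      by rewrite !mulR_pure !mulrA.
    by rewrite !mulRDr' hz hz'.
  by rewrite mulRDl !mulRDr' mulRDl hy hy'.
by rewrite !mulRDl hx hx'.
Qed.
Fact mul1R : left_id oneR mulR.
Proof.
move=> x; elim/tensR_ind: x => [|b c|x x' hx hx']; rewrite ?mulR0 //.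
  by rewrite mulR_pure !mul1r.
by rewrite mulRDr' hx hx'.
Qed.
HB.instance Definition _ := GRing.Zmodule_isComPzRing.Build tensR
  mulRA mulRC mul1R mulRDl.

Definition tinl_fun (b : B) : tensR := pureR b 1.
Definition tinr_fun (c : C) : tensR := pureR 1 c.
Fact tinl_zmod : zmod_morphism tinl_fun.
Proof.
move=> b b'; apply: (addIr (tinl_fun b')); rewrite subrK -pureRDl.
by rewrite subrK.
Qed.
Fact tinr_zmod : zmod_morphism tinr_fun.
Proof.
move=> b b'; apply: (addIr (tinr_fun b')); rewrite subrK -pureRDr.
by rewrite subrK.
Qed.
Fact tinl_mon : monoid_morphism tinl_fun.
Proof. by split=> // b b'; rewrite /tinl_fun [RHS]mulR_pure mulr1. Qed.
Fact tinr_mon : monoid_morphism tinr_fun.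
Proof. by split=> // b b'; rewrite /tinr_fun [RHS]mulR_pure mulr1. Qed.
HB.instance Definition _ := GRing.isZmodMorphism.Build B tensR tinl_fun tinl_zmod.
HB.instance Definition _ := GRing.isZmodMorphism.Build C tensR tinr_fun tinr_zmod.
HB.instance Definition _ := GRing.isMonoidMorphism.Build B tensR tinl_fun tinl_mon.
HB.instance Definition _ := GRing.isMonoidMorphism.Build C tensR tinr_fun tinr_mon.
Definition tinl : {rmorphism B -> tensR} := GRing.RMorphism.clone B tensR tinl_fun _.
Definition tinr : {rmorphism C -> tensR} := GRing.RMorphism.clone C tensR tinr_fun _.
Lemma tinlr a : tinl (f a) = tinr (g a).
Proof. by rewrite /= /tinl_fun -[f a]mul1r pureR_bal mulr1. Qed.

(* b (x) c |-> u b * v c *)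
Definition tcopair (D : comPzRingType) (u : B -> D) (v : C -> D) (t : tensR) : D :=
  tlift (fun b (c : restr g C^o) => u b * v c) t.

Lemma tcopairE (D : comPzRingType) (h : {rmorphism tensR -> D}) (u : B -> D) (v : C -> D) :
  (forall b, h (tinl b) = u b) -> (forall c, h (tinr c) = v c) ->
  forall t, tcopair u v t = h t.
Proof.
move=> hu hv.
have hE b c : u b * v c = h (pureR b c).
  rewrite -hu -hv -rmorphM; congr (h _).
  by rewrite [LHS]mulR_pure mulr1 mul1r.
have bal : balanced f (fun b (c : restr g C^o) => u b * v c).
  split=> [b b' c|b c c'|b a c]; rewrite !hE.
  - by rewrite pureRDl rmorphD.
  - by rewrite pureRDr rmorphD.
  - by rewrite pureR_bal.
elim/tensR_ind => [|b c|x y hx hy].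
- by rewrite /tcopair (tlift0 bal) rmorph0.
- by rewrite /tcopair (tlift_pure _ _ bal).
- by rewrite /tcopair (tliftD bal) rmorphD [X in X + _]hx [X in _ + X]hy.
Qed.

Section Copair.
Context (D : comPzRingType) (u : {rmorphism B -> D}) (v : {rmorphism C -> D}).
Context (uv : forall a, u (f a) = v (g a)).
Fact tcopair_bal : balanced f (fun b (c : restr g C^o) => u b * v c).
Proof.
split=> [b b' c|b c c'|b a c]; first by rewrite rmorphD mulrDl.
  by rewrite rmorphD mulrDr.
by rewrite rmorphM -mulrA uv -rmorphM.
Qed.
Fact tcopair_pure b c : tcopair u v (pureR b c) = u b * v c.
Proof. exact: (tlift_pure _ _ tcopair_bal). Qed.
Fact tcopairD : {morph tcopair u v : s t / s + t}.
Proof. exact: (tliftD tcopair_bal). Qed.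
Fact tcopair0 : tcopair u v 0 = 0.
Proof. exact: (tlift0 tcopair_bal). Qed.
Fact tcopair_zmod : zmod_morphism (tcopair u v).
Proof.
by move=> s t; apply: (addIr (tcopair u v t)); rewrite subrK -tcopairD subrK.
Qed.
Fact tcopair_mon : monoid_morphism (tcopair u v).
Proof.
split=> [|s t]; first by rewrite tcopair_pure !rmorph1 mulr1.
elim/tensR_ind: s => [|b c|s s' hs hs']; rewrite ?mul0r ?tcopair0 ?mul0r //.
  elim/tensR_ind: t => [|b' c'|t t' ht ht']; rewrite ?mulr0 ?tcopair0 ?mulr0 //.
    by rewrite [pureR b c * _]mulR_pure !tcopair_pure !rmorphM mulrACA.
  by rewrite mulrDr !tcopairD ht ht' mulrDr.
by rewrite mulrDl !tcopairD hs hs' mulrDl.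
Qed.
Definition tcopair_mor : {rmorphism tensR -> D} :=
  HB.pack (tcopair u v) (GRing.isZmodMorphism.Build tensR D (tcopair u v) tcopair_zmod)
    (GRing.isMonoidMorphism.Build tensR D (tcopair u v) tcopair_mon).
Lemma tcopair_inl b : tcopair_mor (tinl b) = u b.
Proof. by rewrite /= tcopair_pure rmorph1 mulr1. Qed.
Lemma tcopair_inr c : tcopair_mor (tinr c) = v c.
Proof. by rewrite /= tcopair_pure rmorph1 mul1r. Qed.
End Copair.
End TensorRing.

Definition flat (A B : comPzRingType) (f : {rmorphism A -> B}) : Prop :=
  forall (M N : lmodType A) (l : {linear M -> N}), injective l -> injective (tmap f l).

Inductive pexpr (R I : Type) : Type :=
| PVar of I
| PCst of R
| PAdd of pexpr R I & pexpr R I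
| PMul of pexpr R I & pexpr R I.
Arguments PVar {R I}.
Arguments PCst {R I}.

Fixpoint peval (R I : Type) (C : comPzRingType) (h : R -> C) (c : I -> C)
  (p : pexpr R I) : C :=
  match p with
  | PVar i => c i
  | PCst a => h a
  | PAdd p q => peval h c p + peval h c q
  | PMul p q => peval h c p * peval h c q
  end.

(* B is A[x_i | i in I] / (r_j | j in J) with I, J finite, the class of x_i
   being b i: the b i generate B, and every solution of the relations r in an
   A-algebra C is the image of b under an A-algebra morphism B -> C.  (The
   library's polynomials exclude the zero ring.) *)
Definition finitely_presented (A B : comPzRingType) (f : {rmorphism A -> B}) : Prop :=
  exists (I J : finType) (r : J -> pexpr A I) (b : I -> B),
  [/\ forall y, exists p, peval f b p = y,
      forall j, peval f b (r j) = 0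
    & forall (C : comPzRingType) (h : {rmorphism A -> C}) (c : I -> C),
        (forall j, peval h c (r j) = 0) ->
        exists g : {rmorphism B -> C},
          (forall a, g (f a) = h a) /\ (forall i, g (b i) = c i)].

Definition flat_fp (A B : comPzRingType) (f : {rmorphism A -> B}) : Prop :=
  flat f /\ finitely_presented f.

Definition square_zero_ext (C D : comPzRingType) (q : {rmorphism C -> D}) : Prop :=
  (forall d, exists c, q c = d) /\ (forall x y, q x = 0 -> q y = 0 -> x * y = 0).

Definition is_lifting (A B C D : comPzRingType) (f : {rmorphism A -> B})
  (q : {rmorphism C -> D}) (u : {rmorphism A -> C}) (v : {rmorphism B -> D})
  (w : {rmorphism B -> C}) : Prop :=
  (forall a, w (f a) = u a) /\ (forall b, q (w b) = v b).

Definition formally_smooth (A B : comPzRingType) (f : {rmorphism A -> B}) : Prop :=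
  forall (C D : comPzRingType) (q : {rmorphism C -> D}) (u : {rmorphism A -> C})
    (v : {rmorphism B -> D}),
  square_zero_ext q -> (forall a, q (u a) = v (f a)) -> exists w, is_lifting f q u v w.

Definition formally_etale (A B : comPzRingType) (f : {rmorphism A -> B}) : Prop :=
  forall (C D : comPzRingType) (q : {rmorphism C -> D}) (u : {rmorphism A -> C})
    (v : {rmorphism B -> D}),
  square_zero_ext q -> (forall a, q (u a) = v (f a)) -> exists! w, is_lifting f q u v w.

Definition smooth (A B : comPzRingType) (f : {rmorphism A -> B}) : Prop :=
  formally_smooth f /\ finitely_presented f.
Definition etale (A B : comPzRingType) (f : {rmorphism A -> B}) : Prop :=
  formally_etale f /\ finitely_presented f.

Record prime_ideal (A : comPzRingType) (P : A -> Prop) : Prop := PrimeIdeal {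
  prime_id0 : P 0;
  prime_idD : forall a b, P a -> P b -> P (a + b);
  prime_idMl : forall a b, P b -> P (a * b);
  prime_id1 : ~ P 1;
  prime_idM : forall a b, P (a * b) -> P a \/ P b }.

(* The maps Spec (B i) -> Spec A are jointly surjective. *)
Definition jointly_surjective (A : comPzRingType) (I : Type) (B : I -> comPzRingType)
  (f : forall i, {rmorphism A -> B i}) : Prop :=
  forall P : A -> Prop, prime_ideal P ->
  exists i, exists2 Q : B i -> Prop, prime_ideal Q & forall a, P a <-> Q (f i a).

Definition spec_surjective (A B : comPzRingType) (f : {rmorphism A -> B}) : Prop :=
  jointly_surjective (fun _ : unit => f).

Lemma flat_comp (A B C : comPzRingType) (f : {rmorphism A -> B})
  (g : {rmorphism B -> C}) : flat f -> flat g -> flat (rcomp g f).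
Proof.
move=> ff fg M N l li.
pose to (P : lmodType A) (x : tens (rcomp g f) P) : tens g (tens f P) :=
  tlift (fun c (m : P) => pure g c (pure f 1 m)) x.
have tob (P : lmodType A) : balanced (rcomp g f) (fun c (m : P) => pure g c (pure f 1 m)).
  case: (pure_balanced g (tens f P)) => h1 h2 h3.
  case: (pure_balanced f P) => k1 k2 k3.
  split=> [c c' m|c m m'|c a m]; rewrite ?h1 ?k2 ?h2 //.
  by rewrite h3 scale_pure -k3 mul1r mulr1.
have e a : g (f a) = rcomp g f a by [].
pose fro (P : lmodType A) (y : tens g (tens f P)) : tens (rcomp g f) P :=
  tlift (fun c (x : tens f P) => c *: tbase e x) y.
have frob (P : lmodType A) : balanced g (fun c (x : tens f P) => c *: tbase e x).
  split=> [c c' x|c x y|c b x]; rewrite ?scalerDl //.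
    by rewrite tbaseD scalerDr.
  by rewrite tbaseZ scalerA.
have toK (P : lmodType A) (x : tens (rcomp g f) P) : fro P (to P x) = x.
  elim/tens_ind: x => [|c m|x y hx hy].
  - by rewrite /to (tlift0 (tob P)) /fro (tlift0 (frob P)).
  - rewrite /to (tlift_pure _ _ (tob P)) /fro (tlift_pure _ _ (frob P)).
    by rewrite tbase_pure scale_pure rmorph1 mulr1.
  - by rewrite /to (tliftD (tob P)) /fro (tliftD (frob P)) [X in X + _]hx [X in _ + X]hy.
have nat (x : tens (rcomp g f) M) :
    to N (tmap (rcomp g f) l x) = tmap g (tmap f l) (to M x).
  elim/tens_ind: x => [|c m|x y hx hy].
  - by rewrite linear0 /to !(tlift0 (tob _)) linear0.
  - by rewrite [tmap _ _ _]tmap_pure /to !(tlift_pure _ _ (tob _)) [RHS]tmap_pure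
      [tmap f l _]tmap_pure.
  - by rewrite linearD /to !(tliftD (tob _)) linearD [X in X + _]hx [X in _ + X]hy.
have ii := fg _ _ _ (ff _ _ _ li).
move=> x y exy; rewrite -[x]toK -[y]toK; congr fro; apply: ii.
by rewrite -!nat exy.
Qed.

Lemma fp_comp (A B C : comPzRingType) (f : {rmorphism A -> B})
  (g : {rmorphism B -> C}) :
  finitely_presented f -> finitely_presented g -> finitely_presented (rcomp g f).
Proof.
move=> [I [J [r [b [gen rel univ]]]]] [I' [J' [s [c [gen' rel' univ']]]]].
pose rep y := sval (cid (gen y)).
have repE y : peval f b (rep y) = y by rewrite /rep; case: cid.
pose ren := fix ren (p : pexpr A I) : pexpr A (I + I')%type :=
  match p with
  | PVar i => PVar (inl i) | PCst a => PCst a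
  | PAdd p q => PAdd (ren p) (ren q) | PMul p q => PMul (ren p) (ren q) end.
pose lft := fix lft (p : pexpr B I') : pexpr A (I + I')%type :=
  match p with
  | PVar i => PVar (inr i) | PCst y => ren (rep y)
  | PAdd p q => PAdd (lft p) (lft q) | PMul p q => PMul (lft p) (lft q) end.
have renE (D : comPzRingType) (h : A -> D) d p :
    peval h d (ren p) = peval h (d \o inl) p.
  by elim: p => //= p -> q ->.
have evalM (D E : comPzRingType) (R K : Type) (h : R -> D) (k : {rmorphism D -> E})
    (d : K -> D) p : k (peval h d p) = peval (k \o h) (k \o d) p.
  by elim: p => //= p <- q <-; rewrite ?rmorphD ?rmorphM.
have evalE (D : comPzRingType) (R K : Type) (h h' : R -> D) (d d' : K -> D) p :
    h =1 h' -> d =1 d' -> peval h d p = peval h' d' p.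
  by move=> e1 e2; elim: p => //= p -> q ->.
have lftE (D : comPzRingType) (h : A -> D) d (k : {rmorphism B -> D}) p :
    k \o f =1 h -> k \o b =1 d \o inl -> peval h d (lft p) = peval k (d \o inr) p.
  move=> e1 e2; elim: p => [i|y|p hp q hq|p hp q hq] //=; rewrite ?hp ?hq //.
  rewrite renE -[in RHS](repE y) evalM; apply: evalE => // i; by [rewrite -e1|rewrite -e2].
pose bc (k : I + I') : C := match k with inl i => g (b i) | inr i => c i end.
exists (I + I')%type, (J + J')%type.
exists (fun k => match k with inl j => ren (r j) | inr j => lft (s j) end), bc.
split.
- move=> y; have [p <-] := gen' y; exists (lft p).
  by rewrite (lftE _ _ _ g).
- case=> j; last by rewrite (lftE _ _ _ g) // rel'.
  by rewrite renE -(rmorph0 g) -(rel j) evalM.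
- move=> D h d hd.
  have [j|k [k1 k2]] := univ D h (d \o inl); first by rewrite -renE (hd (inl j)).
  have [j|m [m1 m2]] := univ' D k (d \o inr).
    by rewrite -(lftE _ h) // (hd (inr j)).
  exists m; split=> [a|[i|i]] /=; first by rewrite m1 k1.
    by rewrite m1 k2.
  by rewrite m2.
Qed.

Lemma flat_fp_comp (A B C : comPzRingType) (f : {rmorphism A -> B})
  (g : {rmorphism B -> C}) : flat_fp f -> flat_fp g -> flat_fp (rcomp g f).
Proof.
by move=> [f1 f2] [g1 g2]; split; [apply: flat_comp | apply: fp_comp].
Qed.

Lemma flat_fp_iso (A B : comPzRingType) (f : {rmorphism A -> B})
  (g : {rmorphism B -> A}) : cancel f g -> cancel g f -> flat_fp f.
Proof.
move=> fK gK; split.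
  move=> M N l li.
  have tE (P : lmodType A) (x : tens f P) : exists m, x = pure f 1 m.
    case: (pure_balanced f P) => h1 h2 h3.
    elim/tens_ind: x => [|b m|x y [m ->] [n ->]]; last by exists (m + n).
      exists 0; apply: (addrI (pure f 1 0)); by rewrite -h2 !addr0.
    by exists (g b *: m); rewrite -h3 gK mul1r.
  have bal (P : lmodType A) : balanced f (fun b (m : P) => g b *: m).
    split=> [b b' m|b m m'|b a m]; rewrite ?rmorphD ?scalerDl ?scalerDr //.
    by rewrite rmorphM fK scalerA.
  have pinj (P : lmodType A) (m n : P) : pure f 1 m = pure f 1 n -> m = n.
    move=> /(congr1 (tlift (fun b (m : P) => g b *: m))).
    by rewrite !(tlift_pure _ _ (bal P)) rmorph1 !scale1r.
  move=> x y; have [m ->] := tE _ x; have [n ->] := tE _ y.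
  by rewrite /= !tmap_pure => /pinj /li ->.
exists void, void, (of_void _), (of_void _).
split=> [y|[]|C h c _]; first by exists (PCst (g y)); rewrite /= gK.
by exists (rcomp h g); split=> [a|[]] /=; rewrite fK.
Qed.
#[local] Obligation Tactic := idtac.

Record category := Category {
  cob :> Type;
  hom : cob -> cob -> Type;
  idc : forall X, hom X X;
  ccomp : forall X Y Z, hom Y Z -> hom X Y -> hom X Z;
  compcA : forall X Y Z W (h : hom Z W) (g : hom Y Z) (f : hom X Y),
    ccomp h (ccomp g f) = ccomp (ccomp h g) f;
  compc1l : forall X Y (f : hom X Y), ccomp (idc Y) f = f;
  compc1r : forall X Y (f : hom X Y), ccomp f (idc X) = f }.
Arguments hom {c}.
Arguments idc {c}.
Arguments ccomp {c X Y Z}.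

Record functor (C D : category) := Functor {
  fob :> C -> D;
  fmor : forall X Y, hom X Y -> hom (fob X) (fob Y);
  fmor_id : forall X, fmor (idc X) = idc (fob X);
  fmor_comp : forall X Y Z (g : hom Y Z) (f : hom X Y),
    fmor (ccomp g f) = ccomp (fmor g) (fmor f) }.

(* The composite G \o F is naturally isomorphic to the identity of C. *)
Definition iso_to_id (C D : category) (F : functor C D) (G : functor D C) : Prop :=
  exists (e : forall X : C, hom (G (F X)) X) (e' : forall X : C, hom X (G (F X))),
  [/\ forall X, ccomp (e X) (e' X) = idc X,
      forall X, ccomp (e' X) (e X) = idc (G (F X))
    & forall X Y (f : hom X Y), ccomp f (e X) = ccomp (e Y) (fmor G (fmor F f))].

Definition equivalent (C D : category) : Prop :=
  exists (F : functor C D) (G : functor D C), iso_to_id F G /\ iso_to_id G F.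

(* A site with finite covering families, and a sheaf of rings. *)
Record ringed_site := RingedSite {
  rcat :> category;
  rO : rcat -> comPzRingType;
  rres : forall V U : rcat, hom V U -> {rmorphism rO U -> rO V};
  rres_id : forall U a, rres (idc U) a = a;
  rres_comp : forall W V U (h : hom V U) (k : hom W V) a,
    rres (ccomp h k) a = rres k (rres h a);
  rcover : forall (U : rcat) (n : nat) (V : 'I_n -> rcat),
    (forall i, hom (V i) U) -> Prop }.

Record modpsh (S : ringed_site) := Modpsh {
  msec :> forall U : S, lmodType (rO U);
  mres : forall V U : S, hom V U -> msec U -> msec V;
  mresD : forall V U (h : hom V U) m m', mres h (m + m') = mres h m + mres h m';
  mresZ : forall V U (h : hom V U) a m, mres h (a *: m) = rres h a *: mres h m;
  mres_id : forall U (m : msec U), mres (idc U) m = m;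
  mres_comp : forall W V U (h : hom V U) (k : hom W V) m,
    mres (ccomp h k) m = mres k (mres h m) }.

Definition is_sheaf (S : ringed_site) (M : modpsh S) : Prop :=
  forall (U : S) (n : nat) (V : 'I_n -> S) (c : forall i, hom (V i) U), rcover c ->
  forall m : forall i, M (V i),
  (forall i j W (k : hom W (V i)) (l : hom W (V j)),
     ccomp (c i) k = ccomp (c j) l -> mres k (m i) = mres l (m j)) ->
  exists! x : M U, forall i, mres (c i) x = m i.

Record modmor (S : ringed_site) (M N : modpsh S) := Modmor {
  mfun :> forall U : S, {linear M U -> N U};
  mnat : forall V U (h : hom V U) m, mfun V (mres h m) = mres h (mfun U m) }.

Lemma modmor_eq (S : ringed_site) (M N : modpsh S) (f g : modmor M N) :
  (forall U m, f U m = g U m) -> f = g.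
Proof.
case: f g => [f nf] [g ng] /= e.
have fg : f = g by apply: functional_extensionality_dep => U; apply: lin_eq => m; exact: e.
by subst g; rewrite (Prop_irrelevance nf ng).
Qed.

Definition mmid (S : ringed_site) (M : modpsh S) : modmor M M :=
  @Modmor S M M (fun U => lid (M U)) (fun _ _ _ _ => erefl).

Program Definition mmcomp (S : ringed_site) (M N P : modpsh S) (g : modmor N P)
  (f : modmor M N) : modmor M P :=
  @Modmor S M P (fun U => lcomp (g U) (f U)) _.
Next Obligation. by move=> S M N P g f V U h m /=; rewrite !mnat. Qed.

Definition mm_iso (S : ringed_site) (M N : modpsh S) (f : modmor M N) : Prop :=
  exists g : modmor N M, mmcomp g f = mmid M /\ mmcomp f g = mmid N.

Section FreeModule.
Context (I : choiceType) (B : comPzRingType).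
Definition finsupp : {pred I -> B^o} :=
  fun x => `[< exists s : seq I, forall i, i \notin s -> x i = 0 >].
Fact finsupp_closed : submod_closed finsupp.
Proof.
split; first by apply/asboolP; exists [::].
move=> a x y /asboolP[s hs] /asboolP[t ht]; apply/asboolP; exists (s ++ t) => i.
rewrite mem_cat negb_or => /andP[his hit].
by change (a *: x i + y i = 0); rewrite hs // ht // scaler0 addr0.
Qed.
HB.instance Definition _ :=
  GRing.isSubmodClosed.Build B (I -> B^o) finsupp finsupp_closed.
Record freemod := Freemod { fmval :> I -> B^o; fmvalP : fmval \in finsupp }.
HB.instance Definition _ := [isSub for fmval].
HB.instance Definition _ := [Choice of freemod by <:].
HB.instance Definition _ := [SubChoice_isSubLmodule of freemod by <:].
End FreeModule.

Section FreeMap.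
Context (I : choiceType) (B C : comPzRingType) (f : {rmorphism B -> C}).
Program Definition fmmap (x : freemod I B) : freemod I C :=
  @Freemod I C (fun i => f (x i)) _.
Next Obligation.
move=> x; have /asboolP[s hs] := fmvalP x; apply/asboolP; exists s => i /hs ->.
exact: rmorph0.
Qed.
End FreeMap.

Lemma freemod_eq (I : choiceType) (B : comPzRingType) (x y : freemod I B) :
  (forall i, x i = y i) -> x = y.
Proof. by move=> e; apply: val_inj; apply: funext. Qed.

(* O^(I).  Coverings being finite, this presheaf is already a sheaf. *)
Program Definition free_mod (S : ringed_site) (I : choiceType) : modpsh S :=
  @Modpsh S (fun U => freemod I (rO U)) (fun V U h => fmmap (rres h)) _ _ _ _.
Next Obligation.
by move=> S I V U h x y; apply: freemod_eq => i; exact: (rmorphD (rres h) (x i) (y i)).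
Qed.
Next Obligation.
by move=> S I V U h a x; apply: freemod_eq => i; exact: (rmorphM (rres h) a (x i)).
Qed.
Next Obligation.
by move=> S I U x; apply: freemod_eq => i; exact: rres_id.
Qed.
Next Obligation.
by move=> S I W V U h k x; apply: freemod_eq => i; exact: rres_comp.
Qed.

(* Exactness of M --a--> N --b--> P --> 0 as sheaves. *)
Definition right_exact (S : ringed_site) (M N P : modpsh S) (a : modmor M N)
  (b : modmor N P) : Prop :=
  [/\ forall U x, b U (a U x) = 0,
      forall U (y : N U), b U y = 0 ->
        exists n (V : 'I_n -> S) (c : forall i, hom (V i) U),
          rcover c /\ forall i, exists x, a (V i) x = mres (c i) y
    & forall U (z : P U),
        exists n (V : 'I_n -> S) (c : forall i, hom (V i) U),
          rcover c /\ forall i, exists y, b (V i) y = mres (c i) z].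

Section Slice.
Context (S : ringed_site) (T : S).
Record slice_ob := SliceOb { sl_ob : S; sl_map : hom sl_ob T }.
Record slice_hom (V U : slice_ob) := SliceHom {
  sl_hom : hom (sl_ob V) (sl_ob U);
  sl_homE : ccomp (sl_map U) sl_hom = sl_map V }.
Lemma slice_hom_eq V U (f g : slice_hom V U) : sl_hom f = sl_hom g -> f = g.
Proof.
by case: f g => [f ef] [g eg] /= e; subst g; rewrite (Prop_irrelevance ef eg).
Qed.
Program Definition slice_cat : category := @Category slice_ob slice_hom
  (fun U => @SliceHom U U (idc _) _)
  (fun U V W g f => @SliceHom U W (ccomp (sl_hom g) (sl_hom f)) _) _ _ _.
Next Obligation. by move=> U; rewrite compc1r. Qed.
Next Obligation. by move=> U V W g f; rewrite compcA !sl_homE. Qed.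
Next Obligation. by move=> *; apply: slice_hom_eq; exact: compcA. Qed.
Next Obligation. by move=> *; apply: slice_hom_eq; exact: compc1l. Qed.
Next Obligation. by move=> *; apply: slice_hom_eq; exact: compc1r. Qed.

Program Definition slice : ringed_site := @RingedSite slice_cat
  (fun U => rO (sl_ob U)) (fun V U h => rres (sl_hom h)) _ _
  (fun U n V c => rcover (fun i => sl_hom (c i))).
Next Obligation. by move=> U a; exact: rres_id. Qed.
Next Obligation. by move=> W V U h k a; exact: rres_comp. Qed.

Program Definition mod_slice (M : modpsh S) : modpsh slice :=
  @Modpsh slice (fun U => M (sl_ob U)) (fun V U h => mres (sl_hom h)) _ _ _ _.
Next Obligation. by move=> M V U h m m'; exact: mresD. Qed.
Next Obligation. by move=> M V U h a m; exact: mresZ. Qed.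
Next Obligation. by move=> M U m; exact: mres_id. Qed.
Next Obligation. by move=> M W V U h k m; exact: mres_comp. Qed.
End Slice.

Definition quasi_coherent (S : ringed_site) (M : modpsh S) : Prop :=
  forall V : S, exists n (W : 'I_n -> S) (c : forall i, hom (W i) V),
  rcover c /\
  forall i, exists (I J : choiceType)
    (a : modmor (free_mod (slice (W i)) I) (free_mod (slice (W i)) J))
    (b : modmor (free_mod (slice (W i)) J) (mod_slice (W i) M)),
  right_exact a b.

Section Fppf.
Context (A : comPzRingType).
Record fppf_ob := FppfOb {
  fp_ring :> comPzRingType;
  fp_str : {rmorphism A -> fp_ring};
  fp_flat : flat_fp fp_str }.
(* Arrows of affine schemes are written with the direction of the schemes. *)
Record fppf_hom (V U : fppf_ob) := FppfHom {
  fp_map :> {rmorphism U -> V};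
  fp_mapE : forall a, fp_map (fp_str U a) = fp_str V a }.
Lemma fppf_hom_eq V U (f g : fppf_hom V U) : fp_map f =1 fp_map g -> f = g.
Proof.
case: f g => [f ef] [g eg] /= /rmorph_eq e; subst g.
by rewrite (Prop_irrelevance ef eg).
Qed.
Program Definition fppf_cat : category := @Category fppf_ob fppf_hom
  (fun U => @FppfHom U U (rid U) _)
  (fun U V W g f => @FppfHom U W (rcomp f g) _) _ _ _.
Next Obligation. by []. Qed.
Next Obligation. by move=> U V W g f a /=; rewrite !fp_mapE. Qed.
Next Obligation. by move=> *; apply: fppf_hom_eq. Qed.
Next Obligation. by move=> *; apply: fppf_hom_eq. Qed.
Next Obligation. by move=> *; apply: fppf_hom_eq. Qed.

Program Definition fppf : ringed_site := @RingedSite fppf_cat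
  fp_ring (fun V U h => fp_map h) _ _
  (fun U n V c => (forall i, flat_fp (fp_map (c i))) /\
                  jointly_surjective (fun i => fp_map (c i))).
Next Obligation. by []. Qed.
Next Obligation. by []. Qed.
End Fppf.

Section Pullback.
Context (A B : comPzRingType) (f : {rmorphism A -> B}) (ff : flat_fp f).

Definition fppf_push (W : fppf B) : fppf A :=
  @FppfOb A (fp_ring W) (rcomp (fp_str W) f) (flat_fp_comp ff (fp_flat W)).
Definition fppf_push_hom (V U : fppf B) (h : hom V U) :
  hom (fppf_push V) (fppf_push U) :=
  @FppfHom A (fppf_push V) (fppf_push U) (fp_map h) (fun a => fp_mapE h (f a)).

Program Definition pull (G : modpsh (fppf A)) : modpsh (fppf B) :=
  @Modpsh (fppf B) (fun W => G (fppf_push W)) (fun V U h => mres (fppf_push_hom h))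
    _ _ _ _.
Next Obligation. by move=> G V U h m m'; exact: mresD. Qed.
Next Obligation. by move=> G V U h a m; exact: mresZ. Qed.
Next Obligation.
move=> G U m; rewrite -[RHS](mres_id (m : G (fppf_push U))); congr mres.
exact: fppf_hom_eq.
Qed.
Next Obligation.
move=> G W V U h k m; apply: etrans (mres_comp _ _ (m : G (fppf_push U))).
congr mres.
exact: fppf_hom_eq.
Qed.

Definition pull_mor (G G' : modpsh (fppf A)) (h : modmor G G') :
  modmor (pull G) (pull G') :=
  @Modmor (fppf B) (pull G) (pull G') (fun W => h (fppf_push W))
    (fun V U k m => mnat h (fppf_push_hom k) m).
End Pullback.

Section PullbackSquare.
Context (A B B' D : comPzRingType).
Context (g : {rmorphism A -> B}) (f : {rmorphism B -> D}).
Context (g' : {rmorphism A -> B'}) (f' : {rmorphism B' -> D}).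
Context (gg : flat_fp g) (ff : flat_fp f) (gg' : flat_fp g') (ff' : flat_fp f').
Context (e : forall a, f (g a) = f' (g' a)).

Program Definition push_square (W : fppf D) :
  hom (fppf_push gg' (fppf_push ff' W)) (fppf_push gg (fppf_push ff W)) :=
  @FppfHom A (fppf_push gg' (fppf_push ff' W)) (fppf_push gg (fppf_push ff W))
    (rid W) _.
Next Obligation. by move=> W a /=; rewrite e. Qed.

(* The canonical identification f^* g^* G = f'^* g'^* G when f \o g = f' \o g'. *)
Definition pull_square_fun (G : modpsh (fppf A)) (W : fppf D)
    (m : pull ff (pull gg G) W) : pull ff' (pull gg' G) W :=
  mres (push_square W) m.
Fact pull_square_linear G W : linear (@pull_square_fun G W).
Proof. by move=> a x y; rewrite /pull_square_fun mresD mresZ. Qed.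
Program Definition pull_square (G : modpsh (fppf A)) :
  modmor (pull ff (pull gg G)) (pull ff' (pull gg' G)) :=
  @Modmor (fppf D) (pull ff (pull gg G)) (pull ff' (pull gg' G))
    (fun W => mklin (@pull_square_linear G W)) _.
Next Obligation.
move=> G V U h m.
have e1 := mres_comp (push_square U) (fppf_push_hom gg' (fppf_push_hom ff' h))
  (m : G (fppf_push gg (fppf_push ff U))).
have e2 := mres_comp (fppf_push_hom gg (fppf_push_hom ff h)) (push_square V)
  (m : G (fppf_push gg (fppf_push ff U))).
apply: etrans (esym e2) (etrans _ e1); congr mres.
exact: fppf_hom_eq.
Qed.
End PullbackSquare.

(* The rings and face maps of the Cech diagram of a flat covering by an affine
   scheme: fd1, fd2 for p_1, p_2 and fd12, fd23, fd13 for p_12, p_23, p_13. *)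
Record flat_groupoid := FlatGroupoid {
  fg0 : comPzRingType;
  fg1 : comPzRingType;
  fg2 : comPzRingType;
  fd1 : {rmorphism fg0 -> fg1};
  fd2 : {rmorphism fg0 -> fg1};
  fd12 : {rmorphism fg1 -> fg2};
  fd23 : {rmorphism fg1 -> fg2};
  fd13 : {rmorphism fg1 -> fg2};
  fd1_flat : flat_fp fd1;
  fd2_flat : flat_fp fd2;
  fd12_flat : flat_fp fd12;
  fd23_flat : flat_fp fd23;
  fd13_flat : flat_fp fd13;
  face1 : forall a, fd13 (fd1 a) = fd12 (fd1 a);
  face2 : forall a, fd23 (fd1 a) = fd12 (fd2 a);
  face3 : forall a, fd23 (fd2 a) = fd13 (fd2 a) }.

Section Descent.
Context (X : flat_groupoid).
Local Notation p1 := (pull (fd1_flat X)).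
Local Notation p2 := (pull (fd2_flat X)).

(* p_12^* t \o p_23^* t = p_13^* t, up to the identifications
   p_23^* p_1^* = p_12^* p_2^*, p_13^* p_1^* = p_12^* p_1^* and
   p_23^* p_2^* = p_13^* p_2^*. *)
Definition cocycle (G : modpsh (fppf (fg0 X))) (t : modmor (p2 G) (p1 G)) : Prop :=
  mmcomp (pull_mor (fd12_flat X) t)
    (mmcomp (pull_square (fd1_flat X) (fd23_flat X) (fd2_flat X) (fd12_flat X) (@face2 X) G)
            (pull_mor (fd23_flat X) t)) =
  mmcomp (pull_square (fd1_flat X) (fd13_flat X) (fd1_flat X) (fd12_flat X) (@face1 X) G)
    (mmcomp (pull_mor (fd13_flat X) t)
       (pull_square (fd2_flat X) (fd23_flat X) (fd2_flat X) (fd13_flat X) (@face3 X) G)).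

Record desc_ob := DescOb {
  de_sh : modpsh (fppf (fg0 X));
  de_sheaf : is_sheaf de_sh;
  de_qc : quasi_coherent de_sh;
  de_t : modmor (p2 de_sh) (p1 de_sh);
  de_iso : mm_iso de_t;
  de_cocycle : cocycle de_t }.

Record desc_hom (D E : desc_ob) := DescHom {
  de_h : modmor (de_sh D) (de_sh E);
  de_comm : mmcomp (pull_mor (fd1_flat X) de_h) (de_t D) =
            mmcomp (de_t E) (pull_mor (fd2_flat X) de_h) }.

Lemma desc_hom_eq D E (f g : desc_hom D E) :
  (forall U m, de_h f U m = de_h g U m) -> f = g.
Proof.
case: f g => [f ef] [g eg] h; have /= e := modmor_eq h; subst g.
by rewrite (Prop_irrelevance ef eg).
Qed.

Lemma mmcompE (S : ringed_site) (M N N' P : modpsh S) (g : modmor N P)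
  (f : modmor M N) (g' : modmor N' P) (f' : modmor M N') : mmcomp g f = mmcomp g' f' ->
  forall U m, g U (f U m) = g' U (f' U m).
Proof. by move=> e U m; have := congr1 (fun k : modmor M P => k U m) e. Qed.

Program Definition desc_qc : category := @Category desc_ob desc_hom
  (fun D => @DescHom D D (mmid _) _)
  (fun D E F g f => @DescHom D F (mmcomp (de_h g) (de_h f)) _) _ _ _.
Next Obligation. by move=> D; apply: modmor_eq. Qed.
Next Obligation.
move=> D E F g f; apply: modmor_eq => U m /=.
have ef := mmcompE (de_comm f) m.
have eg := mmcompE (de_comm g) (pull_mor (fd2_flat X) (de_h f) U m).
by move: eg; rewrite -ef.
Qed.
Next Obligation. by move=> *; apply: desc_hom_eq. Qed.
Next Obligation. by move=> *; apply: desc_hom_eq. Qed.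
Next Obligation. by move=> *; apply: desc_hom_eq. Qed.
End Descent.

Record hopf_algebroid := HopfAlgebroid {
  ha0 : comPzRingType;
  ha1 : comPzRingType;
  etaL : {rmorphism ha0 -> ha1};
  etaR : {rmorphism ha0 -> ha1};
  eps : {rmorphism ha1 -> ha0};
  kappa : {rmorphism ha1 -> ha1};
  nabla : {rmorphism ha1 -> tensR etaR etaL};
  eps_etaL : forall a, eps (etaL a) = a;
  eps_etaR : forall a, eps (etaR a) = a;
  kappa_etaL : forall a, kappa (etaL a) = etaR a;
  kappa_etaR : forall a, kappa (etaR a) = etaL a;
  kappaK : forall b, kappa (kappa b) = b;
  nabla_etaL : forall a, nabla (etaL a) = tinl etaR etaL (etaL a);
  nabla_etaR : forall a, nabla (etaR a) = tinr etaR etaL (etaR a);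
  nabla_epsl : forall b, tcopair (etaL \o eps) id (nabla b) = b;
  nabla_epsr : forall b, tcopair id (etaR \o eps) (nabla b) = b;
  nabla_kappal : forall b, tcopair kappa id (nabla b) = etaR (eps b);
  nabla_kappar : forall b, tcopair id kappa (nabla b) = etaL (eps b);
  nablaA : forall b,
    let f := rcomp (tinr etaR etaL) etaR in
    tcopair (tinl f etaL \o nabla) (tinr f etaL) (nabla b) =
    tcopair (tinl f etaL \o tinl etaR etaL)
      (tcopair (tinl f etaL \o tinr etaR etaL) (tinr f etaL) \o nabla) (nabla b) }.

Section Comodules.
Context (A : hopf_algebroid).
Local Notation A0 := (ha0 A).
Local Notation A1 := (ha1 A).
Local Notation i1 := (tinl (etaR A) (etaL A)).
Local Notation i2 := (tinr (etaR A) (etaL A)).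

Definition coten (M : lmodType A0) := tens (etaR A) M.

(* A1 (x) (A1 (x) M) -> (A1 (x) A1) (x) M, a (x) (b (x) m) |-> (a (x) b) (x) m *)
Definition coten_assoc (M : lmodType A0)
  (x : tens (etaR A) (restr (etaL A) (coten M))) : tens (rcomp i2 (etaR A)) M :=
  tlift (fun a (t : restr (etaL A) (coten M)) =>
    i1 a *: tbase (f' := rcomp i2 (etaR A)) (fun=> erefl) (t : coten M)) x.

(* nabla (x) id *)
Definition coten_nabla (M : lmodType A0) (x : coten M) : tens (rcomp i2 (etaR A)) M :=
  tbase (f' := rcomp i2 (etaR A)) (@nabla_etaR A) x.

(* eps (x) id, followed by A0 (x) M = M *)
Definition coten_eps (M : lmodType A0) (x : coten M) : M :=
  tlift (fun a m => eps A a *: m) x.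

Record comod_ob := ComodOb {
  co_mod : lmodType A0;
  co_psi : {linear co_mod -> restr (etaL A) (coten co_mod)};
  co_assoc : forall m,
    coten_nabla (co_psi m) = coten_assoc (tmap (etaR A) co_psi (co_psi m));
  co_unit : forall m, coten_eps (co_psi m) = m }.

Record comod_hom (M N : comod_ob) := ComodHom {
  co_map : {linear co_mod M -> co_mod N};
  co_mapE : forall m, tmap (etaR A) co_map (co_psi M m) = co_psi N (co_map m) }.

Lemma comod_hom_eq M N (f g : comod_hom M N) : co_map f =1 co_map g -> f = g.
Proof.
case: f g => [f ef] [g eg] /= /lin_eq e; subst g.
by rewrite (Prop_irrelevance ef eg).
Qed.

Program Definition comod : category := @Category comod_ob comod_hom
  (fun M => @ComodHom M M (lid _) _)
  (fun M N P g f => @ComodHom M P (lcomp (co_map g) (co_map f)) _) _ _ _.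
Next Obligation. by move=> M m; rewrite tmap_id. Qed.
Next Obligation.
by move=> M N P g f m; rewrite tmap_comp; rewrite co_mapE [LHS]co_mapE.
Qed.
Next Obligation. by move=> *; apply: comod_hom_eq. Qed.
Next Obligation. by move=> *; apply: comod_hom_eq. Qed.
Next Obligation. by move=> *; apply: comod_hom_eq. Qed.
End Comodules.

Record rfunctor := Rfunctor {
  rf_ob :> comPzRingType -> Type;
  rf_mor : forall A B : comPzRingType, {rmorphism A -> B} -> rf_ob A -> rf_ob B;
  rf_id : forall (A : comPzRingType) (x : rf_ob A), rf_mor (rid A) x = x;
  rf_comp : forall (A B C : comPzRingType) (g : {rmorphism B -> C})
    (f : {rmorphism A -> B}) (x : rf_ob A),
    rf_mor (rcomp g f) x = rf_mor g (rf_mor f x) }.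

Definition is_localization (A L : comPzRingType) (a : A) (l : {rmorphism A -> L}) : Prop :=
  [/\ exists y, l a * y = 1,
      forall y, exists r k, y * l (a ^+ k) = l r
    & forall r, l r = 0 -> exists k, a ^+ k * r = 0].

Definition zariski_sheaf (F : rfunctor) : Prop :=
  forall (A : comPzRingType) (n : nat) (a : 'I_n -> A),
  (exists r : 'I_n -> A, \sum_i r i * a i = 1) ->
  forall (L : 'I_n -> comPzRingType) (l : forall i, {rmorphism A -> L i}),
  (forall i, is_localization (a i) (l i)) ->
  forall x : forall i, F (L i),
  (forall i j (W : comPzRingType) (u : {rmorphism L i -> W}) (v : {rmorphism L j -> W}),
     (forall r, u (l i r) = v (l j r)) -> rf_mor u (x i) = rf_mor v (x j)) ->
  exists! y : F A, forall i, rf_mor (l i) y = x i.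

(* The morphism Spec B -> F given by u is a monomorphism onto an open
   subfunctor: its inverse image along any x : Spec A -> F is the complement of
   the closed subset defined by some E in A. *)
Definition open_immersion (F : rfunctor) (B : comPzRingType) (u : F B) : Prop :=
  (forall (A : comPzRingType) (v w : {rmorphism B -> A}),
     rf_mor v u = rf_mor w u -> v = w) /\
  (forall (A : comPzRingType) (x : F A), exists E : A -> Prop,
     forall (A' : comPzRingType) (f : {rmorphism A -> A'}),
     (exists w : {rmorphism B -> A'}, rf_mor w u = rf_mor f x) <->
     (exists (n : nat) (e : 'I_n -> A) (r : 'I_n -> A'),
        (forall i, E (e i)) /\ \sum_i r i * f (e i) = 1)).

Record scheme := Scheme {
  sch_fun :> rfunctor;
  sch_sheaf : zariski_sheaf sch_fun;
  sch_affine : exists (I : Type) (B : I -> comPzRingType) (u : forall i, sch_fun (B i)),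
    (forall i, open_immersion (u i)) /\
    (forall (K : fieldType) (x : sch_fun K),
       exists i (w : {rmorphism B i -> K}), rf_mor w (u i) = x) }.

Section Aff.
Context (S : scheme).
Record aff_ob := AffOb { af_ring :> comPzRingType; af_str : S af_ring }.
Record aff_hom (V U : aff_ob) := AffHom {
  af_map :> {rmorphism U -> V};
  af_mapE : rf_mor af_map (af_str U) = af_str V }.
Lemma aff_hom_eq V U (f g : aff_hom V U) : af_map f =1 af_map g -> f = g.
Proof.
case: f g => [f ef] [g eg] /= /rmorph_eq e; subst g.
by rewrite (Prop_irrelevance ef eg).
Qed.
Program Definition aff : category := @Category aff_ob aff_hom
  (fun U => @AffHom U U (rid U) (rf_id _))
  (fun U V W g f => @AffHom U W (rcomp f g) _) _ _ _.
Next Obligation. by move=> U V W g f; rewrite rf_comp !af_mapE. Qed.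
Next Obligation. by move=> *; apply: aff_hom_eq. Qed.
Next Obligation. by move=> *; apply: aff_hom_eq. Qed.
Next Obligation. by move=> *; apply: aff_hom_eq. Qed.
End Aff.

(* Categories fibred in groupoids: every arrow is cartesian. *)
Record fibcat (S : scheme) := Fibcat {
  fb :> aff S -> Type;
  fhom : forall V U : aff S, fb V -> fb U -> Type;
  fpr : forall (V U : aff S) (y : fb V) (x : fb U), fhom y x -> hom V U;
  fid : forall (U : aff S) (x : fb U), fhom x x;
  fcomp : forall (W V U : aff S) (z : fb W) (y : fb V) (x : fb U),
    fhom y x -> fhom z y -> fhom z x;
  fcompA : forall (T W V U : aff S) (t : fb T) (z : fb W) (y : fb V) (x : fb U)
    (h : fhom y x) (g : fhom z y) (f : fhom t z),
    fcomp h (fcomp g f) = fcomp (fcomp h g) f;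
  fcomp1l : forall (V U : aff S) (y : fb V) (x : fb U) (f : fhom y x),
    fcomp (fid x) f = f;
  fcomp1r : forall (V U : aff S) (y : fb V) (x : fb U) (f : fhom y x),
    fcomp f (fid y) = f;
  fpr_id : forall (U : aff S) (x : fb U), fpr (fid x) = idc U;
  fpr_comp : forall (W V U : aff S) (z : fb W) (y : fb V) (x : fb U)
    (g : fhom y x) (f : fhom z y), fpr (fcomp g f) = ccomp (fpr g) (fpr f);
  flift : forall (V U : aff S) (h : hom V U) (x : fb U),
    exists (y : fb V) (f : fhom y x), fpr f = h;
  fcart : forall (W V U : aff S) (z : fb W) (y : fb V) (x : fb U)
    (f : fhom y x) (g : fhom z x) (h : hom W V), ccomp (fpr f) h = fpr g ->
    exists! k : fhom z y, fpr k = h /\ fcomp f k = g }.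
Arguments fhom {S _ V U}.
Arguments fpr {S _ V U y x}.
Arguments fid {S _ U}.
Arguments fcomp {S _ W V U z y x}.

Section Stacks.
Context (S : scheme).

Definition etale_cover (U : aff S) (I : Type) (V : I -> aff S)
  (c : forall i, hom (V i) U) : Prop :=
  (forall i, etale (af_map (c i))) /\ jointly_surjective (fun i => af_map (c i)).

Context (X : fibcat S).

(* For x, y over U, the presheaf of morphisms from x to y over U is a sheaf. *)
Definition homs_glue : Prop :=
  forall (U : aff S) (I : Type) (V : I -> aff S) (c : forall i, hom (V i) U),
  etale_cover c ->
  forall (x y : X U) (z : forall i, X (V i))
    (f : forall i, fhom (z i) x) (h : forall i, fhom (z i) y),
  (forall i, fpr (f i) = c i) -> (forall i, fpr (h i) = c i) ->
  (forall i j (T : aff S) (t : X T) (k : fhom t (z i)) (l : fhom t (z j)),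
     fcomp (f i) k = fcomp (f j) l -> fcomp (h i) k = fcomp (h j) l) ->
  exists! g : fhom x y, fpr g = idc U /\ forall i, fcomp g (f i) = h i.

(* Descent data are effective.  By the Yoneda lemma, an isomorphism between the
   inverse images of z i and z j over V i x_U V j is the same as a natural way
   of turning an arrow k : t -> z i, together with a morphism v : T -> V j such
   that fpr k and v agree over U, into an arrow t -> z j over v. *)
Definition objects_glue : Prop :=
  forall (U : aff S) (I : Type) (V : I -> aff S) (c : forall i, hom (V i) U),
  etale_cover c ->
  forall (z : forall i, X (V i))
    (phi : forall i j (T : aff S) (t : X T) (k : fhom t (z i)) (v : hom T (V j)),
       ccomp (c i) (fpr k) = ccomp (c j) v -> fhom t (z j))
    (phi_pr : forall i j T (t : X T) k v e, fpr (phi i j T t k v e) = v),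
  (forall i j T (t : X T) k v e T' (t' : X T') (l : fhom t' t) e',
     phi i j T' t' (fcomp k l) (ccomp v (fpr l)) e' = fcomp (phi i j T t k v e) l) ->
  (forall i j j' T (t : X T) k v v' e e' e'',
     phi j j' T t (phi i j T t k v e) v' e' = phi i j' T t k v' e'') ->
  (forall i T (t : X T) (k : fhom t (z i)) e, phi i i T t k (fpr k) e = k) ->
  exists (x : X U) (f : forall i, fhom (z i) x),
    (forall i, fpr (f i) = c i) /\
    (forall i j T (t : X T) k v e, fcomp (f j) (phi i j T t k v e) = fcomp (f i) k).

Definition is_stack : Prop := homs_glue /\ objects_glue.

(* Objects of X over U are 1-morphisms U -> X.  The 2-fibre product of x : U -> X
   and y : V -> X is the affine scheme W when w over W is a product of x and y in
   the total category of X: an arrow t -> w over T is then a pair of morphisms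
   T -> U, T -> V with an isomorphism between the inverse images of x and y. *)
Definition is_fibre_product (U V W : aff S) (x : X U) (y : X V) (w : X W)
  (f : fhom w x) (g : fhom w y) : Prop :=
  forall (T : aff S) (t : X T) (a : fhom t x) (b : fhom t y),
  exists! h : fhom t w, fcomp f h = a /\ fcomp g h = b.

(* For x, y over U, the sheaf of isomorphisms from x to y is an affine U-scheme. *)
Definition affine_diagonal : Prop :=
  forall (U : aff S) (x y : X U),
  exists (W : aff S) (w : X W) (f : fhom w x) (g : fhom w y), fpr f = fpr g /\
  forall (T : aff S) (t : X T) (a : fhom t x) (b : fhom t y), fpr a = fpr b ->
  exists! h : fhom t w, fcomp f h = a /\ fcomp g h = b.

(* x : U -> X is surjective and has P, both being tested after base change to
   affine schemes V.  The fibre product over such a V is affine, which follows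
   from affine_diagonal as soon as S itself has affine diagonal. *)
Definition is_cover (P : forall A B : comPzRingType, {rmorphism A -> B} -> Prop)
  (U : aff S) (x : X U) : Prop :=
  forall (V : aff S) (y : X V),
  exists (W : aff S) (w : X W) (f : fhom w x) (g : fhom w y),
  [/\ is_fibre_product f g, P _ _ (af_map (fpr g)) & spec_surjective (af_map (fpr g))].

Definition presentation (U : aff S) (x : X U) : Prop := is_cover flat_fp x.
End Stacks.

(* Such a stack is algebraic: its diagonal is affine, so that it is separated
   and quasi-compact, and an affine scheme is an algebraic space. *)
Record geometric_stack (S : scheme) := GeometricStack {
  gs_cat :> fibcat S;
  gs_stack : is_stack gs_cat;
  gs_diag : affine_diagonal gs_cat;
  gs_atlas : exists (U : aff S) (x : gs_cat U), is_cover smooth x }.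

Lemma ex_uniq (T : Type) (P : T -> Prop) (a b : T) :
  (exists! t, P t) -> P a -> P b -> a = b.
Proof. by move=> [t [_ ut]] /ut <- /ut <-. Qed.

Lemma fibre_product_flat (S : scheme) (X : fibcat S) (U V W : aff S) (x : X U)
  (y : X V) (w : X W) (f : fhom w x) (g : fhom w y) :
  presentation x -> is_fibre_product f g -> flat_fp (af_map (fpr g)).
Proof.
move=> hx fp; have [W' [w' [f' [g' [fp' hg' _]]]]] := hx V y.
have [h [[h1 h2] _]] := fp' _ _ f g.
have [k [[k1 k2] _]] := fp _ _ f' g'.
have hk : fcomp h k = fid w'.
  apply: (ex_uniq (fp' _ _ f' g')); split; [| |exact: fcomp1r|exact: fcomp1r].
    by rewrite fcompA h1.
  by rewrite fcompA h2.
have kh : fcomp k h = fid w.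
  apply: (ex_uniq (fp _ _ f g)); split; [| |exact: fcomp1r|exact: fcomp1r].
    by rewrite fcompA k1.
  by rewrite fcompA k2.
have e : af_map (fpr g) = rcomp (af_map (fpr h)) (af_map (fpr g')).
  by rewrite -h2 fpr_comp.
rewrite e; apply: flat_fp_comp hg' _.
apply: (@flat_fp_iso _ _ _ (af_map (fpr k))) => a.
  have := congr1 (fun m : fhom w' w' => af_map (fpr m) a) hk.
  by rewrite fpr_comp fpr_id.
have := congr1 (fun m : fhom w w => af_map (fpr m) a) kh.
by rewrite fpr_comp fpr_id.
Qed.

(* The fibre products of x : U -> X with itself.  The triple one lies over the
   spectrum of A1 (x) A1, with p_12 and p_23 given by b (x) 1 and 1 (x) b.
   All of this exists (cech_exists), and is unique up to unique isomorphism. *)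
Record cech (S : scheme) (X : fibcat S) (U : aff S) (x : X U) := Cech {
  ce_U1 : aff S;
  ce_x1 : X ce_U1;
  ce_q1 : fhom ce_x1 x;
  ce_q2 : fhom ce_x1 x;
  ce_prod : is_fibre_product ce_q1 ce_q2;
  ce_str : S (tensR (af_map (fpr ce_q2)) (af_map (fpr ce_q1)));
  ce_x2 : X (AffOb ce_str);
  ce_q12 : fhom ce_x2 ce_x1;
  ce_q23 : fhom ce_x2 ce_x1;
  ce_q13 : fhom ce_x2 ce_x1;
  ce_inl : forall b, af_map (fpr ce_q12) b = tinl (af_map (fpr ce_q2)) (af_map (fpr ce_q1)) b;
  ce_inr : forall b, af_map (fpr ce_q23) b = tinr (af_map (fpr ce_q2)) (af_map (fpr ce_q1)) b;
  ce_mid : fcomp ce_q2 ce_q12 = fcomp ce_q1 ce_q23;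
  ce_13l : fcomp ce_q1 ce_q13 = fcomp ce_q1 ce_q12;
  ce_13r : fcomp ce_q2 ce_q13 = fcomp ce_q2 ce_q23;
  ce_triple : forall (T : aff S) (t : X T) (a1 a2 a3 : fhom t x),
    exists! h : fhom t ce_x2, [/\ fcomp (fcomp ce_q1 ce_q12) h = a1,
      fcomp (fcomp ce_q2 ce_q12) h = a2 & fcomp (fcomp ce_q2 ce_q23) h = a3];
  ce_diag : fhom x ce_x1;
  ce_diag1 : fcomp ce_q1 ce_diag = fid x;
  ce_diag2 : fcomp ce_q2 ce_diag = fid x;
  ce_swap : fhom ce_x1 ce_x1;
  ce_swap1 : fcomp ce_q1 ce_swap = ce_q2;
  ce_swap2 : fcomp ce_q2 ce_swap = ce_q1 }.

Section Cech.
Context (S : scheme) (X : fibcat S) (U : aff S) (x : X U) (c : cech x).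
Local Notation q1 := (ce_q1 c).
Local Notation q2 := (ce_q2 c).
Local Notation q12 := (ce_q12 c).
Local Notation q23 := (ce_q23 c).
Local Notation q13 := (ce_q13 c).
Local Notation p1 := (af_map (fpr q1)).
Local Notation p2 := (af_map (fpr q2)).

Lemma fprE (W V T : aff S) (z : X W) (y : X V) (t : X T) (g : fhom y t) (f : fhom z y) a :
  af_map (fpr (fcomp g f)) a = af_map (fpr f) (af_map (fpr g) a).
Proof. by rewrite fpr_comp. Qed.
Lemma fpr_idE (V : aff S) (y : X V) a : af_map (fpr (fid y)) a = a.
Proof. by rewrite fpr_id. Qed.

Lemma cech_ext (T : aff S) (t : X T) (a b : fhom t (ce_x1 c)) :
  fcomp q1 a = fcomp q1 b -> fcomp q2 a = fcomp q2 b -> a = b.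
Proof.
by move=> e1 e2; apply: (ex_uniq (ce_prod c (fcomp q1 b) (fcomp q2 b))).
Qed.

Lemma cech_fp1 : is_fibre_product q2 q1.
Proof.
move=> T t a b; have [h [[h1 h2] uh]] := ce_prod c b a.
by exists h; split=> // h' [e1 e2]; apply: uh.
Qed.

Lemma cech_fp12 : is_fibre_product (fcomp q2 q23) q12.
Proof.
move=> T t a b; have [h [[h1 h2 h3] uh]] := ce_triple c (fcomp q1 b) (fcomp q2 b) a.
exists h; split=> [|h' [e1 e2]]; last by apply: uh; rewrite e1 -e2 !fcompA.
by split=> //; apply: cech_ext; rewrite fcompA.
Qed.

Lemma cech_fp23 : is_fibre_product (fcomp q1 q12) q23.
Proof.
move=> T t a b; have [h [[h1 h2 h3] uh]] := ce_triple c a (fcomp q1 b) (fcomp q2 b).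
exists h; split=> [|h' [e1 e2]]; last by apply: uh; rewrite e1 ce_mid -e2 !fcompA.
by split=> //; apply: cech_ext; rewrite fcompA -?ce_mid.
Qed.

Lemma cech_fp13 : is_fibre_product (fcomp q2 q12) q13.
Proof.
move=> T t a b; have [h [[h1 h2 h3] uh]] := ce_triple c (fcomp q1 b) a (fcomp q2 b).
exists h; split=> [|h' [e1 e2]].
  by split=> //; apply: cech_ext; rewrite fcompA ?ce_13l ?ce_13r.
by apply: uh; rewrite e1 -ce_13l -ce_13r -e2 !fcompA.
Qed.

Fact cech_face1 a : af_map (fpr q13) (p1 a) = af_map (fpr q12) (p1 a).
Proof. by rewrite -!fprE ce_13l. Qed.
Fact cech_face2 a : af_map (fpr q23) (p1 a) = af_map (fpr q12) (p2 a).
Proof. by rewrite -!fprE ce_mid. Qed.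
Fact cech_face3 a : af_map (fpr q23) (p2 a) = af_map (fpr q13) (p2 a).
Proof. by rewrite -!fprE ce_13r. Qed.

Definition cech_groupoid (hx : presentation x) : flat_groupoid :=
  @FlatGroupoid (af_ring U) (af_ring (ce_U1 c)) (tensR p2 p1) p1 p2
    (af_map (fpr q12)) (af_map (fpr q23)) (af_map (fpr q13))
    (fibre_product_flat hx cech_fp1) (fibre_product_flat hx (ce_prod c))
    (fibre_product_flat hx cech_fp12) (fibre_product_flat hx cech_fp23)
    (fibre_product_flat hx cech_fp13)
    cech_face1 cech_face2 cech_face3.

Local Notation cnabla := (af_map (fpr q13)).

Lemma cech_pair (T : aff S) (t : X T) (a b m : fhom t (ce_x1 c)) :
  fcomp q2 a = fcomp q1 b -> fcomp q1 m = fcomp q1 a -> fcomp q2 m = fcomp q2 b ->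
  forall r, tcopair (af_map (fpr a)) (af_map (fpr b)) (cnabla r) = af_map (fpr m) r.
Proof.
move=> ab m1 m2 r.
have [h [[h1 h2 h3] _]] :=
  ce_triple c (fcomp q1 a) (fcomp q2 a) (fcomp q2 b).
have ha : fcomp q12 h = a by apply: cech_ext; rewrite fcompA.
have hb : fcomp q23 h = b by apply: cech_ext; rewrite fcompA -?ce_mid ?h2.
have hm : fcomp q13 h = m.
  by apply: cech_ext; rewrite fcompA ?ce_13l ?ce_13r ?h1 ?h3.
rewrite -hm fprE; apply: tcopairE => s.
  by rewrite -ce_inl -ha fprE.
by rewrite -ce_inr -hb fprE.
Qed.

Lemma tcopair_eq (A B C D : comPzRingType) (f : {rmorphism A -> B})
  (g : {rmorphism A -> C}) (u u' : B -> D) (v v' : C -> D) (s : tensR f g) :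
  u =1 u' -> v =1 v' -> tcopair u v s = tcopair u' v' s.
Proof. by move=> /funext -> /funext ->. Qed.

Fact cech_eps_etaL a : af_map (fpr (ce_diag c)) (p1 a) = a.
Proof. by rewrite -fprE ce_diag1 fpr_idE. Qed.
Fact cech_eps_etaR a : af_map (fpr (ce_diag c)) (p2 a) = a.
Proof. by rewrite -fprE ce_diag2 fpr_idE. Qed.
Fact cech_kappa_etaL a : af_map (fpr (ce_swap c)) (p1 a) = p2 a.
Proof. by rewrite -fprE ce_swap1. Qed.
Fact cech_kappa_etaR a : af_map (fpr (ce_swap c)) (p2 a) = p1 a.
Proof. by rewrite -fprE ce_swap2. Qed.
Fact cech_kappaK b : af_map (fpr (ce_swap c)) (af_map (fpr (ce_swap c)) b) = b.
Proof.
rewrite -fprE -[RHS](fpr_idE (ce_x1 c)); congr (af_map (fpr _) b).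
by apply: cech_ext; rewrite fcompA fcomp1r ?ce_swap1 ?ce_swap2 ?ce_swap1.
Qed.
Fact cech_nabla_etaL a : cnabla (p1 a) = tinl p2 p1 (p1 a).
Proof. by rewrite -ce_inl cech_face1. Qed.
Fact cech_nabla_etaR a : cnabla (p2 a) = tinr p2 p1 (p2 a).
Proof. by rewrite -ce_inr cech_face3. Qed.
Fact cech_nabla_epsl b :
  tcopair (p1 \o af_map (fpr (ce_diag c))) id (cnabla b) = b.
Proof.
rewrite -[RHS](fpr_idE (ce_x1 c)).
rewrite -(@cech_pair _ _ (fcomp (ce_diag c) q1) (fid _) (fid _)).
- by apply: tcopair_eq => s /=; rewrite ?fprE ?fpr_idE.
- by rewrite fcompA ce_diag2 fcomp1l fcomp1r.
- by rewrite fcompA ce_diag1 fcomp1l fcomp1r.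
- by [].
Qed.
Fact cech_nabla_epsr b :
  tcopair id (p2 \o af_map (fpr (ce_diag c))) (cnabla b) = b.
Proof.
rewrite -[RHS](fpr_idE (ce_x1 c)).
rewrite -(@cech_pair _ _ (fid _) (fcomp (ce_diag c) q2) (fid _)).
- by apply: tcopair_eq => s /=; rewrite ?fprE ?fpr_idE.
- by rewrite fcompA ce_diag1 fcomp1l fcomp1r.
- by [].
- by rewrite fcompA ce_diag2 fcomp1l fcomp1r.
Qed.
Fact cech_nabla_kappal b :
  tcopair (af_map (fpr (ce_swap c))) id (cnabla b) = p2 (af_map (fpr (ce_diag c)) b).
Proof.
rewrite -fprE -(@cech_pair _ _ (ce_swap c) (fid _) (fcomp (ce_diag c) q2)).
- by apply: tcopair_eq => s //=; rewrite fpr_idE.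
- by rewrite ce_swap2 fcomp1r.
- by rewrite fcompA ce_diag1 fcomp1l ce_swap1.
- by rewrite fcompA ce_diag2 fcomp1l fcomp1r.
Qed.
Fact cech_nabla_kappar b :
  tcopair id (af_map (fpr (ce_swap c))) (cnabla b) = p1 (af_map (fpr (ce_diag c)) b).
Proof.
rewrite -fprE -(@cech_pair _ _ (fid _) (ce_swap c) (fcomp (ce_diag c) q1)).
- by apply: tcopair_eq => s //=; rewrite fpr_idE.
- by rewrite ce_swap1 fcomp1r.
- by rewrite fcompA ce_diag1 fcomp1l fcomp1r.
- by rewrite fcompA ce_diag2 fcomp1l ce_swap2.
Qed.

Fact cech_nablaA b :
  let f := rcomp (tinr p2 p1) p2 in
  tcopair (tinl f p1 \o cnabla) (tinr f p1) (cnabla b) =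
  tcopair (tinl f p1 \o tinl p2 p1)
    (tcopair (tinl f p1 \o tinr p2 p1) (tinr f p1) \o cnabla) (cnabla b).
Proof.
move=> f.
pose V : aff S := @AffOb S (tensR f p1) (rf_mor (tinl f p1) (ce_str c)).
pose j : hom V (AffOb (ce_str c)) := @AffHom S V (AffOb (ce_str c)) (tinl f p1) erefl.
have kE : rf_mor (tinr f p1) (af_str (ce_U1 c)) = af_str V.
  rewrite -(af_mapE (fpr q1)) -rf_comp.
  have -> : rcomp (tinr f p1) p1 = rcomp (rcomp (tinl f p1) (tinr p2 p1)) p2.
    by apply: rmorph_eq => a; rewrite /= -[LHS](tinlr f p1).
  rewrite !rf_comp (af_mapE (fpr q2)); congr rf_mor.
  apply: etrans (af_mapE (fpr q23)); congr (rf_mor _ _).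
  by apply: rmorph_eq => s; rewrite ce_inr.
pose k : hom V (ce_U1 c) := @AffHom S V (ce_U1 c) (tinr f p1) kE.
have [x3 [e eE]] := flift j (ce_x2 c).
have [z [w wE]] := flift k (ce_x1 c).
have [l [[l1 l2] _]] : exists! l : fhom x3 z,
    fpr l = idc V /\ fcomp (fcomp q1 w) l = fcomp (fcomp q2 q23) e.
  apply: fcart; rewrite compc1r; apply: aff_hom_eq => a.
  rewrite !fprE ce_inr eE wE /=.
  by rewrite -[LHS](tinlr f p1).
pose d := fcomp w l.
have dE s : af_map (fpr d) s = tinr f p1 s by rewrite fprE l1 wE.
have e12 s : af_map (fpr (fcomp q12 e)) s = tinl f p1 (tinl p2 p1 s).
  by rewrite fprE ce_inl eE.
have e23 s : af_map (fpr (fcomp q23 e)) s = tinl f p1 (tinr p2 p1 s).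
  by rewrite fprE ce_inr eE.
have e13 s : af_map (fpr (fcomp q13 e)) s = tinl f p1 (cnabla s).
  by rewrite fprE eE.
have d1 : fcomp q1 d = fcomp (fcomp q2 q23) e by rewrite /d fcompA l2.
have [m [[m1 m2] _]] := ce_prod c (fcomp q1 (fcomp q23 e)) (fcomp q2 d).
have [n [[n1 n2] _]] := ce_prod c (fcomp q1 (fcomp q12 e)) (fcomp q2 d).
have mE s : tcopair (tinl f p1 \o tinr p2 p1) (tinr f p1) (cnabla s) = af_map (fpr m) s.
  rewrite -(@cech_pair _ _ (fcomp q23 e) d m) //; last by rewrite fcompA d1.
  by apply: tcopair_eq => r; rewrite ?e23 ?dE.
transitivity (af_map (fpr n) b).
  rewrite -(@cech_pair _ _ (fcomp q13 e) d n) //.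
  - by apply: tcopair_eq => r; rewrite ?e13 ?dE.
  - by rewrite fcompA ce_13r d1.
  - by rewrite n1 !fcompA ce_13l.
rewrite -(@cech_pair _ _ (fcomp q12 e) m n) //.
- by apply: tcopair_eq => r; rewrite ?e12 //= mE.
- by rewrite m1 !fcompA ce_mid.
- by rewrite n2 m2.
Qed.

Definition cech_hopf : hopf_algebroid :=
  @HopfAlgebroid (af_ring U) (af_ring (ce_U1 c)) p1 p2 (af_map (fpr (ce_diag c)))
    (af_map (fpr (ce_swap c))) cnabla
    cech_eps_etaL cech_eps_etaR cech_kappa_etaL cech_kappa_etaR cech_kappaK
    cech_nabla_etaL cech_nabla_etaR cech_nabla_epsl cech_nabla_epsr
    cech_nabla_kappal cech_nabla_kappar cech_nablaA.
End Cech.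

Lemma cech_exists (S : scheme) (X : fibcat S) (U : aff S) (x : X U) :
  presentation x -> inhabited (cech x).
Proof.
move=> hx; have [U1 [x1 [q1 [q2 [fp _ _]]]]] := hx U x.
pose p1 := af_map (fpr q1); pose p2 := af_map (fpr q2).
pose V : aff S := @AffOb S (tensR p2 p1) (rf_mor (tinl p2 p1) (af_str U1)).
pose j : hom V U1 := @AffHom S V U1 (tinl p2 p1) erefl.
have kE : rf_mor (tinr p2 p1) (af_str U1) = af_str V.
  rewrite -(af_mapE (fpr q1)) -rf_comp.
  have -> : rcomp (tinr p2 p1) (af_map (fpr q1)) = rcomp (tinl p2 p1) (af_map (fpr q2)).
    by apply: rmorph_eq => a; rewrite /= -[LHS](tinlr p2 p1).
  by rewrite rf_comp (af_mapE (fpr q2)).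
pose k : hom V U1 := @AffHom S V U1 (tinr p2 p1) kE.
have [x2 [q12 q12E]] := flift j x1.
have [z [w wE]] := flift k x1.
have [l [[l1 l2] _]] : exists! l : fhom x2 z,
    fpr l = idc V /\ fcomp (fcomp q1 w) l = fcomp q2 q12.
  apply: fcart; rewrite compc1r; apply: aff_hom_eq => a.
  by rewrite !fprE q12E wE /= -[LHS](tinlr p2 p1).
pose q23 := fcomp w l.
have q23E s : af_map (fpr q23) s = tinr p2 p1 s by rewrite fprE l1 wE.
have mid : fcomp q2 q12 = fcomp q1 q23 by rewrite /q23 fcompA l2.
have [q13 [[e1 e2] _]] := fp _ _ (fcomp q1 q12) (fcomp q2 q23).
have [dg [[dg1 dg2] _]] := fp _ _ (fid x) (fid x).
have [sw [[sw1 sw2] _]] := fp _ _ q2 q1.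
have inlE b : af_map (fpr q12) b = tinl p2 p1 b by rewrite q12E.
have ext T (t : X T) (a b : fhom t x1) :
    fcomp q1 a = fcomp q1 b -> fcomp q2 a = fcomp q2 b -> a = b.
  by move=> h1 h2; apply: (ex_uniq (fp _ _ (fcomp q1 b) (fcomp q2 b))).
have cext (T W R : aff S) (t : X T) (y : X W) (r : X R) (q : fhom y r) (a b : fhom t y) :
    fpr a = fpr b -> fcomp q a = fcomp q b -> a = b.
  move=> h1 h2.
  have h3 : ccomp (fpr q) (fpr b) = fpr (fcomp q b) by rewrite fpr_comp.
  by apply: (ex_uniq (fcart h3)).
suff tri (T : aff S) (t : X T) (a1 a2 a3 : fhom t x) :
    exists! h : fhom t x2, [/\ fcomp (fcomp q1 q12) h = a1,
      fcomp (fcomp q2 q12) h = a2 & fcomp (fcomp q2 q23) h = a3].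
  exact: (inhabits (@Cech S X U x U1 x1 q1 q2 fp (af_str V) x2 q12 q23 q13 inlE q23E
    mid e1 e2 tri dg dg1 dg2 sw sw1 sw2)).
have [u [[u1 u2] _]] := fp _ _ a1 a2; have [v [[v1 v2] _]] := fp _ _ a2 a3.
have uv a : af_map (fpr u) (p2 a) = af_map (fpr v) (p1 a) by rewrite -!fprE u2 v1.
pose m := tcopair_mor uv.
have mE : rf_mor m (af_str V) = af_str T.
  rewrite /= -rf_comp -(af_mapE (fpr u)); congr (rf_mor _ _).
  by apply: rmorph_eq => s; exact: (tcopair_inl uv).
have [h [[h1 h2] uh]] : exists! h : fhom t x2,
    fpr h = @AffHom S T V m mE /\ fcomp q12 h = u.
  apply: fcart; apply: aff_hom_eq => s; rewrite q12E; exact: (tcopair_inl uv).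
have h3 : fcomp q23 h = v.
  apply: (cext _ _ _ _ _ _ q1); last by rewrite fcompA -mid -fcompA h2 u2.
  apply: aff_hom_eq => s; rewrite fprE h1 q23E; exact: (tcopair_inr uv).
exists h; split; first by split; rewrite -fcompA ?h2 ?h3.
move=> h' [g1 g2 g3]; apply: uh.
have hu : fcomp q12 h' = u by apply: ext; rewrite fcompA ?g1 ?g2.
have hv : fcomp q23 h' = v by apply: ext; rewrite fcompA -?mid ?g2 ?g3.
split=> //; apply: aff_hom_eq => s.
rewrite -(@tcopairE _ _ _ p2 p1 _ (af_map (fpr h')) (af_map (fpr u)) (af_map (fpr v))) //.
  by move=> b; rewrite -inlE -hu fprE.
by move=> b; rewrite -q23E -hv fprE.
Qed.

(* Main.v *)
(* A quasi-coherent sheaf G on the fppf site of an affine scheme Spec A is the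
   sheaf B |-> B (x) G(A).  Locally it is a cokernel of free modules, and
   B |-> B (x) N satisfies faithfully flat descent for every module N, so that the
   cokernel sheaf is B |-> B (x) N for the cokernel N on global sections.
   Globally, tensoring the equalizer that computes G(A) from a covering with a
   flat A-algebra C gives the equalizer that computes G(C).

   An isomorphism t from p_2^* G to p_1^* G then amounts to its inverse evaluated
   on G(A0), that is, to a map psi from M = G(A0) to A1 (x) M; the cocycle
   condition says that psi is coassociative.  Since eps is not flat, t cannot be
   pulled back along the diagonal; but coassociativity alone implies
   psi = psi \o (eps (x) id) \o psi, and psi is injective, so that psi is
   counital.  Conversely a comodule structure extends linearly to a map from
   p_1^* to p_2^*, which is invertible by means of the conjugation kappa. *)
From HB Require Import structures.
From mathcomp Require Import all_boot all_algebra.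
From mathcomp Require Import generic_quotient.
From mathcomp Require Import boolp classical_sets.
Require Import Defs.
Set Implicit Arguments.
Unset Strict Implicit.
Unset Printing Implicit Defensive.
Import GRing.Theory.
Local Open Scope ring_scope.
Local Open Scope quotient_scope.
#[local] Obligation Tactic := idtac.

(** * Base change along semilinear maps *)

(** The modules that occur (sections over an object, restrictions of scalars, cokernels) are rarely
    literal tensor products. Base change is therefore a property [is_bc] of a semilinear map, and
    identifications of iterated tensor products become composition and cancellation of such maps.
    Two notions of covering have to be reconciled: the site speaks of primes, gluing speaks of
    elements that vanish in all base changes. Flatness leads from primes to elements; the way back
    is needed to see that a covering pulled back to a flat [C] is still a covering. Finiteness of
    coverings enters because tensoring has to commute with the product over the covering. The
    injectivity of [psi] comes from the left unit: [eps] splits [etaL], so [m |-> 1 (x) m] into the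
    base change along [etaL] has a retraction, and [t] recovers this map from [psi]. The stack
    itself contributes the flatness and the identities of the face maps; everything else takes place
    over a Hopf algebroid. *)

Section Semilinear.
Context (A B : comPzRingType).

(** Restriction maps of a sheaf change the ring as well as the module. Since [f] is a bare function,
    linear maps are the case [id], and composites of ring maps only have to agree pointwise. *)
Definition semilin (f : A -> B) (M : lmodType A) (N : lmodType B) (u : M -> N) : Prop :=
  (forall x y, u (x + y) = u x + u y) /\ (forall a x, u (a *: x) = f a *: u x).

Context (f : A -> B) (M : lmodType A) (N : lmodType B) (u : M -> N).
Hypothesis su : semilin f u.

Lemma semilinD x y : u (x + y) = u x + u y. Proof. by case: su. Qed.
Lemma semilinZ a x : u (a *: x) = f a *: u x. Proof. by case: su. Qed.
Lemma semilin0 : u 0 = 0.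
Proof. by apply: (addrI (u 0)); rewrite -semilinD !addr0. Qed.
Lemma semilinN x : u (- x) = - u x.
Proof. by apply: (addrI (u x)); rewrite -semilinD !subrr semilin0. Qed.
Lemma semilinB x y : u (x - y) = u x - u y.
Proof. by rewrite semilinD semilinN. Qed.
Lemma semilin_sum (I : Type) (r : seq I) (F : I -> M) :
  u (\sum_(i <- r) F i) = \sum_(i <- r) u (F i).
Proof. by apply: big_morph; [apply: semilinD | apply: semilin0]. Qed.
Lemma semilin_inj : (forall x, u x = 0 -> x = 0) -> injective u.
Proof. by move=> h x y e; apply/subr0_eq/h; rewrite semilinB e subrr. Qed.
End Semilinear.

Lemma linear_semilin (A : comPzRingType) (M N : lmodType A) (u : {linear M -> N}) :
  semilin id u.
Proof. by split=> *; rewrite ?linearD ?linearZ. Qed.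
Lemma semilin_linear (A : comPzRingType) (M N : lmodType A) (u : M -> N) :
  semilin id u -> linear u.
Proof. by move=> [h1 h2] a x y; rewrite h1 h2. Qed.
Lemma semilin_comp (A B C : comPzRingType) (f : A -> B) (g : B -> C) (h : A -> C)
  (M : lmodType A) (N : lmodType B) (P : lmodType C) (u : M -> N) (v : N -> P) :
  semilin f u -> semilin g v -> (forall a, h a = g (f a)) -> semilin h (v \o u).
Proof. by move=> [u1 u2] [v1 v2] e; split=> *; rewrite /= ?u1 ?u2 ?v1 ?v2 ?e. Qed.
Lemma pure_semilin (A B : comPzRingType) (f : {rmorphism A -> B}) (M : lmodType A) :
  semilin f (@pure _ _ f M 1).
Proof.
case: (pure_balanced f M) => h1 h2 h3; split=> [x y|a x]; first exact: h2.
by rewrite scale_pure -h3 mul1r mulr1.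
Qed.
Lemma pureE (A B : comPzRingType) (f : {rmorphism A -> B}) (M : lmodType A) b (m : M) :
  pure f b m = b *: pure f 1 m.
Proof. by rewrite scale_pure mulr1. Qed.
Lemma tbase_semilin (A B C : comPzRingType) (f : {rmorphism A -> B})
  (g : {rmorphism B -> C}) (h : {rmorphism A -> C}) (e : forall a, g (f a) = h a)
  (M : lmodType A) : semilin g (@tbase _ _ f _ g h M e).
Proof. by split=> *; rewrite ?tbaseD ?tbaseZ. Qed.

Section BaseChange.
Context (A B : comPzRingType) (f : {rmorphism A -> B}).
Context (M : lmodType A) (N : lmodType B).

Definition bcmap (u : M -> N) (x : tens f M) : N := tlift (fun b m => b *: u m) x.

(** The comparison map from [B (x) M] to [N] is bijective, that is, [u] exhibits [N] as the base
    change of [M] along [f]. *)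
Definition is_bc (u : M -> N) : Prop :=
  [/\ semilin f u, forall x, bcmap u x = 0 -> x = 0 & forall y, exists x, bcmap u x = y].

Context (u : M -> N).
Hypothesis su : semilin f u.

Lemma bcmap_balanced : balanced f (fun b m => b *: u m).
Proof.
case: su => u1 u2; split=> [b b' m|b m m'|b a m]; first exact: scalerDl.
  by rewrite u1 scalerDr.
by rewrite u2 scalerA.
Qed.
Lemma bcmap_pure b m : bcmap u (pure f b m) = b *: u m.
Proof. exact: (tlift_pure _ _ bcmap_balanced). Qed.
Lemma bcmap1 m : bcmap u (pure f 1 m) = u m.
Proof. by rewrite bcmap_pure scale1r. Qed.
Lemma bcmap_semilin : semilin id (bcmap u).
Proof.
have hD x y : bcmap u (x + y) = bcmap u x + bcmap u y.
  exact: (tliftD bcmap_balanced).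
have h0 : bcmap u 0 = 0 by exact: (tlift0 bcmap_balanced).
split=> // b x; elim/tens_ind: x => [|c m|x y hx hy]; rewrite ?scaler0 ?h0 ?scaler0 //.
  by rewrite scale_pure !bcmap_pure scalerA.
by rewrite scalerDr !hD hx hy scalerDr.
Qed.
End BaseChange.
Arguments bcmap {A B} f {M N} u x.
Arguments is_bc {A B} f {M N} u.

Lemma tens_ext1 (A B C : comPzRingType) (f : {rmorphism A -> B}) (g : B -> C)
  (M : lmodType A) (P : lmodType C) (v w : tens f M -> P) :
  semilin g v -> semilin g w -> (forall m, v (pure f 1 m) = w (pure f 1 m)) -> v =1 w.
Proof.
move=> sv sw e; elim/tens_ind => [|b m|x y hx hy].
- by rewrite (semilin0 sv) (semilin0 sw).
- by rewrite pureE (semilinZ sv) (semilinZ sw) e.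
- by rewrite (semilinD sv) (semilinD sw) hx hy.
Qed.

Section BaseChangeTheory.
Context (A B : comPzRingType) (f : {rmorphism A -> B}).
Context (M : lmodType A) (N : lmodType B) (u : M -> N).

Lemma is_bc_semilin : is_bc f u -> semilin f u. Proof. by case. Qed.
Lemma is_bc_inj : is_bc f u -> injective (bcmap f u).
Proof. by case=> su i _; apply: (semilin_inj (bcmap_semilin su)). Qed.

Lemma bc_ind : is_bc f u -> forall P : N -> Prop, P 0 ->
  (forall b m, P (b *: u m)) -> (forall x y, P x -> P y -> P (x + y)) ->
  forall y, P y.
Proof.
move=> [su _ sj] P P0 P1 PD y; have [x <-] := sj y; have s := bcmap_semilin su.
elim/tens_ind: x => [|b m|x z hx hz]; first by rewrite (semilin0 s).
  by rewrite bcmap_pure.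
by rewrite (semilinD s); apply: PD.
Qed.

Lemma bc_uniq (C : comPzRingType) (g : B -> C) (P : lmodType C) (v w : N -> P) :
  is_bc f u -> semilin g v -> semilin g w -> (forall m, v (u m) = w (u m)) -> v =1 w.
Proof.
move=> bu sv sw e; apply: (bc_ind bu) => [|b m|x y hx hy].
- by rewrite (semilin0 sv) (semilin0 sw).
- by rewrite (semilinZ sv) (semilinZ sw) e.
- by rewrite (semilinD sv) (semilinD sw) hx hy.
Qed.

(** Existence half of the universal property, with a target over a further ring [C]: [P] is read as
    a [B]-module through [g], and the map out of [B (x) M] is composed with the inverse of
    [bcmap f u]. *)
Lemma bc_extend (C : comPzRingType) (g : {rmorphism B -> C}) (h : A -> C)
  (P : lmodType C) (v : M -> P) :
  is_bc f u -> semilin h v -> (forall a, h a = g (f a)) ->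
  exists2 w : N -> P, semilin g w & forall m, w (u m) = v m.
Proof.
move=> bu sv e; have [su _ sj] := bu; pose r y := sval (cid (sj y)).
have rE y : bcmap f u (r y) = y by rewrite /r; case: cid.
have ru x : r (bcmap f u x) = x by apply: (is_bc_inj bu); rewrite rE.
have rs : semilin id r.
  by split=> *; apply: (is_bc_inj bu);
    rewrite ?(semilinD (bcmap_semilin su)) ?(semilinZ (bcmap_semilin su)) !rE.
have sv' : semilin f (v : M -> restr g P).
  by case: sv => v1 v2; split=> // a x; rewrite v2 e.
exists (fun y => bcmap f (v : M -> restr g P) (r y)).
  split=> [x y|b x]; first by rewrite (semilinD rs) (semilinD (bcmap_semilin sv')).
  by rewrite (semilinZ rs) (semilinZ (bcmap_semilin sv')).
by move=> m; rewrite -(bcmap1 su) ru bcmap1.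
Qed.

(** Testing the universal property on [B (x) M] itself gives a map back from [N], which is inverse
    to [bcmap f u]. *)
Lemma bc_intro :
  semilin f u ->
  (forall (P : lmodType B) (v : M -> P), semilin f v ->
     exists2 w : N -> P, semilin id w & forall m, w (u m) = v m) ->
  (forall (P : lmodType B) (v w : N -> P), semilin id v -> semilin id w ->
     (forall m, v (u m) = w (u m)) -> v =1 w) ->
  is_bc f u.
Proof.
move=> su ex un; have [w sw wE] := ex _ _ (pure_semilin f M).
have s := bcmap_semilin su.
have wK x : w (bcmap f u x) = x.
  move: x; apply: (tens_ext1 (semilin_comp s sw (fun=> erefl))) => [|m]; first by split.
  by rewrite /= bcmap1.
split=> // [x e|y]; first by rewrite -[x]wK e (semilin0 sw).
exists (w y); move: y; apply: un; [exact: semilin_comp sw s (fun=> erefl)|by split|].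
by move=> m /=; rewrite wE bcmap1.
Qed.
End BaseChangeTheory.

Lemma pure_bc (A B : comPzRingType) (f : {rmorphism A -> B}) (M : lmodType A) :
  is_bc f (@pure _ _ f M 1).
Proof.
have sp := pure_semilin f M.
apply: bc_intro => // [P v sv|P v w sv sw]; last exact: (tens_ext1 sv sw).
by exists (bcmap f v); [exact: bcmap_semilin | exact: bcmap1].
Qed.

Section BaseChangeComp.
Context (A B C : comPzRingType) (f : {rmorphism A -> B}) (g : {rmorphism B -> C}).
Context (h : {rmorphism A -> C}) (hE : forall a, h a = g (f a)).
Context (M : lmodType A) (N : lmodType B) (P : lmodType C) (u : M -> N) (v : N -> P).

Lemma bc_comp : is_bc f u -> is_bc g v -> is_bc h (v \o u).
Proof.
move=> bu bv; have su := is_bc_semilin bu; have sv := is_bc_semilin bv.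
apply: bc_intro; first exact: semilin_comp su sv hE.
  move=> Q w sw; have [w1 sw1 w1E] := bc_extend bu sw hE.
  have [w2 sw2 w2E] := bc_extend (g := rid C) bv sw1 (fun=> erefl).
  by exists w2 => // m; rewrite /= w2E w1E.
move=> Q w1 w2 s1 s2 e; apply: (bc_uniq bv s1 s2).
by apply: (bc_uniq bu (semilin_comp sv s1 (fun=> erefl)) (semilin_comp sv s2 (fun=> erefl))).
Qed.

(** The tool for comparing sections over two objects when both are known as base changes of one
    module. *)
Lemma bc_cancel : is_bc f u -> is_bc h (v \o u) -> semilin g v -> is_bc g v.
Proof.
move=> bu bvu sv; have su := is_bc_semilin bu.
apply: bc_intro => //.
  move=> Q w sw.
  have [w' sw' w'E] := bc_extend (g := rid C) bvu (semilin_comp su sw hE) (fun=> erefl).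
  exists w' => //; exact: (bc_uniq bu (semilin_comp sv sw' (fun=> erefl)) sw).
move=> Q w1 w2 s1 s2 e; apply: (bc_uniq bvu s1 s2) => m; exact: e.
Qed.
End BaseChangeComp.

Lemma tbase_bc (A B C : comPzRingType) (f : {rmorphism A -> B})
  (g : {rmorphism B -> C}) (h : {rmorphism A -> C}) (e : forall a, g (f a) = h a)
  (M : lmodType A) : is_bc g (@tbase _ _ f _ g h M e).
Proof.
apply: (bc_cancel (fun a => esym (e a)) (pure_bc f M)); last exact: tbase_semilin.
suff -> : tbase e \o pure f 1 = @pure _ _ h M 1 by exact: pure_bc.
by apply: funext => m; rewrite /= tbase_pure rmorph1.
Qed.

(** * Pushouts of rings and base change *)

Section Restriction.
Context (A B C D : comPzRingType) (f : A -> B) (g : {rmorphism A -> C})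
  (i : {rmorphism B -> D}) (j : C -> D).
Context (e : forall a, i (f a) = j (g a)) (N : lmodType C) (P : lmodType D) (v : N -> P).
Lemma semilin_restr : semilin j v -> semilin f (v : restr g N -> restr i P).
Proof.
by move=> [v1 v2]; split=> [x y|a x]; [exact: v1 | rewrite [LHS]v2 -e].
Qed.
End Restriction.

(* D is B (x)_A C with coprojections i and j. *)
Definition is_pushout (A B C D : comPzRingType) (f : {rmorphism A -> B})
  (g : {rmorphism A -> C}) (i : {rmorphism B -> D}) (j : {rmorphism C -> D}) : Prop :=
  (forall a, i (f a) = j (g a)) /\ is_bc f (j : restr g C^o -> restr i D^o).

(** The isomorphism of [D (x)_C N] with [B (x)_A N]. For a test map [w] and fixed [n], the map
    [c |-> w (c *: n)] extends along [j] to [b n] on [D]; then [(d, n) |-> b n d] is balanced over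
    [C] and defines the extension of [w]. *)
Lemma pushout_bc (A B C D : comPzRingType) (f : {rmorphism A -> B})
  (g : {rmorphism A -> C}) (i : {rmorphism B -> D}) (j : {rmorphism C -> D})
  (N : lmodType C) (P : lmodType D) (v : N -> P) :
  is_pushout f g i j -> is_bc j v -> is_bc f (v : restr g N -> restr i P).
Proof.
move=> [e bj] bv; have sv := is_bc_semilin bv.
have sv' := semilin_restr e sv.
apply: bc_intro => //.
  move=> Q w sw.
  have act_semilin n : semilin f (fun c : restr g C^o => w ((c : C) *: n)).
    split=> [c c'|a c]; first by rewrite scalerDl (semilinD sw).
    rewrite -(semilinZ sw); congr w.
    exact: (esym (scalerA (g a) (c : C) n)).
  have ex n : {b : restr i D^o -> Q |
      semilin id b /\ forall c : C, b (j c) = w (c *: n)}.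
    apply: cid.
    by have [b sb bE] := bc_extend (g := rid B) bj (act_semilin n) (fun=> erefl); exists b.
  pose b n := sval (ex n).
  have sb n : semilin id (b n) := proj1 (svalP (ex n)).
  have bE n (c : C) : b n (j c) = w (c *: n) := proj2 (svalP (ex n)) c.
  (* The identities in [d] need checking only on the elements [j c], which generate [D] over [B]. *)
  have bal : balanced j (fun (d : D) n => b n d).
    split=> [d d' n|d n n'|d c n]; first exact: (semilinD (sb n)).
      move: d; apply: (bc_uniq bj (sb _)) => [|c].
        split=> [x y|a x].
          by rewrite !(semilinD (sb _)) addrACA.
        by rewrite !(semilinZ (sb _)) scalerDr.
      by rewrite !bE scalerDr (semilinD sw).
    suff h : (fun d : restr i D^o => b n ((d : D) * j c)) =1 b (c *: n) by exact: h.
    apply: (bc_uniq bj _ (sb _)) => [|c'].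
      split=> [x y|a x]; first by rewrite mulrDl (semilinD (sb _)).
      rewrite -(semilinZ (sb _)); congr (b n _).
      exact: (esym (mulrA (i a) (x : D) (j c))).
    by rewrite -rmorphM !bE scalerA.
  pose r y := sval (cid (let: And3 _ _ sj := bv in sj y)).
  have rE y : bcmap j v (r y) = y by rewrite /r; case: cid.
  have ru x : r (bcmap j v x) = x by apply: (is_bc_inj bv); rewrite rE.
  have rs : semilin id r.
    by split=> *; apply: (is_bc_inj bv);
      rewrite ?(semilinD (bcmap_semilin sv)) ?(semilinZ (bcmap_semilin sv)) !rE.
  pose t := tlift (fun (d : D) n => b n d) : tens j N -> Q.
  have tZ c x : t (i c *: x) = c *: t x.
    elim/tens_ind: x => [|d n|x y hx hy].
    - by rewrite scaler0 /t (tlift0 bal) scaler0.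
    - rewrite scale_pure /t !(tlift_pure _ _ bal) -(semilinZ (sb _)).
      by [].
    - by rewrite scalerDr /t !(tliftD bal) scalerDr; congr (_ + _).
  exists (fun y => t (r y)).
    split=> [x y|c x]; first by rewrite (semilinD rs) /t (tliftD bal).
    by rewrite -tZ; congr t; exact: (semilinZ rs).
  move=> n; rewrite -(bcmap1 sv) ru /t (tlift_pure _ _ bal).
  by rewrite -(rmorph1 j) bE scale1r.
move=> Q w1 w2 s1 s2 ew.
apply: (bc_ind bv) => [|d n|x y hx hy].
- by rewrite (semilin0 s1) (semilin0 s2).
- suff h : (fun d : restr i D^o => w1 ((d : D) *: v n)) =1
           (fun d : restr i D^o => w2 ((d : D) *: v n)) by exact: h.
  have lin (w : restr i P -> Q) : semilin id w ->
      semilin id (fun d : restr i D^o => w ((d : D) *: v n)).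
    move=> sw; split=> [x y|a x]; first by rewrite scalerDl (semilinD sw).
    rewrite -(semilinZ sw); congr w; exact: (esym (scalerA (i a) (x : D) (v n))).
  apply: (bc_uniq bj (lin _ s1) (lin _ s2)) => c.
  by rewrite -(semilinZ sv) ew.
- by rewrite (semilinD s1) (semilinD s2) hx hy.
Qed.

(** * Quotient and product modules, kernels under flat base change *)

Record submod (A : comPzRingType) (M : lmodType A) := Submod {
  sm_mem :> M -> Prop;
  sm_mem0 : sm_mem 0;
  sm_memD : forall x y, sm_mem x -> sm_mem y -> sm_mem (x + y);
  sm_memZ : forall a x, sm_mem x -> sm_mem (a *: x) }.

Section QuotientModule.
Context (A : comPzRingType) (M : lmodType A) (S : submod M).

Lemma sm_memN x : S x -> S (- x).
Proof. by move=> h; rewrite -scaleN1r; apply: sm_memZ. Qed.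

Definition quo_rel (x y : M) : bool := `[< S (x - y) >].
Fact quo_rel_equiv : equiv_class_of quo_rel.
Proof.
split.
- by move=> x; apply/asboolP; rewrite subrr; apply: sm_mem0.
- by move=> x y; apply/asboolP/asboolP => /sm_memN; rewrite opprB.
- move=> y x z /asboolP h /asboolP k; apply/asboolP.
  by rewrite -(subrK y x) -addrA; apply: sm_memD.
Qed.
Canonical quo_equivrel := EquivRelPack quo_rel_equiv.
Definition quo : Type := {eq_quot quo_equivrel}.
HB.instance Definition _ := Choice.on quo.
Definition qpi (x : M) : quo := \pi_({eq_quot quo_equivrel}) x.
Definition qrep (x : quo) : M := repr (x : {eq_quot quo_equivrel}).
Fact qrepK x : qpi (qrep x) = x. Proof. exact: (@reprK _ {eq_quot quo_equivrel}). Qed.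
Fact qpiP x y : qpi x = qpi y <-> S (x - y).
Proof.
split; first by move=> /eqmodP /asboolP.
by move=> h; apply/eqmodP/asboolP.
Qed.
Fact qrep_pi x : S (qrep (qpi x) - x).
Proof. by apply/qpiP; rewrite qrepK. Qed.

Definition quo_add x y := qpi (qrep x + qrep y).
Definition quo_opp x := qpi (- qrep x).
Definition quo_scale a x := qpi (a *: qrep x).
Fact quo_addE x y : quo_add (qpi x) (qpi y) = qpi (x + y).
Proof. by apply/qpiP; rewrite opprD addrACA; apply: sm_memD; apply: qrep_pi. Qed.
Fact quo_oppE x : quo_opp (qpi x) = qpi (- x).
Proof. by apply/qpiP; rewrite -opprD; apply: sm_memN; apply: qrep_pi. Qed.
Fact quo_scaleE a x : quo_scale a (qpi x) = qpi (a *: x).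
Proof. by apply/qpiP; rewrite -scalerBr; apply: sm_memZ; apply: qrep_pi. Qed.
Fact quo_addA : associative quo_add.
Proof. by move=> x y z; rewrite -[x]qrepK -[y]qrepK -[z]qrepK !quo_addE addrA. Qed.
Fact quo_addC : commutative quo_add.
Proof. by move=> x y; rewrite -[x]qrepK -[y]qrepK !quo_addE addrC. Qed.
Fact quo_add0 : left_id (qpi 0) quo_add.
Proof. by move=> x; rewrite -[x]qrepK !quo_addE add0r. Qed.
Fact quo_addN : left_inverse (qpi 0) quo_opp quo_add.
Proof. by move=> x; rewrite -[x]qrepK quo_oppE quo_addE addNr. Qed.
HB.instance Definition _ := GRing.isZmodule.Build quo
  quo_addA quo_addC quo_add0 quo_addN.
Fact quo_scaleA a b x : quo_scale a (quo_scale b x) = quo_scale (a * b) x.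
Proof. by rewrite -[x]qrepK !quo_scaleE scalerA. Qed.
Fact quo_scale1 : left_id 1 quo_scale.
Proof. by move=> x; rewrite -[x]qrepK quo_scaleE scale1r. Qed.
Fact quo_scaleDr : right_distributive quo_scale +%R.
Proof.
move=> a x y; rewrite -[x]qrepK -[y]qrepK [_ + _]quo_addE !quo_scaleE.
by rewrite [RHS]quo_addE scalerDr.
Qed.
Fact quo_scaleDl x : {morph quo_scale^~ x : a b / a + b}.
Proof.
move=> a b; rewrite -[x]qrepK !quo_scaleE [RHS]quo_addE.
by rewrite scalerDl.
Qed.
HB.instance Definition _ := GRing.Zmodule_isLmodule.Build A quo
  quo_scaleA quo_scale1 quo_scaleDr quo_scaleDl.

Fact qpi_linear : linear qpi.
Proof. by move=> a x y; rewrite [a *: qpi x]quo_scaleE [RHS]quo_addE. Qed.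
Definition qproj : {linear M -> quo} := mklin qpi_linear.
Lemma qproj_surj y : exists x, qproj x = y.
Proof. by exists (qrep y); exact: qrepK. Qed.
Lemma qproj_eq0 x : qproj x = 0 <-> S x.
Proof.
have -> : (0 : quo) = qproj 0 by rewrite linear0.
by rewrite [qproj x = _]qpiP subr0.
Qed.

Lemma quo_lift (B : comPzRingType) (f : A -> B) (N : lmodType B) (u : M -> N) :
  semilin f u -> (forall x, S x -> u x = 0) ->
  exists2 v : quo -> N, semilin f v & forall x, v (qproj x) = u x.
Proof.
move=> su u0; have uE x : u (qrep (qpi x)) = u x.
  by apply/subr0_eq; rewrite -(semilinB su); apply/u0/qrep_pi.
exists (u \o qrep); last exact: uE.
split=> [x y|a x] /=.
  by rewrite -(semilinD su) -[in LHS](qrepK x) -[in LHS](qrepK y) [_ + _]quo_addE uE.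
by rewrite -(semilinZ su) -[in LHS](qrepK x) [_ *: _]quo_scaleE uE.
Qed.
End QuotientModule.

Section Kernels.
Context (A : comPzRingType).
Context (M N : lmodType A) (l : {linear M -> N}).
Program Definition kersub : submod M := @Submod A M (fun x => l x = 0) _ _ _.
Next Obligation. exact: linear0. Qed.
Next Obligation. by move=> x y /= hx hy; rewrite linearD hx hy addr0. Qed.
Next Obligation. by move=> a x /= hx; rewrite linearZ /= hx scaler0. Qed.
Program Definition imsub : submod N := @Submod A N (fun y => exists x, l x = y) _ _ _.
Next Obligation. by exists 0; exact: linear0. Qed.
Next Obligation. by move=> _ _ [x <-] [y <-]; exists (x + y); exact: linearD. Qed.
Next Obligation. by move=> a _ [x <-]; exists (a *: x); exact: linearZ. Qed.
End Kernels.

Section RightExact.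
Context (A B : comPzRingType) (f : {rmorphism A -> B}) (M : lmodType A) (S : submod M).

(** The image of [B (x) S] in [B (x) M], with members as explicit sums: this form is what later
    arguments take apart. *)
Program Definition tensub : submod (tens f M) := @Submod B (tens f M)
  (fun x => exists s : seq (B * M),
     (forall p, p \in s -> S p.2) /\ x = \sum_(p <- s) pure f p.1 p.2) _ _ _.
Next Obligation. by exists [::]; split=> //; rewrite big_nil. Qed.
Next Obligation.
move=> x y [s [hs ->]] [t [ht ->]]; exists (s ++ t); split; last by rewrite big_cat.
by move=> p; rewrite mem_cat => /orP[/hs|/ht].
Qed.
Next Obligation.
move=> a x [s [hs ->]]; exists [seq (a * p.1, p.2) | p <- s]; split.
  by move=> p /mapP[q /hs qs ->].
by rewrite big_map scaler_sumr; apply: eq_bigr => p _; rewrite scale_pure.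
Qed.

(** Right exactness of the tensor product: [m |-> 1 (x) m] modulo [tensub] kills [S], so the
    projection onto the quotient by [tensub] factors through [B (x) (M / S)]. *)
Lemma tens_quo_ker (x : tens f M) : tmap f (qproj S) x = 0 -> tensub x.
Proof.
have hl : exists2 v : quo S -> quo tensub,
    semilin f v & forall m, v (qproj S m) = qproj tensub (pure f 1 m).
  apply: quo_lift => [|m Sm].
    exact: semilin_comp (pure_semilin f M) (linear_semilin (qproj tensub)) _.
  apply/qproj_eq0; exists [:: (1, m)]; split; last by rewrite big_seq1.
  by move=> p; rewrite inE => /eqP ->.
have [v sv vE] := hl => e.
apply/qproj_eq0; have -> : qproj tensub x = bcmap f v (tmap f (qproj S) x).
  move: x {e}; apply: (tens_ext1 (linear_semilin _)) => [|m].
    by apply: semilin_comp (linear_semilin _) (bcmap_semilin sv) _.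
  by rewrite [tmap _ _ _]tmap_pure bcmap1 // vE.
by rewrite e (semilin0 (bcmap_semilin sv)).
Qed.
End RightExact.

Lemma tmap_bcmap (A B : comPzRingType) (f : {rmorphism A -> B}) (M N : lmodType A)
  (P : lmodType B) (l : {linear M -> N}) (u : N -> P) (x : tens f M) :
  semilin f u -> bcmap f u (tmap f l x) = bcmap f (u \o l) x.
Proof.
move=> su; have sul : semilin f (u \o l).
  exact: semilin_comp (linear_semilin l) su _.
move: x; apply: tens_ext1 (bcmap_semilin sul) _ => [|m].
  exact: semilin_comp (linear_semilin _) (bcmap_semilin su) _.
by rewrite [tmap _ _ _]tmap_pure !bcmap1.
Qed.

(** The quotient of [M] by the kernel of [l] embeds in [N]; flatness preserves this embedding, so
    [x] already dies in the tensor product with the quotient. *)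
Lemma flat_ker (A B : comPzRingType) (f : {rmorphism A -> B}) (M N : lmodType A)
  (l : {linear M -> N}) (x : tens f M) :
  flat f -> tmap f l x = 0 -> tensub f (kersub l) x.
Proof.
move=> ff e; apply: tens_quo_ker.
have [v sv vE] := quo_lift (S := kersub l) (linear_semilin l) (fun _ h => h).
have vi : injective v.
  apply: (semilin_inj sv) => y; have [z <-] := qproj_surj y.
  by rewrite vE => /(qproj_eq0 (kersub l)).
apply: (ff _ _ (mklin (semilin_linear sv)) vi); rewrite linear0 -[RHS]e.
rewrite -tmap_comp; congr (tmap f _ _); apply: lin_eq => m; exact: vE.
Qed.

Section PiModule.
Context (A : comPzRingType) (I : Type) (M : I -> lmodType A).
Definition pimod : Type := forall i, M i.
Implicit Types x y z : pimod.
HB.instance Definition _ := gen_eqMixin pimod.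
HB.instance Definition _ := gen_choiceMixin pimod.
Definition pi_add x y : pimod := fun i => x i + y i.
Definition pi_opp x : pimod := fun i => - x i.
Definition pi_scale a x : pimod := fun i => a *: x i.
Lemma pimod_eq x y : (forall i, x i = y i) -> x = y.
Proof. exact: functional_extensionality_dep. Qed.
Fact pi_addA : associative pi_add.
Proof. by move=> x y z; apply: pimod_eq => i; exact: addrA. Qed.
Fact pi_addC : commutative pi_add.
Proof. by move=> x y; apply: pimod_eq => i; exact: addrC. Qed.
Fact pi_add0 : left_id (fun=> 0) pi_add.
Proof. by move=> x; apply: pimod_eq => i; exact: add0r. Qed.
Fact pi_addN : left_inverse (fun=> 0) pi_opp pi_add.
Proof. by move=> x; apply: pimod_eq => i; exact: addNr. Qed.
HB.instance Definition _ := GRing.isZmodule.Build pimod pi_addA pi_addC pi_add0 pi_addN.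
Fact pi_scaleA a b x : pi_scale a (pi_scale b x) = pi_scale (a * b) x.
Proof. by apply: pimod_eq => i; exact: scalerA. Qed.
Fact pi_scale1 : left_id 1 pi_scale.
Proof. by move=> x; apply: pimod_eq => i; exact: scale1r. Qed.
Fact pi_scaleDr : right_distributive pi_scale +%R.
Proof. by move=> a x y; apply: pimod_eq => i; exact: scalerDr. Qed.
Fact pi_scaleDl x : {morph pi_scale^~ x : a b / a + b}.
Proof. by move=> a b; apply: pimod_eq => i; exact: scalerDl. Qed.
HB.instance Definition _ := GRing.Zmodule_isLmodule.Build A pimod
  pi_scaleA pi_scale1 pi_scaleDr pi_scaleDl.

Fact pi_proj_linear i : linear (fun x : pimod => x i). Proof. by []. Qed.
Definition pi_proj i : {linear pimod -> M i} := mklin (pi_proj_linear i).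

Section Tuple.
Context (N : lmodType A) (u : forall i, {linear N -> M i}).
Fact pi_tuple_linear : linear (fun n => (fun i => u i n) : pimod).
Proof. by move=> a x y; apply: pimod_eq => i; exact: linearP. Qed.
Definition pi_tuple : {linear N -> pimod} := mklin pi_tuple_linear.
End Tuple.
End PiModule.

Section PiTensor.
Context (A B : comPzRingType) (f : {rmorphism A -> B}) (I : finType) (M : I -> lmodType A).

Definition pi_inj_fun (i : I) (m : M i) : pimod M :=
  fun j => if i =P j is ReflectT e then eq_rect i M m j e else 0.
Fact pi_inj_linear i : linear (@pi_inj_fun i).
Proof.
move=> a x y; apply: pimod_eq => j.
change (@pi_inj_fun i (a *: x + y) j = a *: @pi_inj_fun i x j + @pi_inj_fun i y j).
by rewrite /pi_inj_fun; case: eqP => [e|_]; [case: _ / e | rewrite scaler0 addr0].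
Qed.
Definition pi_inj i : {linear M i -> pimod M} := mklin (@pi_inj_linear i).
Lemma pi_proj_inj i (m : M i) : pi_proj M i (pi_inj i m) = m.
Proof.
rewrite /= /pi_inj_fun; case: eqP => // e.
by rewrite (Prop_irrelevance e erefl).
Qed.
Lemma pi_proj_inj0 i j (m : M i) : j != i -> pi_proj M j (pi_inj i m) = 0.
Proof. by move=> ne; rewrite /= /pi_inj_fun; case: eqP => // e; rewrite e eqxx in ne. Qed.

Lemma pi_decomp (x : pimod M) : x = \sum_i pi_inj i (pi_proj M i x).
Proof.
apply: pimod_eq => j; change (pi_proj M j x = pi_proj M j (\sum_i pi_inj i (pi_proj M i x))).
rewrite linear_sum (bigD1 j) //= big1 ?addr0 => [|i ne].
  exact: (esym (pi_proj_inj _)).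
by apply: (pi_proj_inj0 (pi_proj M i x)); rewrite eq_sym.
Qed.

(** As [I] is finite, the identity of the product is the sum of the maps [pi_inj i] after
    [pi_proj i], and this survives tensoring. *)
Lemma tens_pi_eq0 (x : tens f (pimod M)) :
  (forall i, tmap f (pi_proj M i) x = 0) -> x = 0.
Proof.
move=> h; suff -> : x = \sum_i tmap f (pi_inj i) (tmap f (pi_proj M i) x).
  by rewrite big1 // => i _; rewrite h linear0.
move: x {h}; apply: (tens_ext1 (g := id)); first by split.
  split=> [x y|a x].
    by rewrite -big_split; apply: eq_bigr => i _; rewrite !linearD.
  by rewrite scaler_sumr; apply: eq_bigr => i _; rewrite !linearZ.
move=> m; rewrite {1}[m]pi_decomp (semilin_sum (pure_semilin f _)).
by apply: eq_bigr => i _; rewrite [tmap _ (pi_proj _ _) _]tmap_pure [RHS]tmap_pure.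
Qed.

Lemma tens_pi_ex (y : forall i, tens f (M i)) :
  exists x, forall i, tmap f (pi_proj M i) x = y i.
Proof.
exists (\sum_i tmap f (pi_inj i) (y i)) => j.
rewrite linear_sum (bigD1 j) //= big1 ?addr0 => [|i ne].
  have := @tmap_comp _ _ f _ _ _ (pi_proj M j) (pi_inj j) (y j).
  rewrite (_ : lcomp _ _ = lid _) ?tmap_id //.
  by apply: lin_eq => m; exact: pi_proj_inj.
have := @tmap_comp _ _ f _ _ _ (pi_proj M j) (pi_inj i) (y i) => /= <-.
move: (y i); apply: (tens_ext1 (linear_semilin (tmap f (lcomp (pi_proj M j) (pi_inj i)))))
  => [|m]; first by split=> *; rewrite ?addr0 ?scaler0.
rewrite [LHS]tmap_pure [lcomp _ _ _]pi_proj_inj0 1?eq_sym //.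
exact: (semilin0 (pure_semilin f _)).
Qed.
End PiTensor.

(** * Faithful families and descent of elements *)

(** Krull's argument: an ideal containing [I] and maximal among those disjoint from the
    multiplicative set [T] is prime. *)
Lemma prime_avoiding (A : comPzRingType) (I : submod A^o) (T : A -> Prop) :
  T 1 -> (forall a b, T a -> T b -> T (a * b)) -> (forall a, I a -> ~ T a) ->
  exists2 Q : A -> Prop, prime_ideal Q & (forall a, I a -> Q a) /\ (forall a, Q a -> ~ T a).
Proof.
move=> T1 TM IT.
pose good (J : set A) := [/\ I `<=` J, forall a b, J a -> J b -> J (a + b),
  forall a b, J b -> J (a * b) & forall a, J a -> ~ T a]%classic.
pose P : set (set A) := fun J => J = set0 \/ good J.
have [Q [PQ Qmax]] : exists Q, P Q /\ forall B, (Q `<` B)%classic -> ~ P B.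
  apply: Zorn_bigcup => F FP Ftot.
  have [[J0 FJ0 gJ0]|no] := pselect (exists2 J, F J & good J); last first.
    left; apply/seteqP; split=> // a [J FJ Ja].
    have [J0|gJ] := FP _ FJ; first by rewrite J0 in Ja.
    by case: no; exists J.
  right; split.
  - by move=> a Ia; exists J0 => //; case: gJ0 => + _ _ _; apply.
  - have key J K a b : F J -> F K -> J a -> K b -> (J `<=` K)%classic ->
        exists2 L, F L & L (a + b).
      move=> FJ FK Ja Kb JK; exists K => //.
      have [K0|[_ KD _ _]] := FP _ FK; first by rewrite K0 in Kb.
      by apply: KD => //; apply: JK.
    move=> a b [J FJ Ja] [K FK Kb].
    have [JK|KJ] := Ftot _ _ FJ FK; first exact: (key J K).
    by rewrite addrC; exact: (key K J).
  - move=> a b [J FJ Jb]; exists J => //.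
    have [J0'|[_ _ JM _]] := FP _ FJ; first by rewrite J0' in Jb.
    exact: JM.
  - move=> a [J FJ Ja]; have [J0'|[_ _ _ JT]] := FP _ FJ; first by rewrite J0' in Ja.
    exact: JT.
have [Q0|[QI QD QM QT]] := PQ.
  case: (Qmax I); last first.
    right; split=> // a b; first exact: sm_memD.
    exact: (@sm_memZ _ _ I a b).
  by rewrite Q0; split=> [a //|h]; exact: (h 0 (sm_mem0 I)).
have Q00 : Q 0 by apply: QI; exact: sm_mem0.
(* By maximality, the ideal generated by [Q] and [a] meets [T]. Multiplying two such elements, for
   [a] and for [b], gives primality. *)
have ext a : ~ Q a -> exists q r, Q q /\ T (q + r * a).
  move=> nQa; apply: contrapT => no.
  pose B : set A := fun x => exists q r, Q q /\ x = q + r * a.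
  have QB : (Q `<=` B)%classic by move=> q Qq; exists q, 0; rewrite mul0r addr0.
  apply: (Qmax B).
    split=> // BQ; apply: nQa; apply: BQ; exists 0, 1.
    by rewrite add0r mul1r.
  right; split.
  - by move=> x /QI /QB.
  - move=> _ _ [q [r [Qq ->]]] [q' [r' [Qq' ->]]].
    by exists (q + q'), (r + r'); rewrite mulrDl addrACA; split=> //; apply: QD.
  - move=> c _ [q [r [Qq ->]]]; exists (c * q), (c * r).
    by rewrite mulrDr mulrA; split=> //; apply: QM.
  - by move=> _ [q [r [Qq ->]]] Tx; apply: no; exists q, r.
exists Q; last by [].
split=> //; first by move/QT; apply.
move=> a b Qab; apply: contrapT => /not_orP[/ext[q [r [Qq Ta]]] /ext[q' [r' [Qq' Tb]]]].
apply: QT (TM _ _ Ta Tb); rewrite mulrDl; apply: (QD).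
  by rewrite mulrC; apply: QM.
rewrite mulrDr; apply: (QD); first exact: QM.
by rewrite mulrACA; apply: QM.
Qed.

(** Detection of elements, the form of faithfulness that gluing uses; coverings of the site are
    instead given by primes. *)
Definition faithful_family (A : comPzRingType) (I : Type) (B : I -> comPzRingType)
  (f : forall i, {rmorphism A -> B i}) : Prop :=
  forall (N : lmodType A) (n : N), (forall i, pure (f i) 1 n = 0) -> n = 0.

Lemma rmorph_semilin (A B : comPzRingType) (f : {rmorphism A -> B}) :
  semilin f (f : A^o -> B^o).
Proof. by split=> *; [exact: rmorphD | exact: rmorphM]. Qed.

(** If [n] is nonzero, its annihilator lies in a prime [P], the contraction of a prime [Q] of some
    [B i]. By flatness the annihilator of [1 (x) n] is generated by that of [n], so it lies in [Q];
    but it contains 1. *)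
Lemma flat_faithful (A : comPzRingType) (I : Type) (B : I -> comPzRingType)
  (f : forall i, {rmorphism A -> B i}) :
  (forall i, flat (f i)) -> jointly_surjective f -> faithful_family f.
Proof.
move=> ff fs N n fn.
have lin : linear (fun a : A^o => a *: n).
  by move=> a x y; rewrite scalerDl -scalerA.
pose l : {linear A^o -> N} := mklin lin.
suff : kersub l 1 by rewrite /= scale1r.
apply: contrapT => n1.
have [|||P PP [PK P1]] := @prime_avoiding A (kersub l) (fun a => a = 1).
- by [].
- by move=> a b -> ->; rewrite mulr1.
- by move=> a /[swap] ->.
have [i [Q PQ QE]] := fs _ PP.
have e : tmap (f i) l (pure (f i) 1 (1 : A^o)) = 0.
  by rewrite [LHS]tmap_pure /= scale1r fn.
have [s [sK sE]] := flat_ker (ff i) e.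
have sf := bcmap_semilin (rmorph_semilin (f i)).
have := congr1 (bcmap (f i) (f i : A^o -> (B i)^o)) sE.
rewrite bcmap1; last exact: rmorph_semilin.
rewrite rmorph1 (semilin_sum sf) => e1.
apply: (prime_id1 PQ); rewrite e1 big_seq; apply: big_ind.
- exact: (prime_id0 PQ).
- exact: (prime_idD PQ).
- move=> p /sK Kp; rewrite bcmap_pure; last exact: rmorph_semilin.
  by apply: (prime_idMl PQ); apply/QE/PK.
Qed.

(** Faithfulness passes to base changes without difficulty; this converse turns it back into
    surjectivity on primes, as the site demands. *)
Lemma faithful_surjective (A : comPzRingType) (I : finType) (B : I -> comPzRingType)
  (f : forall i, {rmorphism A -> B i}) : faithful_family f -> jointly_surjective f.
Proof.
move=> ff P PP.
pose PM := @Submod A A^o P (prime_id0 PP) (prime_idD PP) (prime_idMl PP).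
have PX i : {E : submod (B i)^o | forall y, E y <->
    exists2 s : seq (B i * A), (forall p, p \in s -> P p.2) &
      y = \sum_(p <- s) p.1 * f i p.2}.
  pose E y := exists2 s : seq (B i * A), (forall p, p \in s -> P p.2) &
      y = \sum_(p <- s) p.1 * f i p.2.
  have E0 : E 0 by exists [::]; rewrite ?big_nil.
  have ED x y : E x -> E y -> E (x + y).
    move=> [s hs ->] [t ht ->]; exists (s ++ t); last by rewrite big_cat.
    by move=> p; rewrite mem_cat => /orP[/hs|/ht].
  have EM a x : E x -> E (a * x).
    move=> [s hs ->]; exists [seq (a * p.1, p.2) | p <- s].
      by move=> p /mapP[q /hs qs ->].
    by rewrite big_map mulr_sumr; apply: eq_bigr => p _; rewrite mulrA.
  by exists (@Submod (B i) (B i)^o E E0 ED EM).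
(* If the extension of [P] to some [B i] contracts to [P], a prime containing this extension and
   avoiding the image of the complement of [P] lies over [P]. *)
have [[i iE]|no] := pselect (exists i, forall s, sval (PX i) (f i s) -> P s).
  pose T b := exists2 s, ~ P s & f i s = b.
  have [|||Q PQ [QI QT]] := @prime_avoiding (B i) (sval (PX i)) T.
  - by exists 1; [exact: prime_id1 PP | exact: rmorph1].
  - move=> _ _ [s Ps <-] [t Pt <-]; exists (s * t); last exact: rmorphM.
    by case/(prime_idM PP).
  - by move=> _ /[swap] -[s Ps <-] /iE.
  exists i, Q => // a; split=> [Pa|Qa].
    apply: QI; apply/(svalP (PX i)); exists [:: (1, a)].
      by move=> p; rewrite inE => /eqP ->.
    by rewrite big_seq1 mul1r.
  by apply: contrapT => nPa; apply: (QT _ Qa); exists a.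
have ex i : {s | sval (PX i) (f i s) & ~ P s}.
  apply: cid2; apply: contrapT => no'; apply: no; exists i => s h.
  by apply: contrapT => nPs; apply: no'; exists s.
(* Otherwise each [i] has a witness outside [P] whose image lies in the extended ideal. Their
   product is outside [P], yet its class in [A / P] vanishes after every base change. *)
pose s := \prod_i s2val (ex i).
have nPs : ~ P s.
  rewrite /s; apply: (big_ind (fun a => ~ P a)) => [|a b na nb|i _].
  - exact: prime_id1 PP.
  - by case/(prime_idM PP).
  - exact: s2valP' (ex i).
case: nPs; apply/(qproj_eq0 PM); apply: ff => i.
have : sval (PX i) (f i s).
  rewrite /s (bigD1 i) //= rmorphM mulrC.
  by apply: (@sm_memZ _ (B i)^o); exact: s2valP (ex i).
move=> /(svalP (PX i))[t ht tE].
have sp := pure_semilin (f i) (quo PM).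
have -> : qproj PM s = s *: qproj PM (1 : A^o) by rewrite -linearZ /= [s *: _]mulr1.
rewrite (semilinZ sp) tE scaler_suml big_seq big1 // => p /ht Pp.
rewrite -scalerA -(semilinZ sp) -linearZ.
have -> : qproj PM (p.2 *: (1 : A^o)) = 0 by apply/qproj_eq0; rewrite [_ *: _]mulr1.
by rewrite (semilin0 sp) scaler0.
Qed.

Lemma faithful_bc (A : comPzRingType) (I : Type) (B : I -> comPzRingType)
  (f : forall i, {rmorphism A -> B i}) (M : lmodType A) (N : forall i, lmodType (B i))
  (u : forall i, M -> N i) (m : M) :
  faithful_family f -> (forall i, is_bc (f i) (u i)) -> (forall i, u i m = 0) -> m = 0.
Proof.
move=> ff bu um; apply: ff => i; apply: (is_bc_inj (bu i)).
have su := is_bc_semilin (bu i).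
by rewrite bcmap1 // um (semilin0 (bcmap_semilin su)).
Qed.

(** * Tensor products of algebras as pushouts; stability of the flat finitely presented and faithful
    conditions *)

Section TensorPushout.
Context (A B C : comPzRingType) (f : {rmorphism A -> B}) (g : {rmorphism A -> C}).

Lemma pureR_inlr b c : pureR f g b c = tinl f g b * tinr f g c.
Proof. by rewrite [RHS]mulR_pure mulr1 mul1r. Qed.

Lemma tensR_pushout : is_pushout f g (tinl f g) (tinr f g).
Proof.
split; first exact: tinlr.
have st : semilin f (tinr f g : restr g C^o -> restr (tinl f g) (tensR f g)^o).
  split=> [x y|a x]; first exact: rmorphD.
  by rewrite [RHS](_ : _ = tinl f g (f a) * tinr f g x) // tinlr -rmorphM.
have e (x : tensR f g) :
    bcmap f (tinr f g : restr g C^o -> restr (tinl f g) (tensR f g)^o) x = x.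
  elim/tensR_ind: x => [|b c|x y hx hy].
  - exact: (semilin0 (bcmap_semilin st)).
  - by rewrite [RHS]pureR_inlr; exact: (bcmap_pure st b c).
  - by rewrite -[in RHS]hx -[in RHS]hy; exact: (semilinD (bcmap_semilin st)).
split=> // [x|y]; last by exists y; exact: e.
by move=> h; rewrite -[LHS]e.
Qed.

(** The construction of [tensR] favours its left factor, so with the roles exchanged the universal
    property is verified directly. *)
Lemma tensR_pushoutC : is_pushout g f (tinr f g) (tinl f g).
Proof.
split=> [a|]; first by rewrite tinlr.
have st : semilin g (tinl f g : restr f B^o -> restr (tinr f g) (tensR f g)^o).
  split=> [x y|a x]; first exact: rmorphD.
  by rewrite [RHS](_ : _ = tinr f g (g a) * tinl f g x) // -tinlr -rmorphM.
apply: bc_intro => // [P v sv|P v w sv sw e].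
  have bal : balanced f (fun b (c : restr g C^o) => (c : C) *: v b).
    split=> [b b' c|b c c'|b a c].
    - by rewrite (semilinD sv) scalerDr.
    - exact: scalerDl.
    - rewrite [RHS](_ : _ = (c * g a) *: v b); last by rewrite mulrC.
      rewrite -scalerA -(semilinZ sv); congr (_ *: v _); exact: mulrC.
  pose w (x : tensR f g) : P := @tlift A B f (restr g C^o) P (fun b (c : C) => c *: v b) x.
  have wE b c : w (pureR f g b c) = c *: v b := tlift_pure _ _ bal.
  have w0 : w 0 = 0 := tlift0 bal.
  exists w; last by move=> b; rewrite [LHS]wE scale1r.
  split=> [x y|c x]; first exact: (tliftD bal).
  change (w (tinr f g c * x) = c *: w x).
  elim/tensR_ind: x => [|b c'|x y hx hy]; first by rewrite mulr0 w0 scaler0.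
    by rewrite [tinr f g c * _]mulR_pure mul1r !wE scalerA.
  by rewrite mulrDr [LHS](tliftD bal) [X in X + _]hx [X in _ + X]hy -scalerDr -(tliftD bal).
elim/tensR_ind => [|b c|x y hx hy]; first by rewrite [LHS](semilin0 sv) [RHS](semilin0 sw).
  have e' : pureR f g b c = tinr f g c * tinl f g b by rewrite mulrC pureR_inlr.
  rewrite e' [LHS](semilinZ sv c (tinl f g b)) [RHS](semilinZ sw c (tinl f g b)).
  by rewrite e.
by rewrite [LHS](semilinD sv) [RHS](semilinD sw) hx hy.
Qed.
End TensorPushout.

Lemma flat_bc (A B : comPzRingType) (f : {rmorphism A -> B}) (M M' : lmodType A)
  (N N' : lmodType B) (u : M -> N) (u' : M' -> N') (l : {linear M -> M'}) (L : N -> N') :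
  flat f -> is_bc f u -> is_bc f u' -> semilin id L -> (forall m, L (u m) = u' (l m)) ->
  injective l -> injective L.
Proof.
move=> ff bu bu' sL e li; have su := is_bc_semilin bu; have su' := is_bc_semilin bu'.
have sj y : exists x, bcmap f u x = y by case: bu.
have LE x : L (bcmap f u x) = bcmap f u' (tmap f l x).
  rewrite tmap_bcmap //; move: x; apply: tens_ext1.
  - exact: semilin_comp (bcmap_semilin su) sL (fun=> erefl).
  - by apply: bcmap_semilin; exact: semilin_comp (linear_semilin l) su' _.
  - move=> m; rewrite /= !bcmap1 ?e //.
    exact: semilin_comp (linear_semilin l) su' _.
move=> y y'; have [x <-] := sj y; have [x' <-] := sj y'.
by rewrite !LE => /(is_bc_inj bu') /(ff _ _ _ li) ->.
Qed.

(** By [pushout_bc], [tmap j l] is the base change along [f] of [l] regarded over [A]. *)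
Lemma flat_pushout (A B C D : comPzRingType) (f : {rmorphism A -> B})
  (g : {rmorphism A -> C}) (i : {rmorphism B -> D}) (j : {rmorphism C -> D}) :
  is_pushout f g i j -> flat f -> flat j.
Proof.
move=> po ff M N l li.
have lin : linear (l : restr g M -> restr g N).
  have [lD lZ] := linear_semilin l.
  by move=> a x y; rewrite [LHS]lD; congr (_ + _); exact: lZ.
have sL : semilin id (tmap j l : restr i (tens j M) -> restr i (tens j N)).
  have [tD tZ] := linear_semilin (tmap j l).
  by split=> [x y|a x]; [exact: tD | exact: tZ].
apply: (flat_bc ff (pushout_bc po (pure_bc j M)) (pushout_bc po (pure_bc j N)) (l := mklin lin)
  sL _ li) => m; exact: tmap_pure.
Qed.

Fixpoint pmap_cst (A C I : Type) (g : A -> C) (p : pexpr A I) : pexpr C I :=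
  match p with
  | PVar i => PVar i
  | PCst a => PCst (g a)
  | PAdd p q => PAdd (pmap_cst g p) (pmap_cst g q)
  | PMul p q => PMul (pmap_cst g p) (pmap_cst g q)
  end.

Lemma peval_pmap (A C I : Type) (E : comPzRingType) (g : A -> C) (h : C -> E) (c : I -> E) p :
  peval h c (pmap_cst g p) = peval (h \o g) c p.
Proof. by elim: p => //= p -> q ->. Qed.

Lemma peval_rmorph (A I : Type) (D E : comPzRingType) (h : A -> D) (k : {rmorphism D -> E})
  (c : I -> D) p : k (peval h c p) = peval (k \o h) (k \o c) p.
Proof. by elim: p => //= p <- q <-; rewrite ?rmorphD ?rmorphM. Qed.

Lemma eq_peval (A I : Type) (D : comPzRingType) (h h' : A -> D) (c c' : I -> D) p :
  h =1 h' -> c =1 c' -> peval h c p = peval h' c' p.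
Proof. by move=> /funext -> /funext ->. Qed.

(** The same generators and relations serve, with coefficients carried along [g]. *)
Lemma tinr_finitely_presented (A B C : comPzRingType) (f : {rmorphism A -> B})
  (g : {rmorphism A -> C}) : finitely_presented f -> finitely_presented (tinr f g).
Proof.
move=> [I [J [r [b [gen rel univ]]]]].
have pE p : peval (tinr f g) (tinl f g \o b) (pmap_cst g p) = tinl f g (peval f b p).
  rewrite peval_pmap peval_rmorph; apply: eq_peval => // a /=.
  exact: (esym (tinlr f g a)).
exists I, J, (fun j => pmap_cst g (r j)), (tinl f g \o b); split.
- elim/tensR_ind => [|b' c|_ _ [p <-] [q <-]]; last by exists (PAdd p q).
    by exists (PCst 0); exact: rmorph0 (tinr f g).
  have [p pb] := gen b'; exists (PMul (pmap_cst g p) (PCst c)).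
  by rewrite pureR_inlr -pb -pE.
- by move=> j; rewrite pE rel rmorph0.
- move=> E h c hc; have [k [kf kb]] : exists k : {rmorphism B -> E},
      (forall a, k (f a) = rcomp h g a) /\ (forall i, k (b i) = c i).
    by apply: univ => j; rewrite -[RHS](hc j) peval_pmap.
  exists (tcopair_mor kf); split=> [a|i]; first exact: tcopair_inr.
  by rewrite [LHS](tcopair_inl kf).
Qed.

Lemma tinr_flat_fp (A B C : comPzRingType) (f : {rmorphism A -> B})
  (g : {rmorphism A -> C}) : flat_fp f -> flat_fp (tinr f g).
Proof.
move=> [ff fp]; split; last exact: tinr_finitely_presented.
exact: flat_pushout (tensR_pushout f g) ff.
Qed.

(** Base change of [N] to the tensor product of [B i] and [C] is, by [pushout_bc], base change to
    [B i] of [N] regarded over [A]. *)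
Lemma faithful_tinr (A C : comPzRingType) (I : Type) (B : I -> comPzRingType)
  (f : forall i, {rmorphism A -> B i}) (g : {rmorphism A -> C}) :
  faithful_family f -> faithful_family (fun i => tinr (f i) g).
Proof.
move=> ff N n nE; apply: (ff (restr g N)) => i.
have po := pushout_bc (tensR_pushout (f i) g) (pure_bc (tinr (f i) g) N).
apply: (is_bc_inj po); have sp := is_bc_semilin po.
by rewrite bcmap1 // (semilin0 (bcmap_semilin sp)) nE.
Qed.

Section Descent.
Context (R : comPzRingType) (I : finType) (C : I -> comPzRingType).
Context (f : forall k, {rmorphism R -> C k}).
Context (N : lmodType R) (Nk : forall k, lmodType (C k)) (u : forall k, N -> Nk k).
Context (P : forall k l, lmodType (tensR (f k) (f l))).
Context (al : forall k l, Nk k -> P k l) (be : forall k l, Nk l -> P k l).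
Arguments al {k l}.
Arguments be {k l}.

(** Existence in descent of elements; uniqueness is [faithful_bc]. The overlap module [P k l] is
    given only up to isomorphism, through [be], so that any model of the sections over an overlap
    fits. *)
Lemma faithful_descent (x : forall k, Nk k) :
  faithful_family f -> (forall k, is_bc (f k) (@u k)) ->
  (forall k l, semilin (tinl (f k) (f l)) (@al k l)) ->
  (forall k l, is_bc (tinr (f k) (f l)) (@be k l)) ->
  (forall k l m, @al k l (u k m) = be (u l m)) ->
  (forall k l, @al k l (x k) = be (x l)) ->
  exists m, forall k, u k m = x k.
Proof.
move=> ff bu sal bbe comm xE.
have su k := is_bc_semilin (bu k).
have lin k : linear (u k : N -> restr (f k) (Nk k)).
  by move=> a m m'; rewrite (semilinD (su k)) (semilinZ (su k)).
pose L k : {linear N -> restr (f k) (Nk k)} := mklin (@lin k).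
pose diag : {linear N -> pimod _} := pi_tuple L.
pose e : pimod (fun k => restr (f k) (Nk k)) := x.
(* It suffices to put e in the image of N after base change to each C k, and
   compatibility says that there it is the image of x k. *)
suff /qproj_eq0 [m mE] : qproj (imsub diag) e = 0.
  by exists m => k; rewrite -[x k]/(e k) -mE.
apply: ff => k.
have [y yE] : exists y, bcmap (f k) (u k) y = x k by case: (bu k).
suff h : pure (f k) 1 e = tmap (f k) diag y.
  transitivity (tmap (f k) (qproj (imsub diag)) (pure (f k) 1 e)).
    exact: (esym (tmap_pure _ _ _ _)).
  rewrite h -tmap_comp.
  move: (y); apply: (tens_ext1 (g := id)) => [||m].
  - exact: linear_semilin.
  - by split=> *; rewrite ?addr0 ?scaler0.
  - rewrite [LHS]tmap_pure; have -> : lcomp (qproj (imsub diag)) diag m = 0.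
      by apply/qproj_eq0; exists m.
    exact: (semilin0 (pure_semilin _ _)).
apply/subr0_eq/tens_pi_eq0 => l; rewrite linearB; apply/eqP; rewrite subr_eq0; apply/eqP.
(* The [l]-component lives in [C k (x)_R Nk l], which [pushout_bc] identifies with [P k l]; there
   the equation becomes the compatibility [xE]. *)
have po := pushout_bc (tensR_pushout (f k) (f l)) (bbe k l).
apply: (is_bc_inj po); have sp := is_bc_semilin po.
rewrite [tmap _ _ (pure _ _ _)]tmap_pure bcmap1 // [LHS](esym (xE k l)) -yE.
rewrite -tmap_comp tmap_bcmap //.
have sc : semilin (f k) ((be : restr (f l) (Nk l) -> restr (tinl (f k) (f l)) (P k l)) \o
    lcomp (pi_proj (fun k => restr (f k) (Nk k)) l) diag).
  exact: semilin_comp (linear_semilin _) sp _.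
have sal' : semilin id (al : Nk k -> restr (tinl (f k) (f l)) (P k l)).
  by case: (sal k l).
move: (y); apply: (tens_ext1 (g := id)).
- exact: semilin_comp (bcmap_semilin (su k)) sal' _.
- exact: bcmap_semilin.
- move=> m; rewrite /= !bcmap1 //; exact: comm.
Qed.
End Descent.

(** * Sheaves with a presentation over an object of the site *)

Lemma tbase_comm (A B C1 C2 D : comPzRingType) (f : {rmorphism A -> B})
  (g1 : {rmorphism B -> C1}) (g2 : {rmorphism B -> C2})
  (h1 : {rmorphism C1 -> D}) (h2 : {rmorphism C2 -> D})
  (f1 : {rmorphism A -> C1}) (f2 : {rmorphism A -> C2}) (f3 : {rmorphism A -> D})
  (e1 : forall a, g1 (f a) = f1 a) (e2 : forall a, g2 (f a) = f2 a)
  (e3 : forall a, h1 (f1 a) = f3 a) (e4 : forall a, h2 (f2 a) = f3 a)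
  (M : lmodType A) (x : tens f M) :
  (forall b, h1 (g1 b) = h2 (g2 b)) -> tbase e3 (tbase e1 x) = tbase e4 (tbase e2 x).
Proof.
move=> e; move: x; apply: (tens_ext1 (g := rcomp h1 g1)).
- exact: (semilin_comp (tbase_semilin _ _) (tbase_semilin _ _) (fun=> erefl)).
- exact: (semilin_comp (tbase_semilin _ _) (tbase_semilin _ _) e).
- by move=> m; rewrite !(tbase_pure, rmorph1).
Qed.

(** * Free modules and morphisms out of free sheaves *)

Section FreeModuleTheory.
Context (I : choiceType) (B : comPzRingType).

Fact fm1_finsupp (i : I) : (fun j => (j == i)%:R : B^o) \in @finsupp I B.
Proof. by apply/asboolP; exists [:: i] => j; rewrite inE => /negPf ->. Qed.
Definition fm1 (i : I) : freemod I B := Freemod (fm1_finsupp i).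

Definition fmsupp (x : freemod I B) : seq I := undup (sval (cid (asboolP _ (fmvalP x)))).
Fact fmsuppP (x : freemod I B) i : i \notin fmsupp x -> x i = 0.
Proof. by rewrite mem_undup; move: i; exact: (svalP (cid (asboolP _ (fmvalP x)))). Qed.

Section Lift.
Context (N : lmodType B) (g : I -> N).
Definition fmlift (x : freemod I B) : N := \sum_(i <- fmsupp x) x i *: g i.

(** Frees [fmlift] from the chosen support: stripped of zero coefficients, two lists that contain
    the support are permutations of each other. *)
Fact fmliftE (x : freemod I B) s :
  uniq s -> (forall i, i \notin s -> x i = 0) -> fmlift x = \sum_(i <- s) x i *: g i.
Proof.
have E (t : seq I) : \sum_(i <- t) x i *: g i =
    \sum_(i <- [seq i <- t | x i != 0]) x i *: g i.
  rewrite big_filter [LHS](bigID (fun i => x i != 0)) /= [X in _ + X]big1 ?addr0 //.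
  by move=> i /negPn /eqP ->; rewrite scale0r.
move=> us sP; rewrite /fmlift E [RHS]E; apply: perm_big; apply: uniq_perm.
- by rewrite filter_uniq // undup_uniq.
- exact: filter_uniq.
move=> i; rewrite !mem_filter; case: (altP (x i =P 0)) => //= nz.
apply/idP/idP => _; apply/negPn/negP => h; case/eqP: nz; [exact: sP|exact: fmsuppP].
Qed.

Lemma fmlift_semilin : semilin id fmlift.
Proof.
split=> [x y|a x].
  have us := undup_uniq (fmsupp x ++ fmsupp y).
  rewrite !(fmliftE us).
  - by rewrite -big_split; apply: eq_bigr => i _; exact: (scalerDl (g i) (x i) (y i)).
  - by move=> i; rewrite mem_undup mem_cat => /norP[_]; apply: fmsuppP.
  - by move=> i; rewrite mem_undup mem_cat => /norP[+ _]; apply: fmsuppP.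
  - move=> i; rewrite mem_undup mem_cat => /norP[hx hy].
    by change (x i + y i = 0); rewrite !fmsuppP // addr0.
rewrite (fmliftE (s := fmsupp x)) ?undup_uniq //.
  by rewrite scaler_sumr; apply: eq_bigr => i _; exact: (esym (scalerA a (x i) (g i))).
by move=> i /fmsuppP h; change (a * x i = 0); rewrite h mulr0.
Qed.

Lemma fmlift_fm1 i : fmlift (fm1 i) = g i.
Proof.
rewrite (fmliftE (s := [:: i])) // ?big_seq1 /= ?eqxx ?scale1r // => j.
by rewrite inE => /negPf ->.
Qed.
End Lift.

Lemma fm_decomp (x : freemod I B) : x = \sum_(i <- fmsupp x) (x i : B) *: fm1 i.
Proof.
have ev j (y z : freemod I B) : (y + z) j = y j + z j by [].
apply: freemod_eq => j.
rewrite (big_morph (fun y : freemod I B => y j) (ev j) (erefl : (0 : freemod I B) j = 0)).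
have [js|js] := boolP (j \in fmsupp x); last first.
  rewrite big_seq big1 ?fmsuppP // => i si.
  change (x i * (j == i)%:R = 0); case: eqP => [e|_]; last exact: mulr0.
  by rewrite e si in js.
rewrite (bigD1_seq j) //= ?undup_uniq // big1 ?addr0.
  by change (x j = x j * (j == j)%:R); rewrite eqxx mulr1.
by move=> i ne; change (x i * (j == i)%:R = 0); rewrite eq_sym (negPf ne) mulr0.
Qed.

Lemma fm_ext (C : comPzRingType) (h : B -> C) (P : lmodType C) (v w : freemod I B -> P) :
  semilin h v -> semilin h w -> (forall i, v (fm1 i) = w (fm1 i)) -> v =1 w.
Proof.
move=> sv sw e x; rewrite (fm_decomp x) (semilin_sum sv) (semilin_sum sw).
by apply: eq_bigr => i _; rewrite (semilinZ sv) (semilinZ sw) e.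
Qed.
End FreeModuleTheory.

Lemma fmmap_fm1 (I : choiceType) (B C : comPzRingType) (f : {rmorphism B -> C}) (i : I) :
  fmmap f (fm1 B i) = fm1 C i.
Proof. by apply: freemod_eq => j; exact: rmorph_nat. Qed.

Lemma mres_semilin (S : ringed_site) (M : modpsh S) (V U : S) (h : hom V U) :
  semilin (rres h) (@mres S M V U h).
Proof. by split=> *; [exact: mresD | exact: mresZ]. Qed.

Section FreeMorphism.
Context (S : ringed_site) (I : choiceType) (N : modpsh S) (g : forall U : S, I -> N U).
Hypothesis gN : forall (V U : S) (h : hom V U) i, mres h (g U i) = g V i.
Program Definition free_mor : modmor (free_mod S I) N :=
  @Modmor S (free_mod S I) N (fun U => mklin (semilin_linear (fmlift_semilin (g U)))) _.
Next Obligation.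
move=> V U h; apply: (@fm_ext I (rO U) (rO V) (rres h)) => [||i].
- exact: (semilin_comp (mres_semilin (free_mod S I) h) (fmlift_semilin _) (fun=> erefl)).
- exact: (semilin_comp (fmlift_semilin _) (mres_semilin N h) (fun=> erefl)).
- by rewrite /= fmmap_fm1 !fmlift_fm1 gN.
Qed.
Lemma free_mor_fm1 U i : free_mor U (fm1 _ i) = g U i.
Proof. exact: fmlift_fm1. Qed.
End FreeMorphism.

Lemma modmor_semilin (S : ringed_site) (M N : modpsh S) (f : modmor M N) (U : S) :
  semilin id (f U).
Proof. exact: linear_semilin. Qed.

Lemma sheaf_separated (S : ringed_site) (M : modpsh S) (U : S) (n : nat)
  (V : 'I_n -> S) (c : forall i, hom (V i) U) (x y : M U) :
  is_sheaf M -> rcover c -> (forall i, mres (c i) x = mres (c i) y) -> x = y.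
Proof.
move=> sM cc e.
have [|z [_ uz]] := sM _ _ _ _ cc (fun i => mres (c i) x).
  by move=> i j W k l kl; rewrite -!mres_comp kl.
by rewrite -(uz x) // -(uz y).
Qed.

Section FppfSite.
Context (A : comPzRingType).
Local Notation fppfA := (fppf A).

Lemma rid_flat_fp : flat_fp (rid A).
Proof. exact: (@flat_fp_iso _ _ (rid A) (rid A)). Qed.
Definition fp_top : fppfA := FppfOb rid_flat_fp.
Definition to_top (U : fppfA) : hom U fp_top :=
  @FppfHom A U fp_top (fp_str U) (fun=> erefl).
Lemma to_top_uniq (U : fppfA) (h k : hom U fp_top) : h = k.
Proof.
apply: fppf_hom_eq => a.
by have := fp_mapE h a => /= ->; have := fp_mapE k a => /= ->.
Qed.

Section Meet.
Context (U V W : fppfA) (f : hom V U) (g : hom W U) (ff : flat_fp (fp_map f)).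
Definition meet_ring : comPzRingType := tensR (fp_map f) (fp_map g).
(** An arrow of the site need not be flat, so one leg is assumed to be. The structure map goes
    through [W], because the coprojection from [W] is the base change of the flat leg [f]. *)
Definition fp_meet : fppfA := @FppfOb A meet_ring (rcomp (tinr (fp_map f) (fp_map g)) (fp_str W))
  (flat_fp_comp (fp_flat W) (tinr_flat_fp (fp_map g) ff)).
Fact meet_pr1E a : tinl (fp_map f) (fp_map g) (fp_str V a) = fp_str fp_meet a.
Proof. by rewrite -(fp_mapE f) tinlr (fp_mapE g). Qed.
Definition meet_pr1 : hom fp_meet V := @FppfHom A fp_meet V (tinl (fp_map f) (fp_map g)) meet_pr1E.
Definition meet_pr2 : hom fp_meet W :=
  @FppfHom A fp_meet W (tinr (fp_map f) (fp_map g)) (fun=> erefl).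
Lemma meet_comm : ccomp f meet_pr1 = ccomp g meet_pr2.
Proof. by apply: fppf_hom_eq => a; exact: tinlr. Qed.
Lemma meet_univ (T : fppfA) (k : hom T V) (l : hom T W) : ccomp f k = ccomp g l ->
  exists p : hom T fp_meet, ccomp meet_pr1 p = k /\ ccomp meet_pr2 p = l.
Proof.
move=> e; have kl a : fp_map k (fp_map f a) = fp_map l (fp_map g a).
  exact: (congr1 (fun h : fppf_hom T U => fp_map h a) e).
have pE a : tcopair_mor kl (fp_str fp_meet a) = fp_str T a.
  by rewrite -(fp_mapE l); exact: tcopair_inr.
exists (@FppfHom A T fp_meet (tcopair_mor kl) pE).
by split; apply: fppf_hom_eq => a; [exact: (tcopair_inl kl) | exact: (tcopair_inr kl)].
Qed.
End Meet.

(** On the slice over [U], the sheaf is the one attached to the module [G U]. *)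
Definition qc_at (G : modpsh fppfA) (U : fppfA) : Prop :=
  forall (V : fppfA) (h : hom V U), is_bc (fp_map h) (@mres _ G V U h).

Lemma cover_faithful (U : fppfA) (n : nat) (V : 'I_n -> fppfA)
  (c : forall i, hom (V i) U) : rcover c -> faithful_family (fun i => fp_map (c i)).
Proof. by case=> cf cs; apply: flat_faithful => // i; case: (cf i). Qed.

Section LocalPresentation.
Context (G : modpsh fppfA) (sG : is_sheaf G) (W : fppfA) (I J : choiceType).
Context (a : modmor (free_mod (slice W) I) (free_mod (slice W) J)).
Context (b : modmor (free_mod (slice W) J) (mod_slice W G)).
Hypothesis ab : right_exact a b.

Let W0 : slice W := SliceOb (idc W).
Let to0 (Z : slice W) : hom Z W0 := @SliceHom _ W Z W0 (sl_map Z) (compc1l _).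
Let N : lmodType (fp_ring W) := quo (imsub (a W0)).
Let s (Z : slice W) : {rmorphism W -> sl_ob Z} := fp_map (sl_map Z).
Let sE (Z' Z : slice W) (k : hom Z' Z) r : fp_map (sl_hom k) (s Z r) = s Z' r.
Proof. by rewrite /s -(sl_homE k). Qed.
(** The map from [O^(J)] onto the sheaf attached to [N], the cokernel of [a] on sections over [W];
    [b] will factor through it. *)
Let q (Z : slice W) : freemod J (sl_ob Z) -> tens (s Z) N :=
  fmlift (fun j => pure (s Z) 1 (qproj (imsub (a W0)) (fm1 W j))).

Let q_semilin Z : semilin id (@q Z). Proof. exact: fmlift_semilin. Qed.
Let q_nat (Z' Z : slice W) (k : hom Z' Z) y :
  tbase (sE k) (q y) = q (@mres _ (free_mod (slice W) J) _ _ k y).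
Proof.
move: y; apply: (@fm_ext J (sl_ob Z) (sl_ob Z') (fp_map (sl_hom k))) => [||j].
- exact: (semilin_comp (q_semilin _) (tbase_semilin _ _) (fun=> erefl)).
- exact: (semilin_comp (mres_semilin (free_mod (slice W) J) k) (q_semilin _) (fun=> erefl)).
- by rewrite /= fmmap_fm1 /q !fmlift_fm1 tbase_pure rmorph1.
Qed.
Let q_unit (Z : slice W) (y : freemod J W) :
  q (@mres _ (free_mod (slice W) J) _ _ (to0 Z) y) = pure (s Z) 1 (qproj (imsub (a W0)) y).
Proof.
move: y; apply: (@fm_ext J W (sl_ob Z) (s Z)) => [||j].
- exact: (semilin_comp (mres_semilin (free_mod (slice W) J) (to0 Z)) (q_semilin _) (fun=> erefl)).
- exact: (semilin_comp (linear_semilin _) (pure_semilin _ _) (fun=> erefl)).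
- by rewrite /= fmmap_fm1 /q fmlift_fm1.
Qed.
Let q_a (Z : slice W) x : q (a Z x) = 0.
Proof.
move: x; apply: (@fm_ext I (sl_ob Z) (sl_ob Z) id) => [||i].
- exact: (semilin_comp (modmor_semilin a Z) (q_semilin _) (fun=> erefl)).
- by split=> *; rewrite ?addr0 ?scaler0.
have -> : fm1 (sl_ob Z) i = @mres _ (free_mod (slice W) I) _ _ (to0 Z) (fm1 W i).
  by rewrite /= fmmap_fm1.
rewrite mnat q_unit; have -> : qproj (imsub (a W0)) (a W0 (fm1 W i)) = 0.
  by apply/qproj_eq0; exists (fm1 W i).
exact: (semilin0 (pure_semilin _ _)).
Qed.
Let q_surj (Z : slice W) x : exists y, @q Z y = x.
Proof.
elim/tens_ind: x => [|r n|x x' [y <-] [y' <-]].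
- by exists 0; exact: (semilin0 (q_semilin _)).
- have [y <-] := qproj_surj n.
  exists (r *: (@mres _ (free_mod (slice W) J) _ _ (to0 Z) y : freemod J (sl_ob Z))).
  by rewrite (semilinZ (q_semilin Z)) q_unit -pureE.
- by exists (y + y'); exact: (semilinD (q_semilin _)).
Qed.

Lemma presentation_qc_at : qc_at G W.
Proof.
have [ba ab_ker b_surj] := ab.
have [w sw wE] : exists2 w : N -> G W, semilin id w &
    forall y, w (qproj (imsub (a W0)) y) = b W0 y.
  by apply: quo_lift => [|_ [x <-]]; [exact: (modmor_semilin b W0) | exact: (ba W0)].
pose wZ (Z : slice W) n : G (sl_ob Z) := mres (sl_map Z) (w n).
have swZ Z : semilin (s Z) (@wZ Z).
  exact: (semilin_comp sw (mres_semilin G (sl_map Z)) (fun=> erefl)).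
pose th (Z : slice W) : tens (s Z) N -> G (sl_ob Z) := bcmap (s Z) (@wZ Z).
have sth Z : semilin id (@th Z) by exact: bcmap_semilin.
have thq Z y : th Z (q y) = b Z y.
  move: y; apply: (@fm_ext J (sl_ob Z) (sl_ob Z) id) => [||j].
  - exact: (semilin_comp (q_semilin _) (sth Z) (fun=> erefl)).
  - exact: (modmor_semilin b Z).
  have -> : fm1 (sl_ob Z) j = @mres _ (free_mod (slice W) J) _ _ (to0 Z) (fm1 W j).
    by rewrite /= fmmap_fm1.
  by rewrite q_unit mnat /th bcmap1 // /wZ wE.
have thN (Z' Z : slice W) (k : hom Z' Z) x : mres (sl_hom k) (th Z x) = th Z' (tbase (sE k) x).
  move: x; apply: (tens_ext1 (g := fp_map (sl_hom k))).
  - exact: (semilin_comp (sth Z) (mres_semilin G (sl_hom k)) (fun=> erefl)).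
  - exact: (semilin_comp (tbase_semilin _ _) (sth Z') (fun=> erefl)).
  by move=> n; rewrite tbase_pure rmorph1 /th !bcmap1 // /wZ -mres_comp sl_homE.
(* A lift [y] of [x] along [q] is killed by [b], hence is locally in the image of [a], where [q]
   vanishes; so [x] dies on a covering. *)
have th_inj Z x : th Z x = 0 -> x = 0.
  have [y <-] := q_surj x; rewrite thq => /ab_ker[n [V [c [cc cx]]]].
  apply: (faithful_bc (cover_faithful (c := fun i => sl_hom (c i)) cc)
    (fun i => tbase_bc (sE (c i)) N)) => i.
  by have [x' x'E] := cx i; rewrite q_nat -x'E q_a.
have th_surj Z z : exists x, th Z x = z.
  have [n [V [c [cc cz]]]] := b_surj Z z.
  pose y i := sval (cid (cz i)).
  have yE i : b (V i) (y i) = mres (sl_hom (c i)) z by rewrite /y; case: cid.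
  have cf i : flat_fp (fp_map (sl_hom (c i))) by case: cc.
  pose T i j := fp_meet (sl_hom (c j)) (cf i).
  pose ZT i j : slice W :=
    SliceOb (ccomp (sl_map (V i)) (meet_pr1 (sl_hom (c j)) (cf i)) : hom (T i j) W).
  pose k1 i j : hom (ZT i j) (V i) := @SliceHom _ W (ZT i j) (V i) (meet_pr1 _ _) erefl.
  have k2E i j : ccomp (sl_map (V j)) (meet_pr2 (sl_hom (c j)) (cf i)) =
      sl_map (ZT i j).
    rewrite -(sl_homE (c j)) /ZT [RHS]/sl_map -(sl_homE (c i)).
    by rewrite -!compcA meet_comm.
  pose k2 i j : hom (ZT i j) (V j) := @SliceHom _ W (ZT i j) (V j) (meet_pr2 _ _) (k2E i j).
  have [||||||x xE] := @faithful_descent _ _ _ (fun i => fp_map (sl_hom (c i)))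
    (tens (s Z) N) (fun i => tens (s (V i)) N) (fun i => tbase (sE (c i)))
    (fun i j => tens (s (ZT i j)) N) (fun i j => tbase (sE (k1 i j)))
    (fun i j => tbase (sE (k2 i j))) (fun i => q (y i)).
  - exact: cover_faithful cc.
  - by move=> i; exact: tbase_bc.
  - by move=> i j; exact: tbase_semilin.
  - by move=> i j; exact: tbase_bc.
  - move=> i j x; apply: tbase_comm => r.
    exact: (congr1 (fun h : fppf_hom _ _ => fp_map h r) (meet_comm (sl_hom (c j)) (cf i))).
  (* Injectivity of [th] over the overlap pulls the agreement of the sections of [G] back to the
     lifts. *)
  - move=> i j; apply: (semilin_inj (sth (ZT i j)) (@th_inj (ZT i j))).
    by rewrite -!thN !thq !yE -!mres_comp meet_comm.
  exists x; apply: (sheaf_separated sG cc) => i.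
  by rewrite thN xE thq yE.
have bcZ Z : is_bc (s Z) (@wZ Z) by split; [exact: swZ | exact: th_inj | exact: th_surj].
move=> V h.
have bh : is_bc (fp_map h) (@wZ (SliceOb h)) := bcZ (SliceOb h).
have b0 : is_bc (fp_map (idc W)) (@wZ W0) := bcZ W0.
(* Sections over [W] and over [V] are both base changes of [N]; cancelling [N] leaves the
   restriction map. *)
apply: (@bc_cancel _ _ _ (fp_map (idc W)) (fp_map h) (fp_map h) (fun=> erefl) _ _ _
  (@wZ W0) (mres h) b0); last exact: mres_semilin.
suff -> : mres h \o @wZ W0 = @wZ (SliceOb h) by [].
by apply: funext => n; rewrite /wZ /= mres_id.
Qed.
End LocalPresentation.
End FppfSite.

(** * Sections of quasi-coherent sheaves *)

Lemma tmapB (A B : comPzRingType) (f : {rmorphism A -> B}) (M N : lmodType A)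
  (l l1 l2 : {linear M -> N}) (x : tens f M) :
  (forall m, l m = l1 m - l2 m) -> tmap f l x = tmap f l1 x - tmap f l2 x.
Proof.
move=> e; move: x; apply: (tens_ext1 (linear_semilin _)) => [|m].
  have [D1 Z1] := linear_semilin (tmap f l1); have [D2 Z2] := linear_semilin (tmap f l2).
  by split=> [y z|a y]; [rewrite D1 D2 opprD addrACA | rewrite Z1 Z2 scalerBr].
rewrite [LHS]tmap_pure [X in X - _]tmap_pure [X in _ - X]tmap_pure e.
exact: (semilinB (pure_semilin f N)).
Qed.

Section QuasiCoherent.
Context (A : comPzRingType) (G : modpsh (fppf A)).
Local Notation fppfA := (fppf A).

Lemma qc_at_dom (U V : fppfA) (k : hom V U) : qc_at G U -> qc_at G V.
Proof.
move=> qU W h; apply: (@bc_cancel _ _ _ (fp_map k) (fp_map h) (fp_map (ccomp k h)) (fun=> erefl)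
  _ _ _ (mres k) (mres h) (qU _ k)); last exact: mres_semilin.
suff -> : mres h \o mres k = @mres _ G _ _ (ccomp k h) by exact: qU.
by apply: funext => m; rewrite /= mres_comp.
Qed.

Definition sec_mod (U : fppfA) : lmodType A := restr (fp_str U) (G U).
Fact sec_res_linear (V U : fppfA) (k : hom V U) : linear (mres k : sec_mod U -> sec_mod V).
Proof.
apply: semilin_linear; have [kD kZ] := mres_semilin G k; split=> [x y|a x]; first exact: kD.
rewrite [LHS]kZ; exact: (congr1 (fun b : fp_ring V => b *: (mres k x : G V)) (fp_mapE k a)).
Qed.
Definition sec_res (V U : fppfA) (k : hom V U) : {linear sec_mod U -> sec_mod V} :=
  mklin (sec_res_linear k).

Section OverC.
Context (C : fppfA).
Local Notation h := (to_top C).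
Local Notation D U := (fp_meet (U := fp_top A) (f := to_top U) h (fp_flat U)).
Local Notation pr1 U := (meet_pr1 (U := fp_top A) (f := to_top U) h (fp_flat U)).
Local Notation pr2 U := (meet_pr2 (U := fp_top A) (f := to_top U) h (fp_flat U)).
(** The sections over the product of [U] with [C], as a [C]-module. The map [be] compares
    [C (x)_A G(U)] with it and is bijective when [G] is quasi-coherent at [U]. *)
Let Dmod U : lmodType C := restr (fp_map (pr2 U)) (G (D U)).
Let be U : tens (fp_str C) (sec_mod U) -> Dmod U :=
  bcmap (fp_str C) (mres (pr1 U) : sec_mod U -> Dmod U).

Let pr1_semilin U : semilin (fp_str C) (mres (pr1 U) : sec_mod U -> Dmod U).
Proof.
apply: semilin_restr (mres_semilin G (pr1 U)) => a.
exact: (esym (tinlr (fp_str U) (fp_str C) a)).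
Qed.
Let be_semilin U : semilin id (be (U := U)).
Proof. exact: bcmap_semilin. Qed.
Let be_bc U : qc_at G U -> is_bc (fp_str C) (mres (pr1 U) : sec_mod U -> Dmod U).
Proof. by move=> qU; exact: (pushout_bc (tensR_pushoutC (fp_str U) (fp_str C)) (qU _ (pr1 U))). Qed.

Let be_nat (V U : fppfA) (k : hom V U) : exists2 Dk : hom (D V) (D U),
  ccomp (pr2 U) Dk = pr2 V & forall x, mres Dk (be x) = be (tmap _ (sec_res k) x).
Proof.
have [Dk [Dk1 Dk2]] := @meet_univ A _ _ _ (to_top U) h (fp_flat U) _ (ccomp k (pr1 V)) (pr2 V)
  (to_top_uniq _ _).
exists Dk => // x.
have sDk : semilin id (mres Dk : Dmod U -> Dmod V).
  have [kD kZ] := mres_semilin G Dk; split=> [y z|c y]; first exact: kD.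
  rewrite [LHS]kZ; apply: (congr1 (fun b => b *: (mres Dk y : G (D V)))).
  exact: (congr1 (fun l : fppf_hom _ _ => fp_map l c) Dk2).
move: x; apply: tens_ext1 => [||m].
- exact: (semilin_comp (@be_semilin U) sDk (fun=> erefl)).
- exact: (semilin_comp (linear_semilin _) (@be_semilin V) (fun=> erefl)).
rewrite [tmap _ _ _]tmap_pure /be !bcmap1; try exact: pr1_semilin.
by rewrite /= -!mres_comp Dk1.
Qed.

Context (n : nat) (W : 'I_n -> fppfA).
Hypothesis cW : rcover (fun i => to_top (W i)).
Hypothesis qW : forall i, qc_at G (W i).
Hypothesis sG : is_sheaf G.
Let M := sec_mod (fp_top A).

(** Surjectivity on primes of the pulled back family is obtained by a detour through
    faithfulness. *)
Let D_cover : rcover (fun i => pr2 (W i)).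
Proof.
split=> [i|]; first exact: tinr_flat_fp (fp_flat (W i)).
apply: faithful_surjective.
exact: (@faithful_tinr A C 'I_n W (fun i => fp_str (W i)) (fp_str C) (cover_faithful cW)).
Qed.

Let h_semilin : semilin (fp_str C) (mres h : M -> G C).
Proof. exact: (mres_semilin G h). Qed.

Let be_res i (x : tens (fp_str C) M) :
  mres (pr2 (W i)) (bcmap (fp_str C) (mres h : M -> G C) x) =
  be (tmap _ (sec_res (to_top (W i))) x).
Proof.
have s2 : semilin id (mres (pr2 (W i)) : G C -> Dmod (W i)).
  by case: (mres_semilin G (pr2 (W i))).
move: x; apply: tens_ext1 => [||m].
- exact: (semilin_comp (bcmap_semilin h_semilin) s2 (fun=> erefl)).
- exact: (semilin_comp (linear_semilin _) (@be_semilin (W i)) (fun=> erefl)).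
rewrite [tmap _ _ _]tmap_pure /be !bcmap1; try exact: pr1_semilin; try exact: h_semilin.
by rewrite /= -!mres_comp meet_comm.
Qed.

Let be_inj i : injective (be (U := W i)).
Proof. exact: is_bc_inj (be_bc (@qW i)). Qed.

(** Separatedness embeds [G(A)] in the product of the [G (W i)]; flatness of [C] preserves this, and
    [be] identifies the components. *)
Let glue_inj (x : tens (fp_str C) M) : bcmap (fp_str C) (mres h : M -> G C) x = 0 -> x = 0.
Proof.
move=> x0; pose diag := pi_tuple (fun i => sec_res (to_top (W i))).
have di : injective diag.
  move=> m m' e; apply: (sheaf_separated sG cW) => i.
  exact: (congr1 (fun y : pimod _ => y i) e).
have [ff _] := fp_flat C.
apply: (ff _ _ diag di); rewrite linear0; apply: tens_pi_eq0 => i.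
rewrite -tmap_comp; apply: (@be_inj i).
have -> : lcomp (pi_proj (fun i => sec_mod (W i)) i) diag = sec_res (to_top (W i)) by exact: lin_eq.
by rewrite -be_res x0 (semilin0 (mres_semilin G _)) (semilin0 (@be_semilin _)).
Qed.

Let glue_surj (z : G C) : exists x, bcmap (fp_str C) (mres h : M -> G C) x = z.
Proof.
have ex i : {y | be y = mres (pr2 (W i)) z}.
  by apply: cid; have [_ _ sj] := be_bc (@qW i); exact: sj.
pose y i := sval (ex i); have yE i : be (y i) = mres (pr2 (W i)) z := svalP (ex i).
(* [Y] represents the restrictions of [z] in [C (x)] the product of the [G (W i)]. *)
have [Y YE] := tens_pi_ex y.
pose WW (p : 'I_n * 'I_n) :=
  fp_meet (to_top (W p.2)) (fp_flat (W p.1) : flat_fp (fp_map (to_top _))).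
pose k1 p : hom (WW p) (W p.1) := meet_pr1 _ _.
pose k2 p : hom (WW p) (W p.2) := meet_pr2 _ _.
pose M1 := pimod (fun i => sec_mod (W i)).
pose d1 p := lcomp (sec_res (k1 p)) (pi_proj (fun i => sec_mod (W i)) p.1).
pose d2 p := lcomp (sec_res (k2 p)) (pi_proj (fun i => sec_mod (W i)) p.2).
have dlin p : linear (fun e : M1 => d1 p e - d2 p e).
  have [D1 Z1] := linear_semilin (d1 p); have [D2 Z2] := linear_semilin (d2 p).
  by move=> a e e'; rewrite D1 D2 Z1 Z2 opprD addrACA scalerBr.
pose d : {linear M1 -> pimod (fun p => sec_mod (WW p))} := pi_tuple (fun p => mklin (dlin p)).
(* Checked over the product of each overlap with [C], where [be] is injective and both restrictions
   come from [z]. *)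
have dY : tmap _ d Y = 0.
  apply: tens_pi_eq0 => p; rewrite -tmap_comp.
  rewrite (tmapB (l1 := d1 p) (l2 := d2 p)) // !tmap_comp !YE; apply/eqP; rewrite subr_eq0.
  apply/eqP; apply: (is_bc_inj (be_bc (qc_at_dom (k1 p) (@qW p.1)))).
  have [K1 K1E K1N] := be_nat (k1 p); have [K2 K2E K2N] := be_nat (k2 p).
  have := K1N (y p.1); have := K2N (y p.2).
  by rewrite /be => <- <-; rewrite -/(be (y p.1)) -/(be (y p.2)) !yE -!mres_comp K1E K2E.
have [ff _] := fp_flat C; have [s [sK sE]] := flat_ker ff dY.
(* By flatness, [Y] is a sum of terms [c (x) e] with [e] a compatible family, and each [e] glues.
   The default 0 for incompatible families is never consulted, as [sK] places every term in the
   kernel of [d]. *)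
have gl (e : M1) : {m : M | d e = 0 -> forall i, sec_res (to_top (W i)) m = e i}.
  apply: cid; have [de|nde] := pselect (d e = 0); last by exists 0.
  have [|m [mE _]] := @sG _ _ _ _ cW e; last by exists m.
  move=> i j V k l kl.
  have [p [<- <-]] := meet_univ (fp_flat (W i) : flat_fp (fp_map (to_top _))) kl.
  rewrite !mres_comp; congr mres; apply/subr0_eq.
  exact: (congr1 (fun e : pimod _ => e (i, j)) de).
exists (\sum_(p <- s) pure _ p.1 (sval (gl p.2))).
apply: (sheaf_separated sG D_cover) => i.
rewrite be_res -yE; apply: (congr1 (be (U := W i))).
rewrite -YE sE !linear_sum big_seq [RHS]big_seq; apply: eq_bigr => p /sK dp.
rewrite [LHS]tmap_pure [RHS]tmap_pure; congr (pure _ _ _).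
exact: (svalP (gl p.2) dp i).
Qed.

Lemma glue_bc : is_bc (fp_str C) (mres h : M -> G C).
Proof. by split; [exact: h_semilin | exact: glue_inj | exact: glue_surj]. Qed.
End OverC.

Theorem quasi_coherent_qc_at : is_sheaf G -> quasi_coherent G -> qc_at G (fp_top A).
Proof.
move=> sG qG C h; rewrite (to_top_uniq h (to_top C)).
have [n [W [c [cc cW]]]] := qG (fp_top A).
have cE : c = fun i => to_top (W i).
  by apply: functional_extensionality_dep => i; exact: to_top_uniq.
subst c.
(* [sec_mod] carries the scalar action restricted along [rid A]; the identity map, as a base change,
   passes between the two module structures. *)
have b0 : is_bc (rid A) (id : G (fp_top A) -> sec_mod (fp_top A)).
  by apply: bc_intro => // P v sv; exists v.
have qW i : qc_at G (W i).
  by have [I [J [a [b ab]]]] := cW i; exact: (presentation_qc_at sG ab).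
exact (@bc_comp _ _ _ (rid A) (fp_str C) (fp_map (to_top C)) (fun=> erefl)
  (G (fp_top A)) (sec_mod (fp_top A)) (G C)
  id (mres (to_top C)) b0 (glue_bc C cc qW sG)).
Qed.
End QuasiCoherent.

(** * The quasi-coherent sheaf of a module *)

Section Tilde.
Context (A : comPzRingType) (M : lmodType A).

Program Definition tilde : modpsh (fppf A) :=
  @Modpsh (fppf A) (fun U => tens (fp_str U) M) (fun V U h => tbase (@fp_mapE A V U h)) _ _ _ _.
Next Obligation. by move=> V U h; exact: tbaseD. Qed.
Next Obligation. by move=> V U h; exact: tbaseZ. Qed.
Next Obligation.
move=> U; apply: (tens_ext1 (tbase_semilin _ _)) => [|m]; first by split.
by rewrite tbase_pure rmorph1.
Qed.
Next Obligation.
move=> W V U h k; apply: (tens_ext1 (tbase_semilin _ _)) => [|m].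
  exact: (semilin_comp (tbase_semilin _ _) (tbase_semilin _ _) (fun=> erefl)).
by rewrite !(tbase_pure, rmorph1).
Qed.

Lemma tilde_sheaf : is_sheaf tilde.
Proof.
move=> U n V c cc m mE; have cf i : flat_fp (fp_map (c i)) by case: cc.
have fc := cover_faithful cc.
have bc i := tbase_bc (@fp_mapE A (V i) U (c i)) M.
pose T i j := fp_meet (c j) (cf i).
have [||||||x xE] := @faithful_descent U _ V (fun i => fp_map (c i))
  (tens (fp_str U) M) (fun i => tens (fp_str (V i)) M)
  (fun i => tbase (@fp_mapE A (V i) U (c i)))
  (fun i j => tens (fp_str (T i j)) M)
  (fun i j => tbase (@fp_mapE A (T i j) (V i) (meet_pr1 (c j) (cf i))))
  (fun i j => tbase (@fp_mapE A (T i j) (V j) (meet_pr2 (c j) (cf i)))) m.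
- exact: fc.
- exact: bc.
- by move=> i j; exact: tbase_semilin.
- by move=> i j; exact: tbase_bc.
- by move=> i j x; apply: tbase_comm => a; exact: tinlr.
- by move=> i j; exact: (mE i j (T i j) (meet_pr1 _ _) (meet_pr2 _ _) (meet_comm _ (cf i))).
exists x; split=> // y yE; apply/subr0_eq; apply: (faithful_bc fc bc) => i.
by rewrite (semilinB (tbase_semilin _ _)) xE [X in _ - X]yE subrr.
Qed.

Section Presentation.
Context (V : fppf A).
Local Notation S := (slice V).
Let g (Z : S) : M -> mod_slice V tilde Z := pure (fp_str (sl_ob Z)) 1.
Let gN (Z' Z : S) (k : hom Z' Z) m : mres k (g Z m) = g Z' m.
Proof. by rewrite /= /g tbase_pure rmorph1. Qed.
Let b := free_mor gN.
(* M is the quotient of the free module on its elements by these relations. *)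
Definition tilde_rel : choiceType := (M * M + A * M)%type.
Let r (Z : S) (i : tilde_rel) : freemod M (sl_ob Z) :=
  match i with
  | inl (m, m') => fm1 _ (m + m') - fm1 _ m - fm1 _ m'
  | inr (a, m) => fm1 _ (a *: m) - fp_str (sl_ob Z) a *: fm1 _ m
  end.
Let rN (Z' Z : S) (k : hom Z' Z) i : @mres _ (free_mod S M) _ _ k (r Z i) = r Z' i.
Proof.
have sk : semilin (fp_map (sl_hom k)) (@fmmap M _ _ (fp_map (sl_hom k))).
  exact: (mres_semilin (free_mod S M) k).
case: i => [[m m']|[a m]] /=.
  by rewrite !(semilinB sk) /= !fmmap_fm1.
rewrite (semilinB sk) (semilinZ sk) /= !fmmap_fm1; congr (_ - _ *: _).
exact: fp_mapE.
Qed.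
Let a := free_mor (N := free_mod S M) rN.

Let ba (Z : S) x : b Z (a Z x) = 0.
Proof.
move: x; apply: (@fm_ext _ (sl_ob Z) (sl_ob Z) id) => [||i].
- exact: (semilin_comp (modmor_semilin a Z) (modmor_semilin b Z) (fun=> erefl)).
- by split=> *; rewrite ?addr0 ?scaler0.
have sb : semilin id (b Z : freemod M (sl_ob Z) -> tens (fp_str (sl_ob Z)) M).
  exact: (modmor_semilin b Z).
have sp := pure_semilin (fp_str (sl_ob Z)) M.
rewrite free_mor_fm1; case: i => [[m m']|[c m]]; rewrite /r.
  by rewrite !(semilinB sb) !free_mor_fm1 /g (semilinD sp) addrAC addrK subrr.
by rewrite (semilinB sb) (semilinZ sb) !free_mor_fm1 /g (semilinZ sp) subrr.
Qed.

(** Modulo the relations, [m |-> fm1 m] is semilinear, so it extends to [O(Z) (x) M]; this extension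
    recovers the class of [y] from [b Z y]. *)
Let b_ker (Z : S) y : b Z y = 0 -> exists x, a Z x = y.
Proof.
pose Q := imsub (a Z); pose ga m := qproj Q (fm1 _ m).
have sq : semilin id (qproj Q : freemod M (sl_ob Z) -> quo Q) by exact: linear_semilin.
have sga : semilin (fp_str (sl_ob Z)) ga.
  split=> [m m'|c m]; apply/subr0_eq; rewrite /ga.
    rewrite -(semilinD sq) -(semilinB sq); apply/qproj_eq0; exists (fm1 _ (inl (m, m'))).
    by rewrite free_mor_fm1 /= opprD addrA.
  rewrite -(semilinZ sq) -(semilinB sq); apply/qproj_eq0; exists (fm1 _ (inr (c, m))).
  by rewrite free_mor_fm1.
have sbg := bcmap_semilin sga.
move=> by0; apply/(qproj_eq0 Q).
have -> : qproj Q y = bcmap _ ga (b Z y); last by rewrite by0 (semilin0 sbg).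
move: (y); apply: (@fm_ext _ (sl_ob Z) (sl_ob Z) id) => [||m].
- exact: linear_semilin.
- exact: (semilin_comp (modmor_semilin b Z) sbg (fun=> erefl)).
- by rewrite free_mor_fm1 /g bcmap1.
Qed.

Let b_surj (Z : S) z : exists y, b Z y = z.
Proof.
have sb := modmor_semilin b Z.
elim/tens_ind: z => [|c m|x x' [y <-] [y' <-]].
- by exists 0; exact: (semilin0 sb).
- by exists (c *: fm1 _ m); rewrite (semilinZ sb) free_mor_fm1 /g [RHS]pureE.
- by exists (y + y'); exact: (semilinD sb).
Qed.

Lemma id_cover (U : fppf A) : rcover (fun _ : 'I_1 => idc U).
Proof.
split=> [_|P PP]; first exact: rid_flat_fp.
by exists ord0, P.
Qed.

Lemma tilde_presentation : exists (I J : choiceType)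
  (a : modmor (free_mod S I) (free_mod S J)) (b : modmor (free_mod S J) (mod_slice V tilde)),
  right_exact a b.
Proof.
(* Exactness already holds on sections, so the identity covering serves for both local
   conditions. *)
exists tilde_rel, M, a, b; split; first exact: ba.
  move=> Z y /b_ker[x xE]; exists 1, (fun=> Z), (fun=> idc Z).
  split=> [|_]; first exact: id_cover.
  by exists x; rewrite xE mres_id.
move=> Z z; have [y yE] := b_surj z; exists 1, (fun=> Z), (fun=> idc Z).
split=> [|_]; first exact: id_cover.
by exists y; rewrite yE mres_id.
Qed.
End Presentation.

Lemma tilde_qc : quasi_coherent tilde.
Proof.
move=> V; exists 1, (fun=> V), (fun=> idc V); split=> [|_]; first exact: id_cover.
exact: tilde_presentation.
Qed.
End Tilde.

(** * Transport along arrows of the groupoid *)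

Lemma tbase_tbase (A B C D : comPzRingType) (f : {rmorphism A -> B})
  (g : {rmorphism B -> C}) (h : {rmorphism C -> D}) (k : {rmorphism B -> D})
  (f1 : {rmorphism A -> C}) (f2 : {rmorphism A -> D})
  (e1 : forall a, g (f a) = f1 a) (e2 : forall a, h (f1 a) = f2 a)
  (e3 : forall a, k (f a) = f2 a) (M : lmodType A) (x : tens f M) :
  (forall b, h (g b) = k b) -> tbase e2 (tbase e1 x) = tbase e3 x.
Proof.
move=> e; move: x; apply: (tens_ext1 (g := k)).
- exact: (semilin_comp (tbase_semilin _ _) (tbase_semilin _ _) (fun b => esym (e b))).
- exact: tbase_semilin.
- by move=> m; rewrite !(tbase_pure, rmorph1).
Qed.

Lemma tbase_id (A B : comPzRingType) (f : {rmorphism A -> B}) (g : {rmorphism B -> B})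
  (e : forall a, g (f a) = f a) (M : lmodType A) (x : tens f M) :
  (forall b, g b = b) -> tbase e x = x.
Proof.
move=> ge; move: x; apply: (tens_ext1 (tbase_semilin _ _)) => [|m].
  by split=> // b x; rewrite ge.
by rewrite tbase_pure rmorph1.
Qed.

Lemma tcopair_rmorph (A B C D E : comPzRingType) (f : {rmorphism A -> B})
  (g : {rmorphism A -> C}) (u : {rmorphism B -> D}) (v : {rmorphism C -> D})
  (w : {rmorphism D -> E}) (x : tensR f g) :
  (forall a, u (f a) = v (g a)) -> tcopair (w \o u) (w \o v) x = w (tcopair u v x).
Proof.
move=> uv; apply: (tcopairE (h := rcomp w (tcopair_mor uv))) => [b|c].
  exact: (congr1 w (tcopair_inl uv b)).
exact: (congr1 w (tcopair_inr uv c)).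
Qed.

Section Coaction.
Context (H : hopf_algebroid).
Local Notation A0 := (ha0 H).
Local Notation A1 := (ha1 H).
Local Notation L := (etaL H).
Local Notation R := (etaR H).
Local Notation I1 := (tinl R L).
Local Notation I2 := (tinr R L).

Section CotenMaps.
Context (M : lmodType A0).

Fact coten_assoc_aux : semilin R
  (fun t : restr L (coten M) => tbase (f' := rcomp I2 R) (fun=> erefl) (t : coten M)
     : restr I1 (tens (rcomp I2 R) M)).
Proof.
apply: (semilin_restr (f := R) (i := I1) (j := I2)); last exact: tbase_semilin.
exact: tinlr.
Qed.
Lemma coten_assoc_semilin : semilin I1 (@coten_assoc H M).
Proof. exact: (bcmap_semilin coten_assoc_aux). Qed.
Lemma coten_assoc_pure1 t : coten_assoc (pure R 1 (t : restr L (coten M))) =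
  tbase (f' := rcomp I2 R) (fun=> erefl) (t : coten M).
Proof. exact: (bcmap1 coten_assoc_aux). Qed.

Lemma coten_eps_semilin : semilin (eps H) (@coten_eps H M).
Proof.
have s : semilin R (id : M -> restr (eps H) M).
  by split=> // a m; rewrite -[in LHS](eps_etaR a).
exact: (bcmap_semilin s).
Qed.
Lemma coten_eps_pure1 m : coten_eps (pure R 1 m : coten M) = m.
Proof.
have s : semilin R (id : M -> restr (eps H) M).
  by split=> // a x; rewrite -[in LHS](eps_etaR a).
exact: (bcmap1 s m).
Qed.
End CotenMaps.

Section Action.
Context (M : lmodType A0) (psi : {linear M -> restr L (coten M)}).
Hypothesis psiA : forall m, coten_nabla (psi m) = coten_assoc (tmap R psi (psi m)).

Lemma psi_semilin : semilin L (psi : M -> coten M).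
Proof. by split=> *; [rewrite linearD | rewrite linearZ]. Qed.

(* For an arrow w of the groupoid (A0, A1) with values in W, from r to l, the
   comodule structure induces a map from the fibre at l to the fibre at r. *)
Definition transport1 (W : comPzRingType) (w : {rmorphism A1 -> W}) (r : {rmorphism A0 -> W})
  (er : forall a, w (R a) = r a) (m : M) : tens r M := tbase er (psi m : coten M).
Definition transport (W : comPzRingType) (w : {rmorphism A1 -> W}) (l r : {rmorphism A0 -> W})
  (er : forall a, w (R a) = r a) : tens l M -> tens r M := bcmap l (transport1 er).

Section OneArrow.
Context (W : comPzRingType) (w : {rmorphism A1 -> W}) (l r : {rmorphism A0 -> W}).
Context (el : forall a, w (L a) = l a) (er : forall a, w (R a) = r a).
Lemma transport1_semilin : semilin l (transport1 er).
Proof. exact: (semilin_comp psi_semilin (tbase_semilin er M) (fun a => esym (el a))). Qed.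
Lemma transport_semilin : semilin id (@transport W w l r er).
Proof. exact: (bcmap_semilin transport1_semilin). Qed.
Lemma transport_pure1 m : transport er (pure l 1 m) = transport1 er m.
Proof. exact: (bcmap1 transport1_semilin). Qed.

Lemma tbase_transport1 (W' : comPzRingType) (g : {rmorphism W -> W'})
  (w' : {rmorphism A1 -> W'}) (r' : {rmorphism A0 -> W'})
  (er' : forall a, w' (R a) = r' a) (e : forall a, g (r a) = r' a) m :
  (forall b, g (w b) = w' b) -> tbase e (transport1 er m) = transport1 er' m.
Proof. exact: tbase_tbase. Qed.
End OneArrow.

Lemma tbase_transport (W : comPzRingType) (w : {rmorphism A1 -> W})
  (l r : {rmorphism A0 -> W}) (el : forall a, w (L a) = l a) (er : forall a, w (R a) = r a)
  (W' : comPzRingType) (g : {rmorphism W -> W'}) (w' : {rmorphism A1 -> W'})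
  (l' r' : {rmorphism A0 -> W'}) (el' : forall a, w' (L a) = l' a)
  (er' : forall a, w' (R a) = r' a) (e1 : forall a, g (l a) = l' a)
  (e2 : forall a, g (r a) = r' a) (x : tens l M) :
  (forall b, g (w b) = w' b) -> tbase e2 (transport er x) = transport er' (tbase e1 x).
Proof.
move=> gw; move: x; apply: (tens_ext1 (g := g)) => [||m].
- exact: (semilin_comp (transport_semilin el er) (tbase_semilin _ _) (fun=> erefl)).
- exact: (semilin_comp (tbase_semilin _ _) (transport_semilin el' er') (fun=> erefl)).
rewrite /= tbase_pure rmorph1 (transport_pure1 el er) (transport_pure1 el' er').
exact: tbase_transport1.
Qed.

(** The composable arrows [u], [v] define [cop] on [A1 (x) A1], and [p] is their composite. Both
    sides are the images under [cop] of the two sides of coassociativity. *)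
Lemma transport_comp (W : comPzRingType) (u v p : {rmorphism A1 -> W})
  (k r : {rmorphism A0 -> W}) (ur : forall a, u (R a) = k a)
  (vl : forall a, v (L a) = k a) (vr : forall a, v (R a) = r a)
  (pr : forall a, p (R a) = r a) :
  (forall b, tcopair u v (nabla H b) = p b) ->
  forall m, transport vr (transport1 ur m) = transport1 pr m.
Proof.
move=> pE m; have uv a : u (R a) = v (L a) by rewrite ur vl.
pose cop := tcopair_mor uv.
have e a : cop (rcomp I2 R a) = r a by rewrite -vr; exact: (tcopair_inr uv).
have cop1 x : transport vr (tbase ur x) = tbase e (coten_assoc (tmap R psi x)).
  have s3 := semilin_comp (linear_semilin (tmap R psi)) (coten_assoc_semilin M) (fun=> erefl).
  move: x; apply: (tens_ext1 (g := u)) => [||m'].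
  - exact: (semilin_comp (tbase_semilin _ _) (transport_semilin vl vr) (fun=> erefl)).
  - apply: (semilin_comp s3 (tbase_semilin e M)) => b; exact: (esym (tcopair_inl uv b)).
  rewrite tbase_pure rmorph1 (transport_pure1 vl vr) [tmap _ _ _]tmap_pure coten_assoc_pure1.
  by apply/esym/tbase_tbase => b; exact: (tcopair_inr uv).
rewrite cop1 -psiA; apply: tbase_tbase => b; exact: pE.
Qed.
End Action.

Section Comodule.
Context (M : comod_ob H).
Local Notation tr1 := (transport1 (co_psi M)).
Local Notation tr := (transport (co_psi M)).

(** An arrow that factors through [eps] is an identity arrow, where transport reduces to the counit
    axiom. *)
Lemma transport1_unit (W : comPzRingType) (p : {rmorphism A1 -> W}) (r : {rmorphism A0 -> W})
  (pr : forall a, p (R a) = r a) m : (forall b, p b = r (eps H b)) -> tr1 pr m = pure r 1 m.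
Proof.
move=> pE; rewrite -[in RHS](co_unit m) /transport1.
move: (co_psi M m : coten (co_mod M)); apply: (tens_ext1 (tbase_semilin pr _)) => [|m'].
  exact: (semilin_comp (coten_eps_semilin _) (pure_semilin r _) pE).
by rewrite coten_eps_pure1 tbase_pure rmorph1.
Qed.

Context (W : comPzRingType) (w wk : {rmorphism A1 -> W}) (l r : {rmorphism A0 -> W}).
Context (el : forall a, w (L a) = l a) (er : forall a, w (R a) = r a).
Context (kl : forall a, wk (L a) = r a) (kr : forall a, wk (R a) = l a).
Hypothesis wkE : forall b, wk b = w (kappa H b).

(** [wk] is the inverse arrow of [w]; by the antipode axiom their composite factors through
    [eps]. *)
Lemma transport_kappal m : tr er (tr1 kr m) = pure r 1 m.
Proof.
rewrite (@transport_comp _ (co_psi M) (@co_assoc _ M) _ wk w (rcomp (rcomp w R) (eps H)) _ _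
  kr el er) => [a|e|b].
- by rewrite /= eps_etaR er.
- by apply: transport1_unit => b; rewrite -er.
- have -> : tcopair wk w (nabla H b) = tcopair (w \o kappa H) (w \o rid A1) (nabla H b).
    by apply: tcopair_eq => s //=.
  rewrite tcopair_rmorph; last exact: kappa_etaR.
  by rewrite /= -nabla_kappal.
Qed.

Lemma transport_kappar m : tr kr (tr1 er m) = pure l 1 m.
Proof.
rewrite (@transport_comp _ (co_psi M) (@co_assoc _ M) _ w wk (rcomp (rcomp w L) (eps H)) _ _
  er kl kr) => [a|e|b].
- by rewrite /= eps_etaR el.
- by apply: transport1_unit => b; rewrite -el.
- have -> : tcopair w wk (nabla H b) = tcopair (w \o rid A1) (w \o kappa H) (nabla H b).
    by apply: tcopair_eq => s //=.
  rewrite tcopair_rmorph; last by move=> a; rewrite kappa_etaL.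
  by rewrite /= -nabla_kappar.
Qed.

Lemma transportK x : tr kr (tr er x) = x.
Proof.
move: x; apply: (tens_ext1 (g := id)) => [||m]; last 1 first.
- by rewrite (transport_pure1 _ el) transport_kappar.
- exact: (semilin_comp (transport_semilin _ el er) (transport_semilin _ kl kr) (fun=> erefl)).
- by split.
Qed.
Lemma transportVK x : tr er (tr kr x) = x.
Proof.
move: x; apply: (tens_ext1 (g := id)) => [||m]; last 1 first.
- by rewrite (transport_pure1 _ kl) transport_kappal.
- exact: (semilin_comp (transport_semilin _ kl kr) (transport_semilin _ el er) (fun=> erefl)).
- by split.
Qed.
End Comodule.
End Coaction.

(** * The equivalence *)

Lemma tbase_inv (A B : comPzRingType) (f f' : {rmorphism A -> B})
  (e : forall a, rid B (f a) = f' a) (e' : forall a, rid B (f' a) = f a)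
  (M : lmodType A) (x : tens f M) : tbase e' (tbase e x) = x.
Proof.
rewrite (@tbase_tbase _ _ _ _ _ _ _ (rid B) _ _ e e' (fun=> erefl)) //.
exact: tbase_id.
Qed.

Section Equivalence.
Context (H : hopf_algebroid).
Local Notation A0 := (ha0 H).
Local Notation A1 := (ha1 H).
Local Notation L := (etaL H).
Local Notation R := (etaR H).
Local Notation I1 := (tinl R L).
Local Notation I2 := (tinr R L).
Local Notation NB := (nabla H).
Context (fL : flat_fp L) (fR : flat_fp R) (f12 : flat_fp I1) (f23 : flat_fp I2)
  (f13 : flat_fp NB).
Context (e1 : forall a, NB (L a) = I1 (L a)) (e2 : forall a, I2 (L a) = I1 (R a))
  (e3 : forall a, I2 (R a) = NB (R a)).
(** The second and third face maps are literally the coprojections and the comultiplication, so that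
    coassociativity and the cocycle condition concern the same ring. *)
Let X : flat_groupoid := @FlatGroupoid A0 A1 (tensR R L) L R I1 I2 NB fL fR f12 f23 f13 e1 e2 e3.

(** * From comodules to descent data *)

Section ComodToDesc.
Context (M : comod_ob H).
Local Notation T := (tilde (co_mod M)).

Program Definition comod_s : modmor (pull fL T) (pull fR T) :=
  @Modmor (fppf A1) (pull fL T) (pull fR T) (fun W => mklin (semilin_linear
    (@transport_semilin H (co_mod M) (co_psi M) (fp_ring W) (fp_str W)
       (rcomp (fp_str W) L) (rcomp (fp_str W) R) (fun=> erefl) (fun=> erefl)))) _.
Next Obligation.
by move=> V U h m; apply/esym/tbase_transport => // b; exact: (fp_mapE h b).
Qed.

Fact kappaL (W : comPzRingType) (w : {rmorphism A1 -> W}) a :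
  rcomp w (kappa H) (L a) = rcomp w R a.
Proof. by rewrite /= kappa_etaL. Qed.
Fact kappaR (W : comPzRingType) (w : {rmorphism A1 -> W}) a :
  rcomp w (kappa H) (R a) = rcomp w L a.
Proof. by rewrite /= kappa_etaR. Qed.

(** Transport along the inverse of the tautological arrow over [W], hence in the direction opposite
    to [comod_s]. *)
Program Definition comod_t : modmor (pull fR T) (pull fL T) :=
  @Modmor (fppf A1) (pull fR T) (pull fL T) (fun W => mklin (semilin_linear
    (@transport_semilin H (co_mod M) (co_psi M) (fp_ring W) (rcomp (fp_str W) (kappa H))
       (rcomp (fp_str W) R) (rcomp (fp_str W) L) (kappaL _) (kappaR _)))) _.
Next Obligation.
move=> V U h m; apply/esym/tbase_transport=> [||b]; try exact: kappaL.
exact: (fp_mapE h (kappa H b)).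
Qed.

Lemma comod_tK W x : comod_s W (comod_t W x) = x.
Proof.
exact: (@transportVK H M _ (fp_str W) (rcomp (fp_str W) (kappa H)) (rcomp (fp_str W) L)
  (rcomp (fp_str W) R) (fun=> erefl) (fun=> erefl) (kappaL _) (kappaR _) (fun=> erefl)).
Qed.
Lemma comod_sK W x : comod_t W (comod_s W x) = x.
Proof.
exact: (@transportK H M _ (fp_str W) (rcomp (fp_str W) (kappa H)) (rcomp (fp_str W) L)
  (rcomp (fp_str W) R) (fun=> erefl) (fun=> erefl) (kappaL _) (kappaR _) (fun=> erefl)).
Qed.

Lemma comod_s_pure1 W m : comod_s W (pure _ 1 m) =
  @transport1 H (co_mod M) (co_psi M) _ (fp_str W) (rcomp (fp_str W) R) (fun=> erefl) m.
Proof. by apply: transport_pure1. Qed.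

Lemma comod_t_iso : mm_iso comod_t.
Proof.
exists comod_s; split; apply: modmor_eq => W x; [exact: comod_tK | exact: comod_sK].
Qed.

(** Transport composes in the direction of [comod_s]; the condition is proved there as [key] and
    then inverted. *)
Lemma comod_cocycle : @cocycle X T comod_t.
Proof.
apply: modmor_eq => Z x.
pose q1 := @fp_mapE _ _ _ (push_square fL f13 fL f12 e1 Z).
pose q2 := @fp_mapE _ _ _ (push_square fL f23 fR f12 e2 Z).
pose q2' := @fp_mapE _ _ _ (push_square fR f12 fL f23 (fun a => esym (e2 a)) Z).
pose q3 := @fp_mapE _ _ _ (push_square fR f23 fR f13 e3 Z).
pose q3' := @fp_mapE _ _ _ (push_square fR f13 fR f23 (fun a => esym (e3 a)) Z).
pose Z12 := fppf_push f12 Z; pose Z23 := fppf_push f23 Z; pose Z13 := fppf_push f13 Z.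
change (comod_t Z12 (tbase q2 (comod_t Z23 x)) = tbase q1 (comod_t Z13 (tbase q3 x))).
set y := comod_t Z13 _.
have key y' : comod_s Z23 (tbase q2' (comod_s Z12 (tbase q1 y'))) = tbase q3' (comod_s Z13 y').
  move: y'; apply: (tens_ext1 (g := id)) => [||m].
  - have h1 := semilin_comp (tbase_semilin q1 _) (linear_semilin (comod_s Z12)) (fun=> erefl).
    have h2 := semilin_comp h1 (tbase_semilin q2' _) (fun=> erefl).
    exact: (semilin_comp h2 (linear_semilin (comod_s Z23)) (fun=> erefl)).
  - exact: (semilin_comp (linear_semilin (comod_s Z13)) (tbase_semilin q3' _) (fun=> erefl)).
  have r2 a : fp_str Z12 (R a) = rcomp (fp_str Z23) L a := congr1 (fp_str Z) (esym (e2 a)).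
  have r3 a : fp_str Z13 (R a) = rcomp (fp_str Z23) R a := congr1 (fp_str Z) (esym (e3 a)).
  rewrite tbase_pure rmorph1 !comod_s_pure1.
  have t12 := @tbase_transport1 H _ (co_psi M) _ (fp_str Z12) (rcomp (fp_str Z12) R)
    (fun=> erefl) _ (rid _)
    (fp_str Z12) _ r2 q2' m (fun=> erefl).
  have t13 := @tbase_transport1 H _ (co_psi M) _ (fp_str Z13) (rcomp (fp_str Z13) R)
    (fun=> erefl) _ (rid _)
    (fp_str Z13) _ r3 q3' m (fun=> erefl).
  rewrite [RHS]t13; apply: (etrans (congr1 (comod_s Z23) t12)).
  apply: (transport_comp (@co_assoc _ M)) => [//|b].
  (* The arrows for [p_12] and [p_23] form the universal composable pair, so their copairing is the
     structure map of [Z] and their composite is the arrow for [p_13]. *)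
  exact: (tcopairE (h := fp_str Z)).
have -> : x = comod_s Z23 (tbase q2' (comod_s Z12 (tbase q1 y))).
  by rewrite key /y comod_tK tbase_inv.
by rewrite comod_sK tbase_inv comod_sK.
Qed.

Definition comod_desc : desc_ob X :=
  @DescOb X T (@tilde_sheaf _ _) (@tilde_qc _ _) comod_t comod_t_iso comod_cocycle.
End ComodToDesc.

Section TildeMor.
Context (M N : comod_ob H) (f : comod_hom M N).
Program Definition tilde_mor : modmor (tilde (co_mod M)) (tilde (co_mod N)) :=
  @Modmor (fppf A0) (tilde (co_mod M)) (tilde (co_mod N))
    (fun U => tmap (fp_str U) (co_map f)) _.
Next Obligation.
move=> V U h; apply: (tens_ext1 (g := fp_map h)) => [||m].
- exact: (semilin_comp (tbase_semilin _ _) (linear_semilin _) (fun=> erefl)).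
- exact: (semilin_comp (linear_semilin _) (tbase_semilin _ _) (fun=> erefl)).
- by rewrite /= tbase_pure !tmap_pure tbase_pure.
Qed.

Lemma tmap_transport1 (W : comPzRingType) (w : {rmorphism A1 -> W}) (r : {rmorphism A0 -> W})
  (er : forall a, w (R a) = r a) m :
  tmap r (co_map f) (transport1 (co_psi M) er m) = transport1 (co_psi N) er (co_map f m).
Proof.
rewrite /transport1 -co_mapE; move: (co_psi M m : coten (co_mod M)).
apply: (tens_ext1 (g := w)) => [||m'].
- exact: (semilin_comp (tbase_semilin _ _) (linear_semilin _) (fun=> erefl)).
- exact: (semilin_comp (linear_semilin _) (tbase_semilin _ _) (fun=> erefl)).
- by rewrite /= tbase_pure !tmap_pure tbase_pure.
Qed.

Lemma tilde_mor_comm :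
  mmcomp (pull_mor fL tilde_mor) (comod_t M) = mmcomp (comod_t N) (pull_mor fR tilde_mor).
Proof.
apply: modmor_eq => W; apply: (tens_ext1 (g := id)) => [||m].
- exact: linear_semilin.
- exact: linear_semilin.
rewrite /= tmap_pure; rewrite !transport_pure1; try exact: kappaL.
exact: tmap_transport1.
Qed.

Definition comod_desc_mor : desc_hom (comod_desc M) (comod_desc N) :=
  @DescHom X (comod_desc M) (comod_desc N) tilde_mor tilde_mor_comm.
End TildeMor.

Program Definition comod_to_desc : functor (comod H) (desc_qc X) :=
  @Functor (comod H) (desc_qc X) comod_desc comod_desc_mor _ _.
Next Obligation. by move=> M; apply: desc_hom_eq => U x; exact: tmap_id. Qed.
Next Obligation. by move=> M N P g f; apply: desc_hom_eq => U x; exact: tmap_comp. Qed.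

(** * From descent data to comodules *)

Section DescToComod.
Context (D : desc_ob X).
Local Notation G := (de_sh D).
Local Notation t := (de_t D).
Local Notation M := (G (fp_top A0) : lmodType A0).
Local Notation O1 := (fp_top A1).

Definition desc_qcG : qc_at G (fp_top A0) := quasi_coherent_qc_at (@de_sheaf X D) (de_qc D).

Definition resL (W : fppf A1) : M -> pull fL G W := mres (to_top (fppf_push fL W)).
Definition resR (W : fppf A1) : M -> pull fR G W := mres (to_top (fppf_push fR W)).

(** Asking only for pointwise equality with the structure map lets one ring be viewed over [A0]
    through different composites of face maps. *)
Lemma desc_qc_bc (U : fppf A0) (f : {rmorphism A0 -> fp_ring U}) :
  (forall a, fp_str U a = f a) -> is_bc f (mres (to_top U) : M -> G U).
Proof. by move=> /rmorph_eq <-; exact: desc_qcG. Qed.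

Lemma desc_resL_bc W (l : {rmorphism A0 -> fp_ring W}) :
  (forall a, fp_str W (L a) = l a) -> is_bc l (resL W).
Proof. exact: (@desc_qc_bc (fppf_push fL W)). Qed.
Lemma desc_resR_bc W (r : {rmorphism A0 -> fp_ring W}) :
  (forall a, fp_str W (R a) = r a) -> is_bc r (resR W).
Proof. exact: (@desc_qc_bc (fppf_push fR W)). Qed.

Lemma desc_t_inj W : injective (t W).
Proof.
have [t' [t'K _]] := de_iso D; move=> x y e.
have E z : t' W (t W z) = z := congr1 (fun f : modmor _ _ => f W z) t'K.
by rewrite -[x]E -[y]E e.
Qed.
Lemma desc_t_surj W y : exists x, t W x = y.
Proof.
have [t' [_ tK]] := de_iso D; exists (t' W y).
exact: (congr1 (fun f : modmor _ _ => f W y) tK).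
Qed.

(** Naturality of [t] along the map from [W] to the spectrum of [A1]: on base changes, [t] is
    determined by its value at [O1]. *)
Lemma desc_t_base (W : fppf A1) (r : {rmorphism A0 -> fp_ring W})
    (er : forall a, fp_str W (R a) = r a) (x : tens R M) :
  t W (bcmap r (resR W) (tbase er x)) =
  @mres _ (pull fL G) W O1 (to_top W) (t O1 (bcmap R (resR O1) x)).
Proof.
have sW := is_bc_semilin (desc_resR_bc er).
have s1 := is_bc_semilin (@desc_resR_bc O1 R (fun=> erefl)).
rewrite -mnat; congr (t W _); move: x; apply: (tens_ext1 (g := fp_str W)) => [||m].
- exact: (semilin_comp (tbase_semilin _ _) (bcmap_semilin sW) (fun=> erefl)).
- exact: (semilin_comp (bcmap_semilin s1) (mres_semilin (pull fR G) (to_top W)) (fun=> erefl)).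
rewrite tbase_pure rmorph1 !bcmap1 // /resR /= -mres_comp; congr mres; exact: to_top_uniq.
Qed.

Lemma desc_psi_ex (m : M) : {x : tens R M | t O1 (bcmap R (resR O1) x) = resL O1 m}.
Proof.
apply: cid; have [y yE] := desc_t_surj (resL O1 m).
have [_ _ /(_ y)[x xE]] := @desc_resR_bc O1 R (fun=> erefl).
by exists x; rewrite xE.
Qed.
Definition desc_psi_fun (m : M) : restr L (coten M) := sval (desc_psi_ex m).
Definition desc_psi_funE m : t O1 (bcmap R (resR O1) (desc_psi_fun m)) = resL O1 m :=
  svalP (desc_psi_ex m).
Lemma desc_psi_uniq (x y : tens R M) :
  t O1 (bcmap R (resR O1) x) = t O1 (bcmap R (resR O1) y) -> x = y.
Proof. by move=> /desc_t_inj /(is_bc_inj (@desc_resR_bc O1 R (fun=> erefl))). Qed.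
Lemma desc_psi_fun_linear : linear desc_psi_fun.
Proof.
move=> a x y; apply: desc_psi_uniq; rewrite desc_psi_funE.
have s1 := bcmap_semilin (is_bc_semilin (@desc_resR_bc O1 R (fun=> erefl))).
have s2 := semilin_comp s1 (linear_semilin (t O1)) (fun=> erefl).
have sL := is_bc_semilin (@desc_resL_bc O1 L (fun=> erefl)).
rewrite (semilinD sL) (semilinZ sL) -!desc_psi_funE.
by rewrite [RHS](semilinD s2) -[in LHS](semilinZ s2).
Qed.
Definition desc_psi : {linear M -> restr L (coten M)} := mklin desc_psi_fun_linear.

(** The defining equation of [desc_psi] carried to every [W], in particular to the spectrum of
    [A1 (x) A1] in its three guises over [A1]. *)
Lemma desc_t_base_psi (W : fppf A1) (r : {rmorphism A0 -> fp_ring W})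
    (er : forall a, fp_str W (R a) = r a) m :
  t W (bcmap r (resR W) (tbase er (desc_psi m : coten M))) = resL W m.
Proof.
rewrite desc_t_base desc_psi_funE /resL /= -mres_comp; congr mres; exact: to_top_uniq.
Qed.

Lemma desc_psi_assoc m : coten_nabla (desc_psi m) = coten_assoc (tmap R desc_psi (desc_psi m)).
Proof.
pose Z : fppf (fg2 X) := fp_top (tensR R L).
pose Z12 := fppf_push f12 Z; pose Z23 := fppf_push f23 Z; pose Z13 := fppf_push f13 Z.
pose q1 := push_square fL f13 fL f12 e1 Z.
pose q2 := push_square fL f23 fR f12 e2 Z.
pose q3 := push_square fR f23 fR f13 e3 Z.
pose q1' := push_square fL f12 fL f13 (fun a => esym (e1 a)) Z.
pose q3' := push_square fR f13 fR f23 (fun a => esym (e3 a)) Z.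
have coc g : t Z12 (mres q2 (t Z23 g)) = mres q1 (t Z13 (mres q3 g)).
  exact: (@mmcompE _ _ _ _ _ _ _ _ _ (de_cocycle D) Z g).
have r23 a : fp_str Z23 (R a) = rcomp I2 R a by [].
have r13 a : fp_str Z13 (R a) = rcomp I2 R a by rewrite [RHS]e3.
have b23 := desc_resR_bc r23; have b13 := desc_resR_bc r13.
have q1K g : mres q1' (mres q1 g) = g.
  by rewrite -mres_comp -[RHS]mres_id; congr mres; apply: fppf_hom_eq.
have q3K g : mres q3' (mres q3 g) = g.
  by rewrite -mres_comp -[RHS]mres_id; congr mres; apply: fppf_hom_eq.
(* The cocycle condition rewrites the composite through [p_12] and [p_23] as the one through [p_13],
   which is [t] between invertible identifications. *)
have inj g g' : t Z12 (mres q2 (t Z23 g)) = t Z12 (mres q2 (t Z23 g')) -> g = g'.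
  move=> e; rewrite -[g]q3K -[g']q3K; apply/(congr1 (mres q3'))/desc_t_inj.
  by rewrite -[LHS]q1K -[RHS]q1K; apply: (congr1 (mres q1')); rewrite -!coc.
apply: (is_bc_inj b23); apply: inj.
have resE (V U : fppf A0) (k : hom V U) (x : M) : mres k (mres (to_top U) x) = mres (to_top V) x.
  by rewrite -mres_comp; congr mres; exact: to_top_uniq.
have s23 := bcmap_semilin (is_bc_semilin b23).
have s13 := bcmap_semilin (is_bc_semilin b13).
have q3R x : mres q3 (bcmap (rcomp I2 R) (resR Z23) x) = bcmap (rcomp I2 R) (resR Z13) x.
  move: x; apply: (tens_ext1 (g := id)) => [||m'].
  - exact: (semilin_comp s23 (mres_semilin G q3) (fun=> erefl)).
  - exact: s13.
  by rewrite !bcmap1; [exact: resE | exact: is_bc_semilin b13 | exact: is_bc_semilin b23].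
have r12 a : fp_str Z12 (R a) = rcomp I1 R a by [].
have b12 := desc_resR_bc r12.
(* On generators, [t] over [p_23] turns [psi m'] into the restriction of [m'] along [p_1] after
   [p_23], which is its restriction along [p_2] after [p_12]; so [t] over [p_12] can be applied
   next. *)
have q2R x : mres q2 (t Z23 (bcmap (rcomp I2 R) (resR Z23) (coten_assoc (tmap R desc_psi x)))) =
    bcmap (rcomp I1 R) (resR Z12) (tbase r12 x).
  move: x; apply: (tens_ext1 (g := I1)) => [||m'].
  - have h1 := semilin_comp (linear_semilin (tmap R desc_psi)) (coten_assoc_semilin M)
      (fun=> erefl).
    have h2 := semilin_comp (semilin_comp h1 s23 (fun=> erefl)) (linear_semilin (t Z23))
      (fun=> erefl).
    exact: (semilin_comp h2 (mres_semilin G q2) (fun=> erefl)).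
  - exact: (semilin_comp (tbase_semilin _ _) (bcmap_semilin (is_bc_semilin b12)) (fun=> erefl)).
  rewrite tbase_pure rmorph1 (bcmap1 (is_bc_semilin b12)).
  rewrite [tmap _ _ _]tmap_pure coten_assoc_pure1.
  rewrite (desc_t_base_psi r23).
  exact: resE.
rewrite q2R (desc_t_base_psi r12) coc q3R (desc_t_base_psi r13); exact: resE.
Qed.

(** Since [eps] splits [etaL], the identity of [M] extends along [eps] to a retraction of [resL O1],
    and [resL O1 m] is determined by [psi m]. *)
Lemma desc_psi_inj : injective desc_psi.
Proof.
have bL := @desc_resL_bc O1 L (fun=> erefl).
have sid : semilin id (id : M -> M) by [].
have [w sw wE] := bc_extend (g := eps H) bL sid (fun a => esym (eps_etaL a)).
by move=> m m' e; rewrite -[m]wE -[m']wE -!desc_psi_funE [desc_psi_fun m]e.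
Qed.

Lemma desc_psi_unit m : coten_eps (desc_psi m) = m.
Proof.
have uv a : rcomp L (eps H) (R a) = rid A1 (L a) by rewrite /= eps_etaR.
(* Apply (etaL \o eps) (x) id to the coassociativity identity. *)
pose cop := tcopair_mor uv.
have copI2 a : cop (rcomp I2 R a) = R a := tcopair_inr uv (R a).
have cop_nabla x : tbase copI2 (coten_nabla x) = x.
  rewrite /coten_nabla (@tbase_tbase _ _ _ _ _ _ _ (rid A1) _ _ _ _ (fun=> erefl)).
    exact: tbase_id.
  exact: nabla_epsl.
have cop_assoc x : tbase copI2 (coten_assoc (tmap R desc_psi x)) = desc_psi (coten_eps x).
  move: x; apply: (tens_ext1 (g := rcomp L (eps H))) => [||m'].
  - have h1 := semilin_comp (linear_semilin (tmap R desc_psi)) (coten_assoc_semilin M)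
      (fun=> erefl).
    apply: (semilin_comp h1 (tbase_semilin copI2 M)) => b; exact: (esym (tcopair_inl uv b)).
  - exact: (semilin_comp (coten_eps_semilin M) (psi_semilin desc_psi) (fun=> erefl)).
  rewrite coten_eps_pure1 [tmap _ _ _]tmap_pure coten_assoc_pure1.
  rewrite (@tbase_tbase _ _ _ _ _ _ _ (rid A1) _ _ _ _ (fun=> erefl)).
    exact: tbase_id.
  by move=> b; exact: (tcopair_inr uv b).
by apply: desc_psi_inj; rewrite -cop_assoc -desc_psi_assoc cop_nabla.
Qed.

Definition desc_comod : comod_ob H := ComodOb desc_psi_assoc desc_psi_unit.
End DescToComod.

Section DescToComodMor.
Context (D E : desc_ob X) (h : desc_hom D E).
Local Notation O1 := (fp_top A1).

Lemma desc_comod_mor_comm m :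
  tmap R (de_h h (fp_top A0)) (desc_psi D m) = desc_psi E (de_h h (fp_top A0) m).
Proof.
apply: desc_psi_uniq; rewrite [RHS]desc_psi_funE.
have bD := @desc_resR_bc D O1 R (fun=> erefl); have bE := @desc_resR_bc E O1 R (fun=> erefl).
have -> : bcmap R (@resR E O1) (tmap R (de_h h (fp_top A0)) (desc_psi D m)) =
    de_h h (fppf_push fR O1) (bcmap R (@resR D O1) (desc_psi D m)).
  move: (desc_psi D m : coten _); apply: (tens_ext1 (g := id)) => [||m'].
  - exact: (semilin_comp (linear_semilin _) (bcmap_semilin (is_bc_semilin bE)) (fun=> erefl)).
  - exact: (semilin_comp (bcmap_semilin (is_bc_semilin bD)) (linear_semilin _) (fun=> erefl)).
  rewrite [tmap _ _ _]tmap_pure (bcmap1 (is_bc_semilin bE)) (bcmap1 (is_bc_semilin bD)).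
  by rewrite /resR mnat.
have := mmcompE (de_comm h) (bcmap R (@resR D O1) (desc_psi D m)).
by move=> /= <-; rewrite desc_psi_funE /resL mnat.
Qed.

Definition desc_comod_mor : comod_hom (desc_comod D) (desc_comod E) :=
  @ComodHom H (desc_comod D) (desc_comod E) (de_h h (fp_top A0)) desc_comod_mor_comm.
End DescToComodMor.

Program Definition desc_to_comod : functor (desc_qc X) (comod H) :=
  @Functor (desc_qc X) (comod H) desc_comod desc_comod_mor _ _.
Next Obligation. by move=> D; apply: comod_hom_eq. Qed.
Next Obligation. by move=> D E F g f; apply: comod_hom_eq. Qed.

(** * The natural isomorphisms of the two composites *)

Section DescCounit.
Context (D : desc_ob X).
Local Notation N := (co_mod (desc_comod D)).

Fact counit_bc (U : fppf A0) : is_bc (fp_str U) (mres (to_top U) : N -> de_sh D U).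
Proof. exact: desc_qcG. Qed.

Program Definition counit_mor : modmor (tilde N) (de_sh D) :=
  @Modmor (fppf A0) (tilde N) (de_sh D) (fun U => mklin (semilin_linear
    (bcmap_semilin (is_bc_semilin (counit_bc U))))) _.
Next Obligation.
move=> V U h; apply: (tens_ext1 (g := fp_map h)) => [||m].
- exact: (semilin_comp (tbase_semilin _ _) (bcmap_semilin (is_bc_semilin (counit_bc V)))
    (fun=> erefl)).
- exact: (semilin_comp (bcmap_semilin (is_bc_semilin (counit_bc U))) (mres_semilin (de_sh D) h)
    (fun=> erefl)).
rewrite /= tbase_pure rmorph1 !bcmap1; try exact: is_bc_semilin (counit_bc _).
by rewrite -mres_comp; congr mres; exact: to_top_uniq.
Qed.

Lemma counit_comm :
  mmcomp (pull_mor fL counit_mor) (comod_t (desc_comod D)) =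
  mmcomp (de_t D) (pull_mor fR counit_mor).
Proof.
apply: modmor_eq => W x.
(* Compatibility with the inverses, where it reduces on generators to the defining equation of
   [desc_psi]. *)
have key y : de_t D W (counit_mor (fppf_push fR W) (comod_s (desc_comod D) W y)) =
    counit_mor (fppf_push fL W) y.
  move: y; apply: (tens_ext1 (g := id)) => [||m].
  - have h1 := semilin_comp (linear_semilin (comod_s (desc_comod D) W))
      (linear_semilin (counit_mor (fppf_push fR W))) (fun=> erefl).
    exact: (semilin_comp h1 (linear_semilin (de_t D W)) (fun=> erefl)).
  - exact: linear_semilin.
  rewrite comod_s_pure1 [LHS]desc_t_base_psi /=.
  by rewrite bcmap1 //; exact: is_bc_semilin (counit_bc _).
change (counit_mor (fppf_push fL W) (comod_t (desc_comod D) W x) =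
  de_t D W (counit_mor (fppf_push fR W) x)).
by rewrite -key comod_tK.
Qed.

Definition desc_counit : @hom (desc_qc X) (comod_desc (desc_comod D)) D :=
  @DescHom X (comod_desc (desc_comod D)) D counit_mor counit_comm.
End DescCounit.

Lemma desc_counit_nat (D E : desc_qc X) (h : hom D E) :
  ccomp h (desc_counit D) =
  ccomp (desc_counit E) (fmor comod_to_desc (fmor desc_to_comod h)).
Proof.
apply: desc_hom_eq => U; apply: (tens_ext1 (g := id)) => [||m].
- exact: (semilin_comp (linear_semilin (de_h (desc_counit D) U)) (linear_semilin (de_h h U))
    (fun=> erefl)).
- exact: (semilin_comp (linear_semilin (tmap _ _))
    (linear_semilin (de_h (desc_counit E) U)) (fun=> erefl)).
rewrite /= tmap_pure !bcmap1; try exact: is_bc_semilin (counit_bc _ _).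
by rewrite mnat.
Qed.

(** An inverse chosen section by section is linear, natural and compatible with [t], because
    injectivity of [f] reflects each identity. *)
Lemma desc_iso (D E : desc_qc X) (f : hom D E) :
  (forall U, injective (de_h f U)) -> (forall U y, exists x, de_h f U x = y) ->
  exists g : hom E D, ccomp f g = idc E /\ ccomp g f = idc D.
Proof.
move=> fi fs; pose g U y := sval (cid (fs U y)).
have gK U y : de_h f U (g U y) = y by rewrite /g; case: cid.
have glin U : linear (g U) by move=> a x y; apply: fi; rewrite linearP !gK.
have gnat V U (k : hom V U) y : g V (mres k y) = mres k (g U y).
  by apply: fi; rewrite mnat !gK.
pose gm := @Modmor _ (de_sh E) (de_sh D) (fun U => mklin (glin U)) gnat.
have gc : mmcomp (pull_mor fL gm) (de_t E) = mmcomp (de_t D) (pull_mor fR gm).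
  apply: modmor_eq => W x /=; apply: fi; rewrite gK.
  have := mmcompE (de_comm f) (g (fppf_push fR W) x) => /= ->.
  by rewrite gK.
exists (@DescHom X E D gm gc).
by split; apply: desc_hom_eq => U x /=; [|apply: fi]; rewrite gK.
Qed.

Lemma comod_iso (M N : comod H) (f : hom M N) :
  injective (co_map f) -> (forall y, exists x, co_map f x = y) ->
  exists g : hom N M, ccomp f g = idc N /\ ccomp g f = idc M.
Proof.
move=> fi fs; pose g y := sval (cid (fs y)).
have gK y : co_map f (g y) = y by rewrite /g; case: cid.
have fK x : g (co_map f x) = x by apply: fi; rewrite gK.
have glin : linear g by move=> a x y; apply: fi; rewrite linearP !gK.
have gc y : tmap R (mklin glin) (co_psi N y) = co_psi M (g y).
  rewrite -{1}[y]gK -co_mapE -tmap_comp (_ : lcomp _ _ = lid _) ?tmap_id //.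
  by apply: lin_eq => x; exact: fK.
exists (@ComodHom H N M (mklin glin) gc).
by split; apply: comod_hom_eq => x /=.
Qed.

Section ComodUnit.
Context (M : comod_ob H).
Local Notation D := (comod_desc M).
Local Notation O1 := (fp_top A1).

Definition comod_unit_map : {linear co_mod M -> co_mod (desc_comod D)} :=
  mklin (semilin_linear (pure_semilin (rid A0) (co_mod M))).

Lemma comod_unit_comm m :
  tmap R comod_unit_map (co_psi M m) = desc_psi D (comod_unit_map m).
Proof.
apply: desc_psi_uniq; rewrite [RHS]desc_psi_funE.
have bR := @desc_resR_bc D O1 R (fun=> erefl).
have rr a : fp_str O1 (R a) = rcomp (fp_str O1) R a by [].
have E (x : coten (co_mod M)) : bcmap R (@resR D O1) (tmap R comod_unit_map x) =
    @tbase _ _ R _ (fp_str O1) (rcomp (fp_str O1) R) (co_mod M) rr x.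
  move: x; apply: (tens_ext1 (g := id)) => [||m'].
  - exact: (semilin_comp (linear_semilin _) (bcmap_semilin (is_bc_semilin bR)) (fun=> erefl)).
  - exact: tbase_semilin.
  rewrite [tmap _ _ _]tmap_pure (bcmap1 (is_bc_semilin bR)) tbase_pure rmorph1.
  by rewrite /resR /= tbase_pure rmorph1.
(* The base change of [psi m] is [comod_s] of [1 (x) m], which [comod_t] cancels. *)
rewrite E; apply: (etrans (congr1 (comod_t M O1) (esym (@comod_s_pure1 M O1 m)))).
rewrite comod_sK; apply: esym; rewrite /resL /=.
by rewrite [LHS]tbase_pure rmorph1.
Qed.

Definition comod_unit : @hom (comod H) M (desc_comod D) :=
  @ComodHom H M (desc_comod D) comod_unit_map comod_unit_comm.

Lemma comod_unit_inj : injective comod_unit_map.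
Proof.
have sid : semilin (rid A0) (id : co_mod M -> co_mod M) by [].
by move=> m m' /(congr1 (bcmap (rid A0) id)); rewrite !bcmap1.
Qed.
Lemma comod_unit_surj y : exists x, comod_unit_map x = y.
Proof.
have s := pure_semilin (rid A0) (co_mod M).
elim/tens_ind: y => [|b m|x x' [y <-] [y' <-]].
- by exists 0; exact: (semilin0 s).
- by exists (b *: m); rewrite [LHS](semilinZ s) [RHS]pureE.
- by exists (y + y'); exact: (semilinD s).
Qed.
End ComodUnit.

Lemma comod_unit_nat (M N : comod H) (f : hom M N) :
  ccomp (comod_unit N) f =
  ccomp (fmor desc_to_comod (fmor comod_to_desc f)) (comod_unit M).
Proof. by apply: comod_hom_eq => m /=; rewrite tmap_pure. Qed.

Theorem desc_equiv_comod : equivalent (desc_qc X) (comod H).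
Proof.
exists desc_to_comod, comod_to_desc; split.
  have ex (D : desc_qc X) : {g : hom D (comod_desc (desc_comod D)) |
      ccomp (desc_counit D) g = idc _ /\
      ccomp g (desc_counit D) = idc _}.
    apply: cid; apply: desc_iso => U.
      exact: is_bc_inj (counit_bc D U).
    by have [_ _] := counit_bc D U.
  exists desc_counit, (fun D => sval (ex D)); split.
  - by move=> D; have [] := svalP (ex D).
  - by move=> D; have [] := svalP (ex D).
  - exact: desc_counit_nat.
have ex (M : comod H) : {g : @hom (comod H) (desc_comod (comod_desc M)) M |
    ccomp (comod_unit M) g = idc _ /\
    ccomp g (comod_unit M) = idc _}.
  apply: cid; apply: comod_iso; [exact: comod_unit_inj | exact: comod_unit_surj].
exists (fun M => sval (ex M)), comod_unit; split.
- by move=> M; have [] := svalP (ex M).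
- by move=> M; have [] := svalP (ex M).
(* Naturality is known for the unit; composing with the inverses on both sides transfers it to
   them. *)
move=> M N f; have [gM _] := svalP (ex M); have [_ gN] := svalP (ex N).
move: (sval (ex M)) (sval (ex N)) gM gN => eM eN gM gN.
by rewrite -[LHS]compc1l -gN -compcA (compcA _ f) comod_unit_nat -!compcA gM compc1r.
Qed.
End Equivalence.

Theorem theorem5p8 (S : scheme) (X : geometric_stack S) (U : aff S) (x : X U)
    (hx : presentation x) (c : cech x) :
  equivalent (desc_qc (cech_groupoid c hx)) (comod (cech_hopf c)).
Proof.
have e12 : af_map (fpr (ce_q12 c)) = tinl (af_map (fpr (ce_q2 c))) (af_map (fpr (ce_q1 c))).
  by apply: rmorph_eq; exact: ce_inl.
have e23 : af_map (fpr (ce_q23 c)) = tinr (af_map (fpr (ce_q2 c))) (af_map (fpr (ce_q1 c))).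
  by apply: rmorph_eq; exact: ce_inr.
rewrite /cech_groupoid.
(* The flatness and face proofs mention [ce_q12] and [ce_q23], so they are generalized before these
   maps are replaced by the coprojections. *)
move: (fibre_product_flat hx (@cech_fp12 _ _ _ _ c)) (fibre_product_flat hx (@cech_fp23 _ _ _ _ c))
  (@cech_face1 _ _ _ _ c) (@cech_face2 _ _ _ _ c) (@cech_face3 _ _ _ _ c).
rewrite e12 e23 => f12 f23 g1 g2 g3.
exact: (@desc_equiv_comod (cech_hopf c)).
Qed.
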